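(* Suppose that $b,y\in\mathbb{C}$, $\Re(c)>\Re(a)>0$, $x\in\mathbb{C}$ with $x\neq 1$, $|\arg(1-x)|<\pi$, and $\lambda\in\mathbb{R}$. Then as $|\lambda|\to\infty$, $$\Phi_1[a,b;c;x,y+i\lambda]\sim\frac{\Gamma(c)}{\Gamma(c-a)}\sum_{n=0}^{\infty}\frac{y^n}{n!}\,F_n\!\left(a-c+1,b;-\frac1y,-\frac xy\right)(a)_n(-i\lambda)^{-a-n}+\frac{\Gamma(c)}{\Gamma(a)}(1-x)^{-b}e^{y+i\lambda}\sum_{n=0}^{\infty}\frac{(-y)^n}{n!}\,F_n\!\left(1-a,b;\frac1y,\frac{x}{y(x-1)}\right)(c-a)_n(i\lambda)^{a-c-n},$$ where $F_n(\alpha,\beta;u,v)$ is the terminating Kamp\'e de F\'eriet polynomial $$F_n(\alpha,\beta;u,v)=F_{0:0;0}^{1:1;1}\left[\begin{matrix}-n:\ \alpha;\ \beta\\ -:\ -;\ -\end{matrix};u,v\right]=\sum_{r=0}^{n}\sum_{s=0}^{n-r}(-n)_{r+s}(\alpha)_r(\beta)_s\frac{u^r}{r!}\frac{v^s}{s!}.$$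
   Context: $(\alpha)_n=\Gamma(\alpha+n)/\Gamma(\alpha)$ is the Pochhammer symbol, ${}_2F_1$ the principal branch of the Gauss hypergeometric function, powers take principal values; $x,y$ and the parameters are fixed. The sign $\sim$ denotes a compound asymptotic expansion: truncating both series after the first $N$ terms leaves an error of the order of the first neglected terms, $\mathcal{O}(|\lambda|^{-\Re(a)-N})+\mathcal{O}(|\lambda|^{\Re(a-c)-N})$. The Humbert function $\Phi_1$ is defined for $|x|<1$, $y\in\mathbb{C}$ by $$\Phi_1[a,b;c;x,y]=\sum_{m,n=0}^{\infty}\frac{(a)_{m+n}(b)_m}{(c)_{m+n}}\frac{x^m}{m!}\frac{y^n}{n!},$$ and is continued analytically to all $x\in\mathbb{C}\setminus[1,\infty)$, $y\in\mathbb{C}$ by $$\Phi_1[a,b;c;x,y]=\sum_{n=0}^{\infty}\frac{(a)_n}{(c)_n}\,{}_2F_1\left[\begin{matrix}a+n,b\\ c+n\end{matrix};x\right]\frac{y^n}{n!}.$$ For $y=0$ the products $y^nF_n(\alpha,\beta;-\frac1y,-\frac xy)$ and $(-y)^nF_n(\alpha,\beta;\frac1y,\frac{x}{y(x-1)})$, which are polynomials in $y$, are understood by continuity. *)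

(* Defs.v *)
From Stdlib Require Import Reals ZArith ClassicalEpsilon.
From Coquelicot Require Import Coquelicot.

Open Scope R_scope.
Open Scope C_scope.

Definition Cexp (z : C) : C :=
  (exp (Re z) * cos (Im z), exp (Re z) * sin (Im z))%R.

(* Principal argument, with values in (-PI, PI]; meaningless at 0. *)
Definition Carg (z : C) : R :=
  if Rle_dec 0 (Im z) then acos (Re z / Cmod z) else (- acos (Re z / Cmod z))%R.

Definition Clog (z : C) : C := (ln (Cmod z), Carg z).

(* Principal value of z^w, for z <> 0. *)
Definition Cpower (z w : C) : C := Cexp (w * Clog z).

Definition Cfact (n : nat) : C := RtoC (INR (fact n)).

(* The sum of the first N terms (sum_n f n has n+1 terms). *)
Definition partial_sum (f : nat -> C) (N : nat) : C :=
  match N with O => 0 | S n => sum_n f n end.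

Definition CSeries (u : nat -> C) : C :=
  (Series (fun n => Re (u n)), Series (fun n => Im (u n))).

(* (alpha)_n as a rising factorial: equal to Gamma(alpha+n)/Gamma(alpha)
   wherever that quotient makes sense, and its usual value when alpha is a
   nonpositive integer. *)
Fixpoint poch (alpha : C) (n : nat) : C :=
  match n with
  | O => 1
  | S k => poch alpha k * (alpha + RtoC (INR k))
  end.

(* Euler's integral, convergent for Re z > 0. *)
Definition Gamma_integral (z : C) : C :=
  RInt_gen (V := C_R_CompleteNormedModule)
    (fun t : R => Cpower (RtoC t) (z - 1) * RtoC (exp (- t)))
    (at_right 0) (Rbar_locally p_infty).

(* Gamma z = Gamma (z + k) / (z)_k, where k is the least natural number with
   Re (z + k) > 0; in particular k = 0 when Re z > 0. *)
Definition CGamma (z : C) : C :=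
  let k := Z.to_nat (up (- Re z)) in
  Gamma_integral (z + RtoC (INR k)) / poch z k.

Definition analytic_at (f : C -> C) (z : C) : Prop :=
  exists (u : nat -> C) (r : R), (0 < r)%R /\
    forall h : C, (Cmod h < r)%R ->
      is_pseries (K := C_AbsRing) (V := C_NormedModule) u h (f (z + h)).

(* C minus [1, +oo). *)
Definition slit_plane (z : C) : Prop := ~ (Im z = 0%R /\ (1 <= Re z)%R).

(* f is the analytic continuation of the Gauss series to the slit plane; by
   the identity theorem this determines f there. *)
Definition is_principal_2F1 (a b c : C) (f : C -> C) : Prop :=
  (forall z, slit_plane z -> analytic_at f z) /\
  (forall z, (Cmod z < 1)%R ->
     is_pseries (K := C_AbsRing) (V := C_NormedModule)
       (fun n => poch a n * poch b n / poch c n / Cfact n) z (f z)).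

Definition hyp2F1 (a b c : C) : C -> C :=
  epsilon (inhabits (fun _ => RtoC 0)) (is_principal_2F1 a b c).

(* The double series converges absolutely for |x| < 1 (and c not a nonpositive
   integer), so that it may be summed iteratively. *)
Definition Phi1_double_series (a b c x y : C) : C :=
  CSeries (fun n => CSeries (fun m =>
    poch a (m + n) * poch b m / poch c (m + n)
      * (x ^ m / Cfact m) * (y ^ n / Cfact n))).

Definition Phi1_continuation (a b c x y : C) : C :=
  CSeries (fun n =>
    poch a n / poch c n
      * hyp2F1 (a + RtoC (INR n)) b (c + RtoC (INR n)) x * (y ^ n / Cfact n)).

Definition Phi1 (a b c x y : C) : C :=
  if Rlt_dec (Cmod x) 1 then Phi1_double_series a b c x y
  else Phi1_continuation a b c x y.

Definition KdF (n : nat) (alpha beta u v : C) : C :=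
  sum_n (fun r => sum_n (fun s =>
    poch (- RtoC (INR n)) (r + s) * poch alpha r * poch beta s
      * (u ^ r / Cfact r) * (v ^ s / Cfact s)) (n - r)%nat) n.

(* The value at y of g extended to 0 by continuity. *)
Definition extend0 (g : C -> C) (y : C) : C :=
  if Ceq_dec y 0 then C_lim g 0 else g y.

Definition coef_origin (a b c x y : C) (n : nat) : C :=
  extend0 (fun y => y ^ n * KdF n (a - c + 1) b (- (1 / y)) (- (x / y))) y
    / Cfact n.

Definition coef_one (a b x y : C) (n : nat) : C :=
  extend0 (fun y => (- y) ^ n * KdF n (1 - a) b (1 / y) (x / (y * (x - 1)))) y
    / Cfact n.

(* Main.v *)
Require Import Defs.
From Stdlib Require Import Reals Lra Lia ZArith ClassicalEpsilon.
From Coquelicot Require Import Coquelicot.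
Open Scope R_scope.

(** Put d = c - a.  Euler's integral represents the Humbert function as
    1 / B(a, d) times the integral over (0, 1) of
      t^(a-1) (1-t)^(d-1) (1-xt)^(-b) e^(yt),
    and with y + i lambda in place of y this is an oscillatory integral whose only
    critical points are the endpoints 0 and 1, where the integrand has algebraic
    singularities.  The two series of the theorem are the contributions of these
    endpoints.

    The integrand is holomorphic in a thin rectangle around the open interval, since
    1 - xt stays off the cut.  There it has a primitive ([star_primitive]), so the
    interval may be replaced by the two sides of a flat triangle with apex
    1/2 + i v, the sign of v being that of lambda ([humbert_integral_deformed]).
    Along the side issued from 0 the exponential decays like e^(-|lambda v| s).  The
    remaining factors have a Taylor expansion with a remainder bounded on the whole
    side, obtained by multiplying the expansions of (1-z)^(d-1), (1-xz)^(-b) and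
    e^(yz).  Watson's lemma ([watson]) integrates it term by term:
    the integral of z^(a+n-1) e^(i lambda z) along the completed ray is
    Gamma(a+n) (-i lambda)^(-a-n), by rotation of Euler's Gamma integral
    ([nint_Gamma_ray]), and both the completion and the Taylor remainder cost
    O(|lambda|^(-Re a - N)).  The side issued from 1 is the same after the reflection
    t -> 1 - t, which exchanges a and d, replaces lambda by - lambda and extracts the
    factor e^(y + i lambda).  The Taylor coefficients of a product of two binomial
    series and an exponential are the Kampe de Feriet polynomials up to the factors
    y^n / n! ([KdF_taylor]).

    Euler's representation itself follows by termwise integration.  For |x| >= 1 the
    Gauss function is only characterised as an analytic continuation; Euler's
    integral is one ([euler_is_principal_2F1]), and continuations are unique on the
    star-shaped slit plane ([identity_theorem_slit]).  The constants are supplied by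
    B(a, d) = Gamma(a) Gamma(d) / Gamma(a + d) with nonzero Gamma values
    ([Beta_Gamma], [CGamma_neq_0]); both come from Gauss's product formula, that is,
    from the limit of n^a B(a, n + 1).

    Integrals are handled through antiderivatives with limits at the ends of an open
    interval ([is_nint]), and every remainder estimate is an instance of the mean
    value inequality for curves. *)


(** * Complex numbers, curves and limits *)

Lemma C_ext (z w : C) : fst z = fst w -> snd z = snd w -> z = w.
Proof. destruct z, w; simpl; congruence. Qed.

Lemma Cmod_minus_sym (z w : C) : Cmod (z - w) = Cmod (w - z).
Proof. rewrite <- (Cmod_opp (w - z)). f_equal. ring. Qed.

Lemma Cmod_minus_le (z w : C) : Cmod (z - w) <= Cmod z + Cmod w.
Proof.
  replace (z - w)%C with (z + - w)%C by ring.
  rewrite <- (Cmod_opp w). apply Cmod_triangle.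
Qed.

Lemma Cmod_diff_ge (z w : C) : Cmod z - Cmod w <= Cmod (z - w).
Proof.
  pose proof (Cmod_triangle (z - w) w) as H.
  replace (z - w + w)%C with z in H by ring. lra.
Qed.

Lemma Cmod_le_abs (z : C) : Cmod z <= Rabs (fst z) + Rabs (snd z).
Proof.
  replace z with (RtoC (fst z) + Ci * RtoC (snd z))%C at 1
    by (apply C_ext; simpl; ring).
  eapply Rle_trans; [apply Cmod_triangle|].
  rewrite Cmod_mult, Cmod_Ci, !Cmod_R. lra.
Qed.

Lemma snd_le_Cmod (z : C) : Rabs (snd z) <= Cmod z.
Proof. eapply Rle_trans; [apply Rmax_r|apply Rmax_Cmod]. Qed.

Lemma fst_le_Cmod (z : C) : Rabs (fst z) <= Cmod z.
Proof. eapply Rle_trans; [apply Rmax_l|apply Rmax_Cmod]. Qed.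

Lemma dot_le_Cmod (z w : C) : fst z * fst w + snd z * snd w <= Cmod z * Cmod w.
Proof.
  pose proof (fst_le_Cmod (Cconj z * w)) as H.
  rewrite Cmod_mult, Cmod_conj in H. simpl in H.
  pose proof (Rle_abs (fst z * fst w - - snd z * snd w)). lra.
Qed.

Lemma Cmod_sqr (z : C) : Cmod z * Cmod z = fst z * fst z + snd z * snd z.
Proof.
  unfold Cmod. rewrite sqrt_sqrt; [ring|]. nra.
Qed.

(** Derivatives of plane curves are taken by coordinates, so that differentiation
    rules, primitives and limits reduce to those of real functions. *)
Definition cder (f : R -> C) (t : R) (v : C) : Prop :=
  is_derive (fun s => fst (f s)) t (fst v) /\
  is_derive (fun s => snd (f s)) t (snd v).

Lemma is_derive_val (f : R -> R) (x l l' : R) :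
  is_derive f x l -> l = l' -> is_derive f x l'.
Proof. intros H <-. exact H. Qed.

Lemma cder_val (f : R -> C) t v w : cder f t v -> v = w -> cder f t w.
Proof. intros H <-. exact H. Qed.

Lemma cder_ext (f g : R -> C) t v :
  (forall s, f s = g s) -> cder f t v -> cder g t v.
Proof.
  intros E [H1 H2]; split; eapply is_derive_ext; try eassumption;
    intros s; simpl; rewrite E; reflexivity.
Qed.

Lemma cder_ext_loc (f g : R -> C) t v :
  locally t (fun s => f s = g s) -> cder f t v -> cder g t v.
Proof.
  intros E [H1 H2]; split;
    (eapply is_derive_ext_loc; [|eassumption]);
    (eapply filter_imp; [|exact E]); intros s ->; reflexivity.
Qed.

Lemma cder_const z t : cder (fun _ => z) t 0%C.
Proof. split; simpl; apply (is_derive_const (K := R_AbsRing) (V := R_NormedModule)). Qed.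

Lemma cder_RtoC (f : R -> R) t l : is_derive f t l -> cder (fun s => RtoC (f s)) t (RtoC l).
Proof.
  intros H; split; simpl; [exact H|].
  apply (is_derive_const (K := R_AbsRing) (V := R_NormedModule)).
Qed.

Lemma cder_id t : cder (fun s => RtoC s) t 1%C.
Proof.
  apply (cder_RtoC (fun s => s)).
  apply (is_derive_id (K := R_AbsRing)).
Qed.

Lemma cder_plus f g t v w :
  cder f t v -> cder g t w -> cder (fun s => f s + g s)%C t (v + w)%C.
Proof.
  intros [H1 H2] [H3 H4]; split; simpl;
  [exact (is_derive_plus _ _ _ _ _ H1 H3)|exact (is_derive_plus _ _ _ _ _ H2 H4)].
Qed.

Lemma cder_opp f t v : cder f t v -> cder (fun s => - f s)%C t (- v)%C.
Proof.
  intros [H1 H2]; split; simpl;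
  [exact (is_derive_opp _ _ _ H1)|exact (is_derive_opp _ _ _ H2)].
Qed.

Lemma cder_minus f g t v w :
  cder f t v -> cder g t w -> cder (fun s => f s - g s)%C t (v - w)%C.
Proof. intros H1 H2. apply cder_plus; [exact H1|]. apply cder_opp, H2. Qed.

Lemma cder_mult f g t v w :
  cder f t v -> cder g t w -> cder (fun s => f s * g s)%C t (v * g t + f t * w)%C.
Proof.
  intros [H1 H2] [H3 H4]; split; simpl.
  - pose proof (is_derive_minus _ _ _ _ _
      (is_derive_mult _ _ t _ _ H1 H3 Rmult_comm)
      (is_derive_mult _ _ t _ _ H2 H4 Rmult_comm)) as H.
    eapply is_derive_val; [exact H|].
    unfold minus, plus, opp, mult; simpl. ring.
  - pose proof (is_derive_plus _ _ _ _ _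
      (is_derive_mult _ _ t _ _ H1 H4 Rmult_comm)
      (is_derive_mult _ _ t _ _ H2 H3 Rmult_comm)) as H.
    eapply is_derive_val; [exact H|].
    unfold plus, mult; simpl. ring.
Qed.

Lemma cder_scal z f t v : cder f t v -> cder (fun s => z * f s)%C t (z * v)%C.
Proof.
  intros H. eapply cder_val; [apply cder_mult; [apply cder_const|exact H]|]. cbv beta; ring.
Qed.

Lemma cder_comp f g t v l :
  cder f (g t) v -> is_derive g t l -> cder (fun s => f (g s)) t (RtoC l * v)%C.
Proof.
  intros [H1 H2] Hg; split.
  - eapply is_derive_val; [exact (is_derive_comp _ _ _ _ _ H1 Hg)|].
    unfold scal; simpl; unfold mult; simpl; ring.
  - eapply is_derive_val; [exact (is_derive_comp _ _ _ _ _ H2 Hg)|].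
    unfold scal; simpl; unfold mult; simpl; ring.
Qed.

Lemma cder_cont f t v (eps : R) : cder f t v -> 0 < eps ->
  locally t (fun s => Cmod (f s - f t) < eps).
Proof.
  intros [H1 H2] He.
  assert (He2 : 0 < eps / 2) by lra.
  pose proof (ex_derive_continuous _ _ (ex_intro _ _ H1)) as C1.
  pose proof (ex_derive_continuous _ _ (ex_intro _ _ H2)) as C2.
  apply (proj1 (filterlim_locally _ _)) with (eps := mkposreal _ He2) in C1.
  apply (proj1 (filterlim_locally _ _)) with (eps := mkposreal _ He2) in C2.
  generalize (filter_and _ _ C1 C2). apply filter_imp.
  intros s [B1 B2].
  change (Rabs (fst (f s) - fst (f t)) < eps / 2) in B1.
  change (Rabs (snd (f s) - snd (f t)) < eps / 2) in B2.
  eapply Rle_lt_trans; [apply Cmod_le_abs|].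
  simpl. unfold Rminus in B1, B2. lra.
Qed.

Lemma is_derive_le (G : R -> R) (g : R -> R) (x y : R) :
  x <= y -> (forall t, x <= t <= y -> is_derive G t (g t)) ->
  (forall t, x <= t <= y -> 0 <= g t) -> G x <= G y.
Proof.
  intros Hxy HG Hg.
  destruct (MVT_gen G x y g) as [c [Hc E]].
  - intros t Ht. rewrite Rmin_left, Rmax_right in Ht by lra. apply HG; lra.
  - intros t Ht. rewrite Rmin_left, Rmax_right in Ht by lra.
    apply derivable_continuous_pt. exists (g t). apply is_derive_Reals, HG; lra.
  - rewrite Rmin_left, Rmax_right in Hc by lra.
    pose proof (Hg c Hc). nra.
Qed.

(** Testing the increment of the curve against its own direction reduces the
    inequality to the monotonicity of one real function. *)
Lemma mean_value_inequality (F f : R -> C) (G g : R -> R) (x y : R) :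
  x <= y ->
  (forall t, x <= t <= y -> cder F t (f t)) ->
  (forall t, x <= t <= y -> is_derive G t (g t)) ->
  (forall t, x <= t <= y -> Cmod (f t) <= g t) ->
  Cmod (F y - F x) <= G y - G x.
Proof.
  intros Hxy HF HG Hb.
  set (D := (F y - F x)%C).
  assert (M : (fun t => Cmod D * G t - (fst D * fst (F t) + snd D * snd (F t))) x <=
              (fun t => Cmod D * G t - (fst D * fst (F t) + snd D * snd (F t))) y).
  { apply (is_derive_le (fun t => Cmod D * G t - (fst D * fst (F t) + snd D * snd (F t)))
      (fun t => Cmod D * g t - (fst D * fst (f t) + snd D * snd (f t)))).
    - exact Hxy.
    - intros t Ht. destruct (HF t Ht) as [H1 H2]. specialize (HG t Ht).
      eapply is_derive_val.
      + exact (is_derive_minus _ _ _ _ _ (is_derive_scal _ _ (Cmod D) _ HG)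
          (is_derive_plus _ _ _ _ _ (is_derive_scal _ _ (fst D) _ H1)
             (is_derive_scal _ _ (snd D) _ H2))).
      + reflexivity.
    - intros t Ht. pose proof (dot_le_Cmod D (f t)). specialize (Hb t Ht).
      pose proof (Cmod_ge_0 D). nra. }
  cbv beta in M.
  assert (P : G x <= G y).
  { apply is_derive_le with (g := g); auto.
    intros t Ht. eapply Rle_trans; [apply Cmod_ge_0|apply Hb, Ht]. }
  pose proof (Cmod_sqr D) as S.
  assert (S1 : fst D = fst (F y) - fst (F x)) by (unfold D; simpl; ring).
  assert (S2 : snd D = snd (F y) - snd (F x)) by (unfold D; simpl; ring).
  clearbody D.
  destruct (Req_dec (Cmod D) 0) as [Z|Z]; [lra|].
  pose proof (Cmod_ge_0 D).
  apply Rmult_le_reg_l with (Cmod D); [lra|].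
  replace (fst (F y)) with (fst (F x) + fst D) in M by lra.
  replace (snd (F y)) with (snd (F x) + snd D) in M by lra. lra.
Qed.

Lemma mean_value_bound (F f : R -> C) (K : R) :
  (forall t, 0 <= t <= 1 -> cder F t (f t)) ->
  (forall t, 0 <= t <= 1 -> Cmod (f t) <= K) -> Cmod (F 1 - F 0) <= K.
Proof.
  intros HF HK. replace K with (K * 1 - K * 0) by ring.
  apply (mean_value_inequality F f (fun t => K * t) (fun _ => K)); auto; [lra|].
  intros t _. eapply is_derive_val; [apply is_derive_scal, (is_derive_id (K := R_AbsRing))|].
  unfold one; simpl; ring.
Qed.

Definition clim {T} (Ft : (T -> Prop) -> Prop) (F : T -> C) (l : C) : Prop :=
  forall eps, 0 < eps -> Ft (fun x => Cmod (F x - l) < eps).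

Lemma clim_ext_loc {T} Ft {FF : Filter Ft} (F G : T -> C) l :
  Ft (fun x => F x = G x) -> clim Ft F l -> clim Ft G l.
Proof.
  intros E H eps He. specialize (H eps He).
  generalize (filter_and _ _ E H). apply filter_imp. intros x [<- K]; exact K.
Qed.

Lemma clim_const {T} Ft {FF : Filter Ft} (l : C) : clim (T := T) Ft (fun _ => l) l.
Proof.
  intros eps He. apply filter_forall. intros _.
  replace (l - l)%C with (RtoC 0) by ring. rewrite Cmod_0. exact He.
Qed.

Lemma clim_plus {T} Ft {FF : Filter Ft} (F G : T -> C) l m :
  clim Ft F l -> clim Ft G m -> clim Ft (fun x => F x + G x)%C (l + m)%C.
Proof.
  intros H1 H2 eps He. assert (He2 : 0 < eps / 2) by lra.
  generalize (filter_and _ _ (H1 _ He2) (H2 _ He2)). apply filter_imp.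
  intros x [A B].
  replace (F x + G x - (l + m))%C with ((F x - l) + (G x - m))%C by ring.
  eapply Rle_lt_trans; [apply Cmod_triangle|lra].
Qed.

Lemma clim_scal {T} Ft {FF : Filter Ft} (F : T -> C) z l :
  clim Ft F l -> clim Ft (fun x => z * F x)%C (z * l)%C.
Proof.
  intros H eps He. pose proof (Cmod_ge_0 z).
  assert (He2 : 0 < eps / (Cmod z + 1)) by (apply Rdiv_lt_0_compat; lra).
  generalize (H _ He2). apply filter_imp. intros x A.
  replace (z * F x - z * l)%C with (z * (F x - l))%C by ring.
  rewrite Cmod_mult.
  apply Rle_lt_trans with ((Cmod z) * (eps / (Cmod z + 1))).
  - apply Rmult_le_compat_l; lra.
  - replace eps with ((Cmod z + 1) * (eps / (Cmod z + 1))) at 2 by (field; lra). nra.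
Qed.

Lemma clim_minus {T} Ft {FF : Filter Ft} (F G : T -> C) l m :
  clim Ft F l -> clim Ft G m -> clim Ft (fun x => F x - G x)%C (l - m)%C.
Proof.
  intros H1 H2.
  apply clim_ext_loc with (F := fun x => (F x + (- 1) * G x)%C); auto.
  - apply filter_forall. intros x. ring.
  - replace (l - m)%C with (l + (- 1) * m)%C by ring.
    apply clim_plus; auto. apply clim_scal; auto.
Qed.

Lemma clim_mult {T} Ft {FF : Filter Ft} (F G : T -> C) l m :
  clim Ft F l -> clim Ft G m -> clim Ft (fun x => F x * G x)%C (l * m)%C.
Proof.
  intros H1 H2 eps He.
  pose proof (Cmod_ge_0 l) as Pl. pose proof (Cmod_ge_0 m) as Pm.
  set (K := Cmod l + Cmod m + 1).
  assert (Kp : 0 < K) by (unfold K; lra).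
  set (e := Rmin 1 (eps / (K + 1))).
  assert (0 < eps / (K + 1)) by (apply Rdiv_lt_0_compat; lra).
  assert (e0 : 0 < e) by (unfold e; apply Rmin_glb_lt; lra).
  assert (e1 : e <= 1) by apply Rmin_l.
  assert (e2 : e <= eps / (K + 1)) by apply Rmin_r.
  generalize (filter_and _ _ (H1 _ e0) (H2 _ e0)). apply filter_imp.
  intros x [A B].
  replace (F x * G x - l * m)%C
    with ((F x - l) * (G x - m) + l * (G x - m) + m * (F x - l))%C by ring.
  eapply Rle_lt_trans; [apply Cmod_triangle|].
  eapply Rle_lt_trans; [apply Rplus_le_compat_r, Cmod_triangle|].
  rewrite !Cmod_mult.
  pose proof (Cmod_ge_0 (F x - l)). pose proof (Cmod_ge_0 (G x - m)).
  apply Rle_lt_trans with (e * K).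
  - unfold K. nra.
  - apply Rle_lt_trans with (eps / (K + 1) * K).
    + apply Rmult_le_compat_r; lra.
    + replace eps with (eps / (K + 1) * (K + 1)) at 2 by (field; lra). nra.
Qed.

Lemma clim_unique {T} Ft {FF : ProperFilter Ft} (F : T -> C) l m :
  clim Ft F l -> clim Ft F m -> l = m.
Proof.
  intros H1 H2.
  destruct (Req_dec (Cmod (l - m)) 0) as [Z|Z].
  { apply Cmod_eq_0 in Z. replace l with (l - m + m)%C by ring. rewrite Z. ring. }
  exfalso. pose proof (Cmod_ge_0 (l - m)).
  assert (He : 0 < Cmod (l - m) / 2) by lra.
  destruct (filter_ex _ (filter_and _ _ (H1 _ He) (H2 _ He))) as [x [A B]].
  rewrite Cmod_minus_sym in A.
  pose proof (Cmod_triangle (l - F x) (F x - m)) as T0.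
  replace (l - F x + (F x - m))%C with (l - m)%C in T0 by ring. lra.
Qed.

Lemma clim_close {T} Ft {FF : Filter Ft} (F G : T -> C) l :
  clim Ft (fun x => F x - G x)%C 0%C -> clim Ft G l -> clim Ft F l.
Proof.
  intros H1 H2.
  apply clim_ext_loc with (F := fun x => (F x - G x + G x)%C); auto.
  - apply filter_forall. intros; ring.
  - replace l with (0 + l)%C by ring. apply clim_plus; auto.
Qed.

Lemma clim_Cmod_le {T} Ft {FF : ProperFilter Ft} (F : T -> C) l (g : T -> R) lg :
  clim Ft F l -> filterlim g Ft (locally lg) -> Ft (fun x => Cmod (F x) <= g x) ->
  Cmod l <= lg.
Proof.
  intros H1 H2 H3. apply Rnot_lt_le. intros L.
  set (e := (Cmod l - lg) / 2). assert (e0 : 0 < e) by (unfold e; lra).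
  apply (proj1 (filterlim_locally _ _)) with (eps := mkposreal _ e0) in H2.
  destruct (filter_ex _ (filter_and _ _ (filter_and _ _ (H1 _ e0) H2) H3))
    as [x [[A B] D]].
  change (Rabs (g x - lg) < e) in B. apply Rabs_def2 in B.
  pose proof (Cmod_diff_ge l (F x)). rewrite Cmod_minus_sym in A. unfold e in *. lra.
Qed.

Lemma clim_RtoC {T} Ft {FF : Filter Ft} (g : T -> R) lg :
  clim Ft (fun x => RtoC (g x)) (RtoC lg) <-> filterlim g Ft (locally lg).
Proof.
  split; intros H.
  - apply filterlim_locally. intros eps.
    generalize (H eps (cond_pos eps)). apply filter_imp. intros x A.
    rewrite <- RtoC_minus, Cmod_R in A. exact A.
  - intros eps He.
    apply (proj1 (filterlim_locally _ _)) with (eps := mkposreal _ He) in H.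
    revert H. apply filter_imp. intros x A. rewrite <- RtoC_minus, Cmod_R. exact A.
Qed.

Lemma filterlim_Re {T} Ft {FF : Filter Ft} (F : T -> C) l :
  clim Ft F l -> filterlim (fun t => fst (F t)) Ft (locally (fst l)).
Proof.
  intros Hl. apply filterlim_locally. intros eps.
  generalize (Hl eps (cond_pos eps)). apply filter_imp. intros x A.
  change (Rabs (fst (F x) - fst l) < eps).
  eapply Rle_lt_trans; [|exact A]. apply (fst_le_Cmod (F x - l)).
Qed.

(** The Cauchy criterion by coordinates; completeness of the plane, and with it the
    existence of absolutely convergent integrals, enters here. *)
Lemma clim_of_dominated {T} Ft {FF : ProperFilter Ft} (F : T -> C) (G : T -> R) lg (D : T -> Prop) :
  Ft D -> filterlim G Ft (locally lg) ->
  (forall x y, D x -> D y -> Cmod (F y - F x) <= Rabs (G y - G x)) ->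
  exists l, clim Ft F l.
Proof.
  intros HD HG Hb.
  assert (Cauchy : forall h : C -> R, (forall z w, Rabs (h z - h w) <= Cmod (z - w)) ->
     exists y, filterlim (fun x => h (F x)) Ft (locally y)).
  { intros h Hh. apply (filterlim_locally_cauchy (U := R_CompleteSpace)).
    intros eps. assert (He : 0 < eps / 2) by (destruct eps; simpl; lra).
    apply (proj1 (filterlim_locally _ _)) with (eps := mkposreal _ He) in HG.
    eexists; split; [exact (filter_and _ _ HD HG)|].
    intros u v [Du Bu] [Dv Bv].
    change (Rabs (G u - lg) < eps / 2) in Bu. change (Rabs (G v - lg) < eps / 2) in Bv.
    change (Rabs (h (F v) - h (F u)) < eps).
    eapply Rle_lt_trans; [apply Hh|]. eapply Rle_lt_trans; [apply Hb; assumption|].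
    replace (G v - G u) with ((G v - lg) - (G u - lg)) by ring.
    apply Rabs_def2 in Bu. apply Rabs_def2 in Bv. apply Rabs_def1; lra. }
  destruct (Cauchy fst) as [l1 H1].
  { intros z w. apply (fst_le_Cmod (z - w)). }
  destruct (Cauchy snd) as [l2 H2].
  { intros z w. apply (snd_le_Cmod (z - w)). }
  exists (l1, l2). intros eps He. assert (He2 : 0 < eps / 2) by lra.
  apply (proj1 (filterlim_locally _ _)) with (eps := mkposreal _ He2) in H1.
  apply (proj1 (filterlim_locally _ _)) with (eps := mkposreal _ He2) in H2.
  generalize (filter_and _ _ H1 H2). apply filter_imp. intros x [A B].
  change (Rabs (fst (F x) - l1) < eps / 2) in A.
  change (Rabs (snd (F x) - l2) < eps / 2) in B.
  eapply Rle_lt_trans; [apply Cmod_le_abs|]. simpl. unfold Rminus in *. lra.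
Qed.

(** * Absolutely convergent integrals through antiderivatives *)

Definition rend (q : Rbar) : (R -> Prop) -> Prop :=
  match q with Finite r => at_left r | _ => Rbar_locally q end.

(** An integral over the open interval (p, q), proper or not, is the increment
    of an antiderivative between its one-sided limits.  Linearity, substitution
    and integration by parts become rules of differentiation, and the
    endpoint singularities of the integrand never have to be cut off. *)
Definition is_nint (p : R) (q : Rbar) (f : R -> C) (l : C) : Prop :=
  exists (F : R -> C) (la lb : C),
    (forall t, p < t -> Rbar_lt t q -> cder F t (f t)) /\
    clim (at_right p) F la /\ clim (rend q) F lb /\ l = (lb - la)%C.

Global Instance rend_filter q : q <> m_infty -> ProperFilter (rend q).
Proof.
  destruct q; intros H; simpl.
  - apply at_left_proper_filter.
  - apply (Rbar_locally_filter p_infty).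
  - congruence.
Qed.

Lemma rend_inside (p : R) (q : Rbar) : Rbar_lt p q ->
  rend q (fun t => p < t /\ Rbar_lt t q).
Proof.
  destruct q as [q| |]; simpl; intros H.
  - assert (e0 : 0 < q - p) by lra. exists (mkposreal _ e0). intros y By Hy.
    change (Rabs (y - q) < q - p) in By. apply Rabs_def2 in By. lra.
  - exists p. intros x Hx; split; auto.
  - contradiction.
Qed.

Lemma at_right_inside (p : R) (q : Rbar) : Rbar_lt p q ->
  at_right p (fun t => p < t /\ Rbar_lt t q).
Proof.
  destruct q as [q| |]; simpl; intros H.
  - assert (e0 : 0 < q - p) by lra. exists (mkposreal _ e0). intros y By Hy.
    change (Rabs (y - p) < q - p) in By. apply Rabs_def2 in By. lra.
  - exists (mkposreal _ Rlt_0_1). intros; split; auto.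
  - contradiction.
Qed.

Lemma lt_not_m (p : R) q : Rbar_lt p q -> q <> m_infty.
Proof. intros H ->. exact H. Qed.

Lemma nint_val (p : R) q f l l' : is_nint p q f l -> l = l' -> is_nint p q f l'.
Proof. intros H <-; exact H. Qed.

Lemma nint_ext (p : R) q f g l :
  (forall t, p < t -> Rbar_lt t q -> f t = g t) -> is_nint p q f l -> is_nint p q g l.
Proof.
  intros E (F & la & lb & H & H1). exists F, la, lb. split; auto.
  intros t Ht Ht'. rewrite <- E; auto.
Qed.

Lemma nint_plus (p : R) q f g l m : Rbar_lt p q ->
  is_nint p q f l -> is_nint p q g m -> is_nint p q (fun t => f t + g t)%C (l + m)%C.
Proof.
  intros Hpq (F & la & lb & H & H1 & H2 & ->) (G & ma & mb & K & K1 & K2 & ->).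
  pose proof (rend_filter q (lt_not_m _ _ Hpq)).
  exists (fun t => F t + G t)%C, (la + ma)%C, (lb + mb)%C.
  split; [|split; [|split]].
  - intros; apply cder_plus; auto.
  - apply clim_plus; auto. typeclasses eauto.
  - apply clim_plus; auto. typeclasses eauto.
  - ring.
Qed.

Lemma nint_scal (p : R) q f l z : Rbar_lt p q ->
  is_nint p q f l -> is_nint p q (fun t => z * f t)%C (z * l)%C.
Proof.
  intros Hpq (F & la & lb & H & H1 & H2 & ->).
  pose proof (rend_filter q (lt_not_m _ _ Hpq)).
  exists (fun t => z * F t)%C, (z * la)%C, (z * lb)%C.
  split; [|split; [|split]].
  - intros; apply cder_scal; auto.
  - apply clim_scal; auto. typeclasses eauto.
  - apply clim_scal; auto. typeclasses eauto.
  - ring.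
Qed.

Lemma nint_minus (p : R) q f g l m : Rbar_lt p q ->
  is_nint p q f l -> is_nint p q g m -> is_nint p q (fun t => f t - g t)%C (l - m)%C.
Proof.
  intros Hpq H1 H2. apply nint_val with (l + (-1) * m)%C; [|ring].
  apply nint_ext with (f := fun t => (f t + (-1) * g t)%C); [intros; ring|].
  apply nint_plus; auto. apply nint_scal; auto.
Qed.

Lemma nint_zero (p : R) q : Rbar_lt p q -> is_nint p q (fun _ => 0%C) 0%C.
Proof.
  intros Hpq. pose proof (rend_filter q (lt_not_m _ _ Hpq)).
  exists (fun _ => 0%C), 0%C, 0%C. split; [|split; [|split]].
  - intros; apply cder_const.
  - apply clim_const. typeclasses eauto.
  - apply clim_const. typeclasses eauto.
  - ring.
Qed.

Lemma interior_point (p : R) q : Rbar_lt p q -> exists m : R, p < m /\ Rbar_lt m q.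
Proof.
  destruct q as [q| |]; simpl; intros H; [|exists (p + 1); split; [lra|auto]|contradiction].
  exists ((p + q) / 2); lra.
Qed.

Lemma interior_between (p x y t : R) q :
  p < x -> Rbar_lt y q -> x <= t <= y -> p < t /\ Rbar_lt t q.
Proof.
  intros Hx Hy Ht. split; [lra|]. eapply Rbar_le_lt_trans; [|exact Hy]. simpl; lra.
Qed.

Lemma antiderivative_increment (p : R) q (F f : R -> C) (G : R -> C) (g : R -> R) :
  (forall t, p < t -> Rbar_lt t q -> cder F t (f t)) ->
  (forall t, p < t -> Rbar_lt t q -> cder G t (RtoC (g t))) ->
  (forall t, p < t -> Rbar_lt t q -> Cmod (f t) <= g t) ->
  forall x y : R, p < x -> Rbar_lt y q -> x <= y -> Cmod (F y - F x) <= fst (G y) - fst (G x).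
Proof.
  intros HF HG Hb x y Hx Hy Hxy.
  apply (mean_value_inequality F f (fun t => fst (G t)) g); auto;
    intros t Ht; destruct (interior_between p x y t q Hx Hy Ht) as [A B].
  - apply HF; auto.
  - apply (proj1 (HG t A B)).
  - apply Hb; auto.
Qed.

Lemma nint_bound (p : R) q f l g lg : Rbar_lt p q ->
  is_nint p q f l -> is_nint p q (fun t => RtoC (g t)) (RtoC lg) ->
  (forall t, p < t -> Rbar_lt t q -> Cmod (f t) <= g t) ->
  Cmod l <= lg.
Proof.
  intros Hpq (F & la & lb & H & H1 & H2 & ->) (G & ma & mb & K & K1 & K2 & E) Hb.
  pose proof (rend_filter q (lt_not_m _ _ Hpq)) as FFq.
  assert (FFp : ProperFilter (at_right p)) by apply at_right_proper_filter.
  pose proof (antiderivative_increment p q F f G g H K Hb) as MV.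
  assert (S1 : forall y : R, p < y -> Rbar_lt y q -> Cmod (F y - la) <= fst (G y) - fst ma).
  { intros y Hy Hyq.
    apply (clim_Cmod_le (at_right p) (fun x => F y - F x)%C _ (fun x => fst (G y) - fst (G x))).
    - apply clim_minus; auto. typeclasses eauto. apply clim_const. typeclasses eauto.
    - apply (filterlim_Re _ (fun x => (G y - G x)%C) (G y - ma)%C).
      apply clim_minus; auto. typeclasses eauto. apply clim_const. typeclasses eauto.
    - assert (Q : Rbar_lt p y) by exact Hy.
      generalize (at_right_inside p y Q). apply filter_imp.
      intros x [A B]. simpl in B. apply MV; auto. lra. }
  replace lg with (fst mb - fst ma).
  2:{ apply (f_equal fst) in E. simpl in E. rewrite E. ring. }
  apply (clim_Cmod_le (rend q) (fun y => F y - la)%C _ (fun y => fst (G y) - fst ma)).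
  - apply clim_minus; auto. typeclasses eauto. apply clim_const. typeclasses eauto.
  - apply (filterlim_Re _ (fun y => (G y - ma)%C) (mb - ma)%C).
    apply clim_minus; auto. typeclasses eauto. apply clim_const. typeclasses eauto.
  - generalize (rend_inside p q Hpq). apply filter_imp. intros y [A B]. auto.
Qed.

Lemma nint_unique (p : R) q f l m : Rbar_lt p q -> is_nint p q f l -> is_nint p q f m -> l = m.
Proof.
  intros Hpq H1 H2.
  assert (B : Cmod (l - m) <= 0).
  { apply (nint_bound p q (fun t => f t - f t)%C _ (fun _ => 0)); auto.
    - apply nint_minus; auto.
    - apply nint_zero; auto.
    - intros t _ _. replace (f t - f t)%C with (RtoC 0) by ring. rewrite Cmod_0. lra. }
  pose proof (Cmod_ge_0 (l - m)).
  assert (Z : Cmod (l - m) = 0) by lra. apply Cmod_eq_0 in Z.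
  replace l with (l - m + m)%C by ring. rewrite Z. ring.
Qed.

Definition ccontR (f : R -> C) (t : R) : Prop :=
  continuous (fun s => fst (f s)) t /\ continuous (fun s => snd (f s)) t.

Lemma cder_ccontR f t v : cder f t v -> ccontR f t.
Proof.
  intros [H1 H2]; split; apply (ex_derive_continuous (K := R_AbsRing) (V := R_NormedModule));
    eexists; eassumption.
Qed.

Lemma antiderivative_exists (f : R -> C) (p : R) (q : Rbar) : Rbar_lt p q ->
  (forall t, p < t -> Rbar_lt t q -> ccontR f t) ->
  exists F, forall t, p < t -> Rbar_lt t q -> cder F t (f t).
Proof.
  intros Hpq Hc.
  destruct (interior_point p q Hpq) as [m [Hm1 Hm2]].
  assert (In : forall t u : R, p < t -> Rbar_lt t q -> Rmin m t <= u <= Rmax m t -> p < u /\ Rbar_lt u q).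
  { intros t u H1 H2 [H3 H4]. split.
    - eapply Rlt_le_trans; [|exact H3]. apply Rmin_glb_lt; auto.
    - apply (Rbar_le_lt_trans u (Rmax m t)); [exact H4|]. apply Rmax_case; auto. }
  exists (fun t => (RInt (fun s => fst (f s)) m t, RInt (fun s => snd (f s)) m t)).
  intros t H1 H2.
  assert (Loc : locally t (fun u => p < u /\ Rbar_lt u q)).
  { apply filter_and.
    - apply (open_gt p). exact H1.
    - destruct q as [q| |]; simpl in *.
      + apply (open_lt q). exact H2.
      + apply filter_true.
      + contradiction. }
  assert (Comp : forall h : R -> R,
    (forall t, p < t -> Rbar_lt t q -> continuous h t) ->
    is_derive (fun t => RInt h m t) t (h t)).
  { intros h Hh. apply (is_derive_RInt h (fun t => RInt h m t) m t).
    - revert Loc. apply filter_imp. intros u [A B].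
      apply (RInt_correct (V := R_CompleteNormedModule)).
      apply (ex_RInt_continuous (V := R_CompleteNormedModule)).
      intros z Hz. destruct (In u z A B Hz). apply Hh; auto.
    - apply Hh; auto. }
  split; simpl; apply Comp; intros; apply Hc; auto.
Qed.

Lemma nint_exists (p : R) q f g lg : Rbar_lt p q ->
  (forall t, p < t -> Rbar_lt t q -> ccontR f t) ->
  is_nint p q (fun t => RtoC (g t)) lg ->
  (forall t, p < t -> Rbar_lt t q -> Cmod (f t) <= g t) ->
  exists l, is_nint p q f l.
Proof.
  intros Hpq Hc (G & ma & mb & K & K1 & K2 & E) Hb.
  destruct (antiderivative_exists f p q Hpq Hc) as [F HF].
  pose proof (rend_filter q (lt_not_m _ _ Hpq)) as FFq.
  assert (FFp : ProperFilter (at_right p)) by apply at_right_proper_filter.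
  pose proof (antiderivative_increment p q F f G g HF K Hb) as MV.
  assert (MV2 : forall x y : R, p < x /\ Rbar_lt x q -> p < y /\ Rbar_lt y q ->
             Cmod (F y - F x) <= Rabs (fst (G y) - fst (G x))).
  { intros x y [A B] [A' B']. destruct (Rle_dec x y) as [L|L].
    - eapply Rle_trans; [apply MV; auto|apply Rle_abs].
    - rewrite Cmod_minus_sym, Rabs_minus_sym.
      eapply Rle_trans; [apply MV; auto; lra|apply Rle_abs]. }
  destruct (clim_of_dominated (at_right p) F (fun t => fst (G t)) (fst ma)
              (fun t => p < t /\ Rbar_lt t q)) as [la Hla]; auto.
  { apply at_right_inside; auto. }
  { apply filterlim_Re; auto. typeclasses eauto. }
  destruct (clim_of_dominated (rend q) F (fun t => fst (G t)) (fst mb)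
              (fun t => p < t /\ Rbar_lt t q)) as [lb Hlb]; auto.
  { apply rend_inside; auto. }
  { apply filterlim_Re; auto. typeclasses eauto. }
  exists (lb - la)%C, F, la, lb. auto.
Qed.

Lemma nint_RInt_gen f l :
  (forall t, 0 < t -> ccontR f t) -> is_nint 0 p_infty f l ->
  RInt_gen (V := C_R_CompleteNormedModule) f (at_right 0) (Rbar_locally p_infty) = l.
Proof.
  intros Hc (F & la & lb & H & H1 & H2 & ->).
  pose proof (Proper_StrongProper _ (at_right_proper_filter 0)) as FF1.
  pose proof (Proper_StrongProper _ (Rbar_locally_filter p_infty)) as FF2.
  refine (is_RInt_gen_unique (V := C_R_CompleteNormedModule)
            (Fa := at_right 0) (Fb := Rbar_locally p_infty) f _ _).
  intros P [eps HP].
  assert (He : 0 < eps / 2) by (destruct eps; simpl; lra).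
  specialize (H1 _ He). specialize (H2 _ He).
  econstructor; [exact (filter_and _ _ (at_right_inside 0 p_infty I) H1)
                |exact (filter_and _ _ (rend_inside 0 p_infty I) H2)|].
  intros x y [[A _] B] [[A' _] B']. simpl.
  exists (F y - F x)%C. split.
  - apply (is_RInt_fct_extend_pair (U := R_NormedModule) (V := R_NormedModule)).
    + apply (is_RInt_derive (V := R_CompleteNormedModule)) with (f := fun t => fst (F t)).
      * intros z [Hz _]. apply H; simpl; auto.
        eapply Rlt_le_trans; [|exact Hz]. apply Rmin_glb_lt; auto.
      * intros z [Hz _]. apply Hc.
        eapply Rlt_le_trans; [|exact Hz]. apply Rmin_glb_lt; auto.
    + apply (is_RInt_derive (V := R_CompleteNormedModule)) with (f := fun t => snd (F t)).
      * intros z [Hz _]. apply H; simpl; auto.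
        eapply Rlt_le_trans; [|exact Hz]. apply Rmin_glb_lt; auto.
      * intros z [Hz _]. apply Hc.
        eapply Rlt_le_trans; [|exact Hz]. apply Rmin_glb_lt; auto.
  - apply HP.
    assert (Bd : Cmod ((F y - F x) - (lb - la)) < eps).
    { replace ((F y - F x) - (lb - la))%C with ((F y - lb) - (F x - la))%C by ring.
      eapply Rle_lt_trans; [apply Cmod_minus_le|]. lra. }
    split.
    + eapply Rle_lt_trans; [apply (fst_le_Cmod ((F y - F x) - (lb - la)))|exact Bd].
    + eapply Rle_lt_trans; [apply (snd_le_Cmod ((F y - F x) - (lb - la)))|exact Bd].
Qed.

(** An antiderivative on the large interval serves both parts, and its value at the
    interior point m cancels. *)
Lemma nint_split (p m : R) q f l1 l2 l : p < m -> Rbar_lt m q ->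
  is_nint p q f l -> is_nint p m f l1 -> is_nint m q f l2 -> l = (l1 + l2)%C.
Proof.
  intros Hpm Hmq (F & la & lb & H & H1 & H2 & ->) K1 K2.
  assert (Hc : cder F m (f m)) by (apply H; auto).
  pose proof (rend_filter q (lt_not_m _ _ Hmq)) as FFq.
  assert (E1 : l1 = (F m - la)%C).
  { apply (nint_unique p m f); auto. exists F, la, (F m). split; [|split; [|split]]; auto.
    - intros t A B. apply H; auto. eapply Rbar_lt_trans; [exact B|exact Hmq].
    - intros eps He. apply filter_le_within. apply (cder_cont _ _ _ _ Hc He). }
  assert (E2 : l2 = (lb - F m)%C).
  { apply (nint_unique m q f); auto. exists F, (F m), lb. split; [|split; [|split]]; auto.
    - intros t A B. apply H; auto. lra.
    - intros eps He. apply filter_le_within. apply (cder_cont _ _ _ _ Hc He). }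
  rewrite E1, E2. ring.
Qed.
Lemma nint_restrict_l (p m : R) q f l : p < m -> Rbar_lt m q ->
  is_nint p q f l -> exists l1, is_nint p m f l1.
Proof.
  intros Hpm Hmq (F & la & lb & H & H1 & H2 & ->).
  assert (Hc : cder F m (f m)) by (apply H; auto).
  exists (F m - la)%C, F, la, (F m). split; [|split; [|split]]; auto.
  - intros t A B. apply H; auto. eapply Rbar_lt_trans; [exact B|exact Hmq].
  - intros eps He. apply filter_le_within. apply (cder_cont _ _ _ _ Hc He).
Qed.

Lemma nint_restrict_r (p m : R) q f l : p < m -> Rbar_lt m q ->
  is_nint p q f l -> exists l1, is_nint m q f l1.
Proof.
  intros Hpm Hmq (F & la & lb & H & H1 & H2 & ->).
  assert (Hc : cder F m (f m)) by (apply H; auto).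
  exists (lb - F m)%C, F, (F m), lb. split; [|split; [|split]]; auto.
  - intros t A B. apply H; auto. lra.
  - intros eps He. apply filter_le_within. apply (cder_cont _ _ _ _ Hc He).
Qed.

(** * Exponential, logarithm and powers along curves *)

(** Complex differentiability, in the form in which it is used: the chain rule
    along every differentiable curve through the point.  Sums, products and
    compositions then need no estimates. *)
Definition hol (G : C -> C) (z l : C) : Prop :=
  forall (g : R -> C) t v, g t = z -> cder g t v -> cder (fun s => G (g s)) t (l * v)%C.

Lemma hol_val G z l l' : hol G z l -> l = l' -> hol G z l'.
Proof. intros H <-; exact H. Qed.

Lemma hol_ext G H z l : (forall w, G w = H w) -> hol G z l -> hol H z l.
Proof. intros E Hg g t v e D. eapply cder_ext; [|apply (Hg g t v e D)]. intros; apply E. Qed.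

Lemma hol_const k z : hol (fun _ => k) z 0%C.
Proof. intros g t v e D. eapply cder_val; [apply cder_const|ring]. Qed.

Lemma hol_id z : hol (fun w => w) z 1%C.
Proof. intros g t v e D. eapply cder_val; [exact D|ring]. Qed.

Lemma hol_plus G H z l m : hol G z l -> hol H z m -> hol (fun w => G w + H w)%C z (l + m)%C.
Proof.
  intros A B g t v e D. eapply cder_val; [apply cder_plus; [apply A|apply B]; eauto|ring].
Qed.

Lemma hol_mult G H z l m : hol G z l -> hol H z m ->
  hol (fun w => G w * H w)%C z (l * H z + G z * m)%C.
Proof.
  intros A B g t v e D.
  eapply cder_val; [apply cder_mult; [apply A|apply B]; eauto|].
  cbv beta. rewrite e. ring.
Qed.

Lemma hol_scal k G z l : hol G z l -> hol (fun w => k * G w)%C z (k * l)%C.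
Proof.
  intros A. eapply hol_val; [apply (hol_mult (fun _ => k)); [apply hol_const|exact A]|].
  cbv beta. ring.
Qed.

Lemma hol_minus G H z l m : hol G z l -> hol H z m -> hol (fun w => G w - H w)%C z (l - m)%C.
Proof.
  intros A B g t v e D. eapply cder_val; [apply cder_minus; [apply A|apply B]; eauto|ring].
Qed.

Lemma hol_comp G H z l m : hol G (H z) l -> hol H z m -> hol (fun w => G (H w)) z (l * m)%C.
Proof.
  intros A B g t v e D.
  eapply cder_val; [apply (A (fun s => H (g s)) t (m * v)%C)|ring].
  - rewrite e. reflexivity.
  - apply B; auto.
Qed.

Lemma hol_Cexp z : hol Cexp z (Cexp z).
Proof.
  intros g t v e [D1 D2].
  set (a := fun s => fst (g s)). set (b := fun s => snd (g s)).
  assert (E1 : ex_derive a t) by (eexists; exact D1).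
  assert (E2 : ex_derive b t) by (eexists; exact D2).
  assert (U1 : Derive a t = fst v) by exact (is_derive_unique _ _ _ D1).
  assert (U2 : Derive b t = snd v) by exact (is_derive_unique _ _ _ D2).
  rewrite <- e. split; simpl.
  - change (is_derive (fun s => exp (a s) * cos (b s)) t
      (exp (a t) * cos (b t) * fst v - exp (a t) * sin (b t) * snd v)).
    auto_derive; [tauto|].
    change (fun x => a x) with a. change (fun x => b x) with b. rewrite U1, U2. ring.
  - change (is_derive (fun s => exp (a s) * sin (b s)) t
      (exp (a t) * cos (b t) * snd v + exp (a t) * sin (b t) * fst v)).
    auto_derive; [tauto|].
    change (fun x => a x) with a. change (fun x => b x) with b. rewrite U1, U2. ring.
Qed.

Lemma Cexp_plus z w : Cexp (z + w) = (Cexp z * Cexp w)%C.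
Proof.
  unfold Cexp, Re, Im. apply C_ext; simpl; rewrite exp_plus, ?cos_plus, ?sin_plus; ring.
Qed.

Lemma Cexp_0 : Cexp 0 = 1%C.
Proof. unfold Cexp. simpl. rewrite exp_0, cos_0, sin_0. apply C_ext; simpl; ring. Qed.

Lemma Cmod_Cexp z : Cmod (Cexp z) = exp (Re z).
Proof.
  unfold Cmod, Cexp. simpl. pose proof (exp_pos (Re z)).
  replace (_ + _) with (exp (Re z) * exp (Re z)).
  - apply sqrt_square. lra.
  - pose proof (sin2_cos2 (Im z)) as S. unfold Rsqr in S.
    transitivity (exp (Re z) * exp (Re z) * (sin (Im z) * sin (Im z) + cos (Im z) * cos (Im z)));
      [rewrite S; ring|ring].
Qed.

Lemma Cexp_neq_0 z : Cexp z <> 0%C.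
Proof.
  intros E. pose proof (Cmod_Cexp z) as H. rewrite E, Cmod_0 in H.
  pose proof (exp_pos (Re z)). lra.
Qed.

Lemma Cexp_opp z : Cexp (- z) = (/ Cexp z)%C.
Proof.
  pose proof (Cexp_neq_0 z).
  assert (E : (Cexp (- z) * Cexp z)%C = 1%C).
  { rewrite <- Cexp_plus. replace (- z + z)%C with (RtoC 0) by ring. apply Cexp_0. }
  replace (Cexp (- z)) with (Cexp (- z) * Cexp z * / Cexp z)%C by (field; auto).
  rewrite E. ring.
Qed.

Lemma Cexp_R r : Cexp (RtoC r) = RtoC (exp r).
Proof. unfold Cexp. simpl. rewrite cos_0, sin_0. apply C_ext; simpl; ring. Qed.

(** The complement of the cut of the principal logarithm. *)
Definition off_cut (z : C) : Prop := 0 < Cmod z + Re z.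

Lemma off_cut_neq_0 z : off_cut z -> z <> 0%C.
Proof. intros H ->. unfold off_cut in H. rewrite Cmod_0 in H. simpl in H. lra. Qed.

Lemma off_cut_Re z : 0 < Re z -> off_cut z.
Proof. intros H. unfold off_cut. pose proof (Cmod_ge_0 z). lra. Qed.

(** By the half-angle formula an arctangent replaces the arc cosine, which is not
    differentiable at -1 and 1, that is, on the real axis. *)
Lemma Carg_off_cut z : off_cut z -> Carg z = 2 * atan (Im z / (Cmod z + Re z)).
Proof.
  intros Hz. pose proof (off_cut_neq_0 z Hz) as Hn.
  apply Cmod_gt_0 in Hn.
  pose proof (Cmod_sqr z) as S. fold (Re z) (Im z) in S.
  unfold off_cut in Hz.
  set (q := Im z / (Cmod z + Re z)).
  assert (Q : q * q = (Cmod z - Re z) / (Cmod z + Re z)).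
  { unfold q. replace (Im z / (Cmod z + Re z) * (Im z / (Cmod z + Re z)))
      with (Im z * Im z / ((Cmod z + Re z) * (Cmod z + Re z))) by (field; lra).
    replace (Im z * Im z) with ((Cmod z - Re z) * (Cmod z + Re z)) by lra.
    field. lra. }
  assert (K : cos (2 * atan q) = Re z / Cmod z).
  { rewrite cos_2a_cos, cos_atan.
    assert (P : 0 < 1 + q²) by (unfold Rsqr; nra).
    pose proof (sqrt_lt_R0 _ P).
    replace (2 * (1 / sqrt (1 + q²)) * (1 / sqrt (1 + q²)) - 1)
      with (2 / (sqrt (1 + q²) * sqrt (1 + q²)) - 1) by (field; lra).
    rewrite sqrt_sqrt by lra. unfold Rsqr. rewrite Q. field; lra. }
  pose proof (atan_bound q) as [B1 B2].
  unfold Carg. rewrite <- K.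
  destruct (Rle_dec 0 (Im z)) as [L|L].
  - apply acos_cos. split; [|lra].
    assert (0 <= q) by (unfold q; apply Rdiv_le_0_compat; lra).
    destruct (Req_dec q 0) as [->|N]; [rewrite atan_0; lra|].
    pose proof (atan_increasing 0 q ltac:(lra)). rewrite atan_0 in *. lra.
  - rewrite <- cos_neg. rewrite acos_cos; [ring|].
    assert (q < 0).
    { unfold q, Rdiv. pose proof (Rinv_0_lt_compat _ Hz). nra. }
    pose proof (atan_increasing q 0 ltac:(lra)). rewrite atan_0 in *. lra.
Qed.

Lemma Carg_bound z : off_cut z -> - PI < Carg z < PI.
Proof.
  intros H. rewrite Carg_off_cut by auto.
  pose proof (atan_bound (Im z / (Cmod z + Re z))). lra.
Qed.

Lemma Cexp_Clog (z : C) : z <> 0%C -> Cexp (Clog z) = z.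
Proof.
  intros Hn. apply Cmod_gt_0 in Hn.
  pose proof (Cmod_sqr z) as S. fold (Re z) (Im z) in S.
  unfold Cexp, Clog. simpl. rewrite exp_ln by auto.
  assert (B : -1 <= Re z / Cmod z <= 1).
  { pose proof (re_le_Cmod z) as R1. apply Rabs_le_between in R1.
    split.
    - apply Rmult_le_reg_r with (Cmod z); auto. unfold Rdiv. rewrite Rmult_assoc, Rinv_l by lra. lra.
    - apply Rmult_le_reg_r with (Cmod z); auto. unfold Rdiv. rewrite Rmult_assoc, Rinv_l by lra. lra. }
  assert (Sq : Cmod z * sqrt (1 - (Re z / Cmod z)²) = Rabs (Im z)).
  { rewrite <- (sqrt_square (Cmod z)) at 1 by lra.
    rewrite <- sqrt_mult.
    - rewrite <- sqrt_Rsqr_abs. f_equal. unfold Rsqr.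
      field_simplify; [|lra]. lra.
    - nra.
    - unfold Rsqr. nra. }
  unfold Carg. destruct (Rle_dec 0 (Im z)) as [L|L].
  - rewrite cos_acos, sin_acos by auto. rewrite Sq.
    rewrite Rabs_right by lra. apply C_ext; simpl; unfold Re, Im; field.
    unfold Re in *. lra.
  - rewrite cos_neg, sin_neg, cos_acos, sin_acos by auto.
    apply C_ext; simpl.
    + unfold Re; field. lra.
    + rewrite <- Ropp_mult_distr_r, Sq. rewrite Rabs_left by lra. unfold Im; ring.
Qed.

Lemma Clog_Cexp u : - PI < Im u < PI -> Clog (Cexp u) = u.
Proof.
  intros B. unfold Clog. rewrite Cmod_Cexp, ln_exp.
  apply C_ext; [reflexivity|]. simpl.
  unfold Carg. rewrite Cmod_Cexp. unfold Cexp. simpl.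
  pose proof (exp_pos (Re u)).
  replace (exp (Re u) * cos (Im u) / exp (Re u)) with (cos (Im u)) by (field; lra).
  destruct (Rle_dec 0 (exp (Re u) * sin (Im u))) as [L|L].
  - destruct (Rle_dec 0 (Im u)); [apply acos_cos; unfold Im in *; lra|].
    exfalso. pose proof (sin_lt_0_var (Im u) ltac:(lra) ltac:(lra)). nra.
  - destruct (Rle_dec 0 (Im u)).
    + exfalso. apply L. pose proof (sin_ge_0 (Im u) ltac:(lra) ltac:(lra)). nra.
    + rewrite <- cos_neg, acos_cos by lra. unfold Im; ring.
Qed.

Lemma hol_Clog z : off_cut z -> hol Clog z (/ z)%C.
Proof.
  intros Hz g t v e D.
  assert (Pz : 0 < Cmod z) by (apply Cmod_gt_0, off_cut_neq_0, Hz).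
  pose proof (Cmod_sqr z) as S.
  pose proof (off_cut_neq_0 z Hz) as Nz.
  assert (Loc : locally t (fun s => off_cut (g s))).
  { assert (He : 0 < (Cmod z + Re z) / 2) by (unfold off_cut in Hz; lra).
    generalize (cder_cont _ _ _ _ D He). apply filter_imp. intros s. rewrite e.
    intros B. unfold off_cut in *.
    pose proof (fst_le_Cmod (g s - z)) as B1. simpl in B1. apply Rabs_le_between in B1.
    pose proof (Cmod_diff_ge z (g s)) as B2. rewrite Cmod_minus_sym in B2.
    unfold Re in *. lra. }
  destruct D as [D1 D2].
  set (a := fun s => fst (g s)). set (b := fun s => snd (g s)).
  assert (E1 : ex_derive a t) by (eexists; exact D1).
  assert (E2 : ex_derive b t) by (eexists; exact D2).
  assert (U1 : Derive a t = fst v) by exact (is_derive_unique _ _ _ D1).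
  assert (U2 : Derive b t = snd v) by exact (is_derive_unique _ _ _ D2).
  assert (Ea : a t = fst z) by (unfold a; rewrite e; reflexivity).
  assert (Eb : b t = snd z) by (unfold b; rewrite e; reflexivity).
  assert (Em : sqrt (a t ^ 2 + b t ^ 2) = Cmod z) by (rewrite Ea, Eb; reflexivity).
  assert (Pos : 0 < a t ^ 2 + b t ^ 2) by (rewrite Ea, Eb; simpl; nra).
  assert (Inv : (/ z)%C = (fst z / (Cmod z * Cmod z), - snd z / (Cmod z * Cmod z))).
  { unfold Cinv. rewrite S. apply C_ext; simpl; f_equal; f_equal; ring. }
  rewrite Inv.
  split; simpl.
  - change (is_derive (fun s => ln (sqrt (a s ^ 2 + b s ^ 2))) t
      (fst z / (Cmod z * Cmod z) * fst v - - snd z / (Cmod z * Cmod z) * snd v)).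
    auto_derive; fold (a t) (b t).
    + replace (a t * (a t * 1) + b t * (b t * 1)) with (a t ^ 2 + b t ^ 2) by ring.
      rewrite Em. repeat split; auto.
    + change (fun x => a x) with a. change (fun x => b x) with b. rewrite U1, U2.
      replace (a t * (a t * 1) + b t * (b t * 1)) with (a t ^ 2 + b t ^ 2) by ring.
      rewrite Em, Ea, Eb. field. lra.
  - apply is_derive_ext_loc with (f := fun s => 2 * atan (b s / (sqrt (a s ^ 2 + b s ^ 2) + a s))).
    { revert Loc. apply filter_imp. intros s Hs. rewrite Carg_off_cut by auto. reflexivity. }
    unfold off_cut in Hz. unfold Re in Hz.
    auto_derive; fold (a t) (b t).
    + replace (a t * (a t * 1) + b t * (b t * 1)) with (a t ^ 2 + b t ^ 2) by ring.
      rewrite Em. repeat split; auto. rewrite Ea. lra.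
    + change (fun x => a x) with a. change (fun x => b x) with b. rewrite U1, U2.
      replace (a t * (a t * 1) + b t * (b t * 1)) with (a t ^ 2 + b t ^ 2) by ring.
      rewrite Em, Ea, Eb.
      (* this factorisation clears the denominator left by the arctangent *)
      assert (Q : snd z * snd z = (Cmod z - fst z) * (Cmod z + fst z)) by lra.
      set (r := Cmod z) in *. set (u := fst z) in *. set (w := snd z) in *.
      replace (1 + w * / (r + u) * (w * / (r + u) * 1)) with (2 * r / (r + u)).
      2:{ replace (w * / (r + u) * (w * / (r + u) * 1)) with (w * w / ((r + u) * (r + u))) by (field; lra).
          rewrite Q. field. lra. }
      apply Rminus_diag_uniq.
      replace (_ - _) with
        ((snd v * (r * (r + u)) - w * (w * snd v)) * / (r * r * (r + u)) - u / (r * r) * snd v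
         - w * fst v * (u + r) / (r * r * (r + u)) + w / (r * r) * fst v)
        by (field; lra).
      replace (w * (w * snd v)) with ((r - u) * (r + u) * snd v) by (rewrite <- Q; ring).
      field. lra.
Qed.

Lemma Clog_R r : 0 < r -> Clog (RtoC r) = RtoC (ln r).
Proof.
  intros H. rewrite <- (exp_ln r) at 1 by auto. rewrite <- Cexp_R.
  apply Clog_Cexp. simpl. pose proof PI_RGT_0. lra.
Qed.

Lemma Clog_1 : Clog 1 = 0%C.
Proof. change (Clog (RtoC 1) = RtoC 0). rewrite Clog_R by lra. rewrite ln_1. reflexivity. Qed.

Lemma Clog_mult z w : off_cut z -> off_cut w -> - PI < Carg z + Carg w < PI ->
  Clog (z * w) = (Clog z + Clog w)%C.
Proof.
  intros Hz Hw B.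
  rewrite <- (Cexp_Clog z) at 1 by (apply off_cut_neq_0; auto).
  rewrite <- (Cexp_Clog w) at 1 by (apply off_cut_neq_0; auto).
  rewrite <- Cexp_plus. apply Clog_Cexp. exact B.
Qed.

Lemma Carg_R r : 0 < r -> Carg (RtoC r) = 0.
Proof. intros H. change (Im (Clog (RtoC r)) = 0). rewrite Clog_R by auto. reflexivity. Qed.

Lemma off_cut_R r : 0 < r -> off_cut (RtoC r).
Proof. intros H. apply off_cut_Re. exact H. Qed.

Lemma Clog_scale r z : 0 < r -> off_cut z -> Clog (RtoC r * z) = (RtoC (ln r) + Clog z)%C.
Proof.
  intros H Hz. rewrite <- Clog_R by auto. apply Clog_mult; auto.
  - apply off_cut_R; auto.
  - rewrite Carg_R by auto. pose proof (Carg_bound z Hz). lra.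
Qed.

Lemma Cpower_neq_0 z w : Cpower z w <> 0%C.
Proof. apply Cexp_neq_0. Qed.

Lemma Cpower_plus z a b : Cpower z (a + b) = (Cpower z a * Cpower z b)%C.
Proof.
  unfold Cpower. rewrite <- Cexp_plus. f_equal. ring.
Qed.

Lemma Cpower_opp z a : Cpower z (- a) = (/ Cpower z a)%C.
Proof. unfold Cpower. rewrite <- Cexp_opp. f_equal. ring. Qed.

Lemma Cpower_0 z : Cpower z 0 = 1%C.
Proof. unfold Cpower. rewrite <- Cexp_0. f_equal. ring. Qed.

Lemma Cpower_1 (z : C) : z <> 0%C -> Cpower z 1 = z.
Proof.
  intros H. unfold Cpower. replace (1 * Clog z)%C with (Clog z) by ring.
  apply Cexp_Clog, H.
Qed.

Lemma Cpower_nat (z : C) n : z <> 0%C -> Cpower z (RtoC (INR n)) = (z ^ n)%C.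
Proof.
  intros H. induction n as [|n IH].
  - apply Cpower_0.
  - rewrite S_INR, RtoC_plus, Cpower_plus, IH, Cpower_1 by auto. simpl. ring.
Qed.

Lemma Cpower_plus_nat (z a : C) n : z <> 0%C ->
  Cpower z (a + RtoC (INR n)) = (Cpower z a * z ^ n)%C.
Proof. intros H. rewrite Cpower_plus, Cpower_nat; auto. Qed.

Lemma Cpower_minus_1 (z a : C) : z <> 0%C -> Cpower z (a - 1) = (Cpower z a / z)%C.
Proof.
  intros H. unfold Cminus. rewrite Cpower_plus, Cpower_opp, Cpower_1 by auto. reflexivity.
Qed.

Lemma Cpower_one a : Cpower 1 a = 1%C.
Proof.
  unfold Cpower. rewrite Clog_1. replace (a * 0)%C with (RtoC 0) by ring. apply Cexp_0.
Qed.

Lemma Cmod_Cpower_R t a : 0 < t -> Cmod (Cpower (RtoC t) a) = Rpower t (Re a).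
Proof.
  intros H. unfold Cpower. rewrite Cmod_Cexp, Clog_R by auto. unfold Rpower.
  f_equal. simpl. unfold Re. ring.
Qed.

Lemma Cpower_R t a : 0 < t -> Cpower (RtoC t) (RtoC a) = RtoC (Rpower t a).
Proof.
  intros H. unfold Cpower. rewrite Clog_R by auto.
  rewrite <- RtoC_mult, Cexp_R. reflexivity.
Qed.

Lemma Cpower_scale r z a : 0 < r -> off_cut z ->
  Cpower (RtoC r * z) a = (Cpower (RtoC r) a * Cpower z a)%C.
Proof.
  intros H Hz. unfold Cpower. rewrite Clog_scale, Clog_R by auto.
  rewrite <- Cexp_plus. f_equal. ring.
Qed.

Lemma hol_Cpower z a : off_cut z -> hol (fun w => Cpower w a) z (a * Cpower z (a - 1))%C.
Proof.
  intros Hz. pose proof (off_cut_neq_0 z Hz).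
  eapply hol_val.
  - apply (hol_comp Cexp (fun w => a * Clog w)%C); [apply hol_Cexp|].
    apply hol_scal, hol_Clog, Hz.
  - rewrite Cpower_minus_1 by auto. unfold Cpower, Cdiv. ring.
Qed.

Lemma cder_Cpower_R t a : 0 < t ->
  cder (fun s => Cpower (RtoC s) a) t (a * Cpower (RtoC t) (a - 1))%C.
Proof.
  intros H. eapply cder_val.
  - apply (hol_Cpower (RtoC t) a (off_cut_R _ H) (fun s => RtoC s) t 1%C); auto.
    apply cder_id.
  - ring.
Qed.

(** Besides the modulus of z only its argument enters, and that is at most PI. *)
Lemma Cmod_Cpower_le z a r R0 : off_cut z -> 0 < r -> r <= Cmod z <= R0 ->
  Cmod (Cpower z a) <= exp (Rabs (Re a) * (Rabs (ln r) + Rabs (ln R0)) + Rabs (Im a) * PI).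
Proof.
  intros Hz Hr B. unfold Cpower. rewrite Cmod_Cexp.
  assert (M : forall u v, u <= v -> exp u <= exp v).
  { intros u v [L| ->]; [left; apply exp_increasing, L|right; reflexivity]. }
  apply M. simpl. unfold Re, Im.
  assert (L1 : ln r <= ln (Cmod z)) by (apply ln_le; lra).
  assert (L2 : ln (Cmod z) <= ln R0) by (apply ln_le; lra).
  assert (L3 : Rabs (ln (Cmod z)) <= Rabs (ln r) + Rabs (ln R0)).
  { pose proof (Rabs_pos (ln r)). pose proof (Rabs_pos (ln R0)).
    pose proof (Rle_abs (ln R0)). pose proof (Rle_abs (- ln r)). rewrite Rabs_Ropp in *.
    apply Rabs_le. lra. }
  pose proof (Carg_bound z Hz) as A.
  assert (L4 : Rabs (Carg z) <= PI) by (apply Rabs_le; lra).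
  pose proof (Rle_abs (fst a * ln (Cmod z))) as K1. rewrite Rabs_mult in K1.
  pose proof (Rle_abs (- (snd a * Carg z))) as K2. rewrite Rabs_Ropp, Rabs_mult in K2.
  pose proof (Rabs_pos (fst a)). pose proof (Rabs_pos (snd a)).
  pose proof (Rmult_le_compat_l _ _ _ H L3). pose proof (Rmult_le_compat_l _ _ _ H0 L4). lra.
Qed.

(** * Binomial and exponential series with remainders *)

Lemma partial_sum_S f N : partial_sum f (S N) = (partial_sum f N + f N)%C.
Proof.
  destruct N as [|N]; simpl.
  - rewrite sum_O. apply C_ext; simpl; ring.
  - rewrite sum_Sn. reflexivity.
Qed.

Lemma partial_sum_ext f g N :
  (forall n, (n < N)%nat -> f n = g n) -> partial_sum f N = partial_sum g N.
Proof.
  induction N as [|N IH]; intros E; [reflexivity|].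
  rewrite !partial_sum_S, IH, E by (intros; try apply E; lia). reflexivity.
Qed.

Lemma partial_sum_scal z f N : partial_sum (fun n => z * f n)%C N = (z * partial_sum f N)%C.
Proof.
  induction N as [|N IH]; [simpl; ring|]. rewrite !partial_sum_S, IH. ring.
Qed.

Lemma partial_sum_plus f g N :
  partial_sum (fun n => f n + g n)%C N = (partial_sum f N + partial_sum g N)%C.
Proof.
  induction N as [|N IH]; [simpl; ring|]. rewrite !partial_sum_S, IH. ring.
Qed.

Lemma poch_S a n : poch a (S n) = (poch a n * (a + RtoC (INR n)))%C.
Proof. reflexivity. Qed.

Lemma poch_add a n m : poch a (n + m) = (poch a n * poch (a + RtoC (INR n)) m)%C.
Proof.
  induction m as [|m IH].
  - rewrite Nat.add_0_r. simpl. ring.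
  - rewrite Nat.add_succ_r, !poch_S, IH, plus_INR, RtoC_plus. ring.
Qed.

Lemma poch_shift a n : poch a (S n) = (a * poch (a + 1) n)%C.
Proof.
  change (S n) with (1 + n)%nat. rewrite (poch_add a 1 n). simpl.
  f_equal. ring.
Qed.

Lemma RtoC_neq_0 r : r <> 0 -> RtoC r <> 0%C.
Proof. intros H E. apply H, RtoC_inj, E. Qed.

Lemma Cfact_neq_0 n : Cfact n <> 0%C.
Proof. apply RtoC_neq_0, INR_fact_neq_0. Qed.

Lemma Cfact_S n : Cfact (S n) = (RtoC (INR (S n)) * Cfact n)%C.
Proof. unfold Cfact. rewrite fact_simpl, mult_INR, RtoC_mult. reflexivity. Qed.

Lemma INR_S_neq_0 n : RtoC (INR (S n)) <> 0%C.
Proof. apply RtoC_neq_0, not_0_INR. lia. Qed.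

Definition bin_coef (b : C) (n : nat) : C := (poch b n / Cfact n)%C.

Lemma bin_coef_0 b : bin_coef b 0 = 1%C.
Proof. unfold bin_coef, Cfact. simpl. field. Qed.

Lemma bin_coef_S b n :
  (RtoC (INR (S n)) * bin_coef b (S n))%C = ((b + RtoC (INR n)) * bin_coef b n)%C.
Proof.
  unfold bin_coef. rewrite poch_S, Cfact_S. field.
  split; [apply Cfact_neq_0|apply INR_S_neq_0].
Qed.

Ltac beta_ring := cbv beta; ring.

Lemma cder_line (z w : C) t : cder (fun s => z + RtoC s * w)%C t w.
Proof.
  eapply cder_val.
  - apply cder_plus; [apply cder_const|]. apply cder_mult; [apply cder_id|apply cder_const].
  - beta_ring.
Qed.

Lemma cder_Cpow f t v n : cder f t v ->
  cder (fun s => f s ^ (S n))%C t (RtoC (INR (S n)) * f t ^ n * v)%C.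
Proof.
  intros H. induction n as [|n IH].
  - simpl. eapply cder_val; [apply cder_mult; [exact H|apply cder_const]|]. beta_ring.
  - eapply cder_val.
    + apply (cder_mult f (fun s => f s ^ (S n))%C); [exact H|exact IH].
    + rewrite (S_INR (S n)), RtoC_plus. simpl Cpow. beta_ring.
Qed.

(** The polynomial satisfies the differential equation of (1 - w)^(-b) up to its
    top-degree term, by telescoping. *)
Lemma bin_poly_der b w k t : exists V,
  cder (fun s => partial_sum (fun n => bin_coef b n * (RtoC s * w) ^ n) (S k))%C t V /\
  ((1 - RtoC t * w) * V)%C =
  (w * (b * partial_sum (fun n => bin_coef b n * (RtoC t * w) ^ n) (S k)
        - RtoC (INR (S k)) * bin_coef b (S k) * (RtoC t * w) ^ k))%C.
Proof.
  induction k as [|k [V [H1 H2]]].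
  - exists 0%C. split.
    + apply cder_ext with (f := fun _ => bin_coef b 0).
      * intros s. rewrite partial_sum_S. simpl. beta_ring.
      * apply cder_const.
    + rewrite partial_sum_S, bin_coef_S, bin_coef_0. simpl. beta_ring.
  - exists (V + bin_coef b (S k) * (RtoC (INR (S k)) * (RtoC t * w) ^ k * w))%C. split.
    + eapply cder_ext; [intros s; symmetry; apply partial_sum_S|].
      apply cder_plus; [exact H1|]. apply cder_scal.
      apply (cder_Cpow (fun s => RtoC s * w)%C). eapply cder_val.
      * apply cder_mult; [apply cder_id|apply cder_const].
      * beta_ring.
    + rewrite Cmult_plus_distr_l, H2, (partial_sum_S _ (S k)).
      replace (RtoC (INR (S (S k))) * bin_coef b (S (S k)))%C
        with ((b + RtoC (INR (S k))) * bin_coef b (S k))%C by (symmetry; apply bin_coef_S).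
      simpl Cpow. beta_ring.
Qed.

(** Multiplying the binomial polynomial by the inverse power turns the remainder
    into the integral of one explicit term along the segment.  The bound therefore
    reaches beyond the disc of convergence |e/z| < 1, as long as the segment stays off
    the cut. *)
Lemma binomial_remainder (z e b : C) (B : R) (k : nat) :
  (forall s, 0 <= s <= 1 -> off_cut (z - RtoC s * e)) ->
  (forall s, 0 <= s <= 1 -> Cmod (Cpower (z - RtoC s * e) (b - 1)) * Cmod z <= B) ->
  Cmod (Cpower (z - e) b * partial_sum (fun n => bin_coef b n * (e / z) ^ n)%C (S k)
        - Cpower z b)%C
  <= B * (INR (S k) * Cmod (bin_coef b (S k)) * Cmod (e / z) ^ (S k)).
Proof.
  intros Hoff HB.
  assert (Hz : z <> 0%C).
  { apply off_cut_neq_0. specialize (Hoff 0 ltac:(lra)).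
    replace (z - RtoC 0 * e)%C with z in Hoff by ring. exact Hoff. }
  set (w := (e / z)%C).
  assert (Ee : e = (w * z)%C) by (unfold w; field; auto).
  set (K := B * (INR (S k) * Cmod (bin_coef b (S k)) * Cmod w ^ (S k))).
  set (F := fun s => (Cpower (z - RtoC s * e) b *
     partial_sum (fun n => bin_coef b n * (RtoC s * w) ^ n)%C (S k))%C).
  assert (D : forall t, 0 <= t <= 1 -> cder F t
     (- (Cpower (z - RtoC t * e) (b - 1) * z * (RtoC (INR (S k)) * bin_coef b (S k) * w ^ (S k))
         * RtoC t ^ k))%C).
  { intros t Ht. specialize (Hoff t Ht).
    destruct (bin_poly_der b w k t) as [V [H1 H2]].
    assert (H3 : cder (fun s => Cpower (z - RtoC s * e) b) t
              (b * Cpower (z - RtoC t * e) (b - 1) * (- e))%C).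
    { apply (hol_Cpower _ b Hoff (fun s => z - RtoC s * e)%C); auto.
      eapply cder_val; [apply cder_minus; [apply cder_const|apply cder_mult; [apply cder_id|apply cder_const]]|].
      beta_ring. }
    eapply cder_val; [apply (cder_mult _ _ _ _ _ H3 H1)|].
    cbv beta.
    replace (Cpower (z - RtoC t * e) b) with (Cpower (z - RtoC t * e) (b - 1) * (z - RtoC t * e))%C.
    2:{ rewrite Cpower_minus_1 by (apply off_cut_neq_0; auto). field. apply off_cut_neq_0; auto. }
    set (P := Cpower (z - RtoC t * e) (b - 1)) in *.
    set (Q := partial_sum _ (S k)) in *.
    transitivity (P * z * ((1 - RtoC t * w) * V - w * (b * Q)))%C.
    { rewrite Ee. beta_ring. }
    rewrite H2, Cpow_mult_l. simpl Cpow. beta_ring. }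
  assert (M : Cmod (F 1 - F 0) <= K).
  { apply (mean_value_bound F _ K D). intros t Ht. rewrite Cmod_opp, !Cmod_mult, !Cmod_pow, !Cmod_R.
      rewrite (Rabs_right (INR (S k))) by (apply Rle_ge, pos_INR).
      unfold K. rewrite Rabs_right by lra.
      assert (T0 : 0 <= t ^ k <= 1).
      { split; [apply pow_le; lra|]. rewrite <- (pow1 k). apply pow_incr; lra. }
      specialize (HB t Ht).
      pose proof (Cmod_ge_0 (Cpower (z - RtoC t * e) (b - 1))) as P1.
      pose proof (Cmod_ge_0 z) as P2.
      assert (P3 : 0 <= INR (S k) * Cmod (bin_coef b (S k)) * Cmod w ^ S k).
      { repeat apply Rmult_le_pos; try apply pos_INR; try apply Cmod_ge_0.
        apply pow_le, Cmod_ge_0. }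
      set (X := INR (S k) * Cmod (bin_coef b (S k)) * Cmod w ^ S k) in *.
      set (Y := Cmod (Cpower (z - RtoC t * e) (b - 1)) * Cmod z) in *.
      assert (P4 : 0 <= Y) by (unfold Y; apply Rmult_le_pos; auto).
      pose proof (Rmult_le_compat_r X _ _ P3 HB).
      assert (0 <= Y * X) by (apply Rmult_le_pos; auto). nra. }
  unfold F in M.
  replace (z - RtoC 1 * e)%C with (z - e)%C in M by ring.
  replace (z - RtoC 0 * e)%C with z in M by ring.
  replace (partial_sum (fun n => bin_coef b n * (RtoC 0 * w) ^ n)%C (S k)) with (RtoC 1) in M.
  2:{ clear. induction k as [|k IH].
      - rewrite partial_sum_S, bin_coef_0. simpl. beta_ring.
      - rewrite partial_sum_S, <- IH. simpl Cpow. beta_ring. }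
  replace (partial_sum (fun n => bin_coef b n * (RtoC 1 * w) ^ n)%C (S k))
    with (partial_sum (fun n => bin_coef b n * w ^ n)%C (S k)) in M.
  2:{ apply partial_sum_ext. intros. do 2 f_equal. beta_ring. }
  replace (Cpower z b * 1)%C with (Cpower z b) in M by ring.
  exact M.
Qed.

Lemma binomial_remainder_inv (z e b : C) (B B' : R) (k : nat) :
  (forall s, 0 <= s <= 1 -> off_cut (z - RtoC s * e)) ->
  (forall s, 0 <= s <= 1 -> Cmod (Cpower (z - RtoC s * e) (b - 1)) * Cmod z <= B) ->
  Cmod (Cpower (z - e) (- b)) * Cmod (Cpower z (- b)) <= B' ->
  Cmod (Cpower (z - e) (- b) -
        Cpower z (- b) * partial_sum (fun n => bin_coef b n * (e / z) ^ n) (S k))%C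
  <= B' * (B * (INR (S k) * Cmod (bin_coef b (S k)) * Cmod (e / z) ^ (S k))).
Proof.
  intros H1 H2 H3.
  pose proof (binomial_remainder z e b B k H1 H2) as R.
  set (Q := partial_sum _ (S k)) in *.
  pose proof (Cpower_neq_0 z b). pose proof (Cpower_neq_0 (z - e) b).
  replace (Cpower (z - e) (- b) - Cpower z (- b) * Q)%C with
    (Cpower (z - e) (- b) * Cpower z (- b) * - (Cpower (z - e) b * Q - Cpower z b))%C.
  2:{ rewrite !Cpower_opp. field. auto. }
  rewrite !Cmod_mult, Cmod_opp.
  apply Rmult_le_compat; auto.
  - apply Rmult_le_pos; apply Cmod_ge_0.
  - apply Cmod_ge_0.
Qed.

Lemma exp_poly_der w k t :
  cder (fun s => partial_sum (fun n => (RtoC s * w) ^ n / Cfact n) (S k))%C t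
    (w * partial_sum (fun n => (RtoC t * w) ^ n / Cfact n) k)%C.
Proof.
  induction k as [|k IH].
  - apply cder_ext with (f := fun _ => (1 / Cfact 0)%C).
    + intros s. rewrite partial_sum_S. simpl. beta_ring.
    + eapply cder_val; [apply cder_const|]. simpl. beta_ring.
  - eapply cder_ext; [intros s; symmetry; apply partial_sum_S|].
    eapply cder_val.
    + apply cder_plus; [exact IH|].
      apply (cder_ext (fun s => / Cfact (S k) * (RtoC s * w) ^ (S k))%C).
      { intros s. unfold Cdiv. beta_ring. }
      apply cder_scal, (cder_Cpow (fun s => RtoC s * w)%C).
      apply cder_mult; [apply cder_id|apply cder_const].
    + rewrite partial_sum_S, Cfact_S. cbv beta. field.
      split; [apply Cfact_neq_0|apply INR_S_neq_0].
Qed.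

Lemma Re_ge_Cmod z : - Cmod z <= Re z.
Proof. pose proof (re_le_Cmod z) as H. apply Rabs_le_between in H. lra. Qed.

Lemma Re_le_Cmod' z : Re z <= Cmod z.
Proof. pose proof (re_le_Cmod z) as H. apply Rabs_le_between in H. lra. Qed.

Lemma exp_le (u v : R) : u <= v -> exp u <= exp v.
Proof. intros [L| ->]; [left; apply exp_increasing, L|right; reflexivity]. Qed.

(** The same device as for the binomial polynomial: multiplication by e^(-s w) makes
    all terms but the last one telescope in the derivative. *)
Lemma exponential_remainder (w : C) (k : nat) :
  Cmod (Cexp w - partial_sum (fun n => w ^ n / Cfact n) (S k))%C
  <= exp (2 * Cmod w) * (Cmod w ^ (S k) / INR (fact k)).
Proof.
  set (F := fun s => (Cexp (- (RtoC s * w)) *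
     partial_sum (fun n => (RtoC s * w) ^ n / Cfact n)%C (S k))%C).
  set (K := exp (Cmod w) * (Cmod w ^ (S k) / INR (fact k))).
  assert (D : forall t, 0 <= t <= 1 -> cder F t
     (- (Cexp (- (RtoC t * w)) * (w * ((RtoC t * w) ^ k / Cfact k))))%C).
  { intros t _. eapply cder_val.
    - apply cder_mult; [|apply exp_poly_der].
      apply (hol_Cexp (- (RtoC t * w))%C (fun s => - (RtoC s * w))%C); [reflexivity|].
      apply cder_opp. apply cder_mult; [apply cder_id|apply cder_const].
    - cbv beta. rewrite partial_sum_S. beta_ring. }
  assert (M : Cmod (F 1 - F 0) <= K).
  { apply (mean_value_bound F _ K D). intros t Ht. rewrite Cmod_opp, Cmod_mult, Cmod_Cexp, Cmod_mult.
      rewrite Cmod_div, Cmod_pow by apply Cfact_neq_0.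
      unfold Cfact. rewrite Cmod_R, (Rabs_right (INR _)) by (apply Rle_ge, pos_INR).
      rewrite Cmod_mult, Cmod_R, Rabs_right by lra.
      unfold K. apply Rmult_le_compat.
      + left; apply exp_pos.
      + apply Rmult_le_pos; [apply Cmod_ge_0|].
        apply Rdiv_le_0_compat; [|apply INR_fact_lt_0].
        apply pow_le, Rmult_le_pos; [lra|apply Cmod_ge_0].
      + apply exp_le. eapply Rle_trans; [apply Re_le_Cmod'|].
        rewrite Cmod_opp, Cmod_mult, Cmod_R, Rabs_right by lra.
        pose proof (Cmod_ge_0 w). nra.
      + simpl. unfold Rdiv. rewrite <- Rmult_assoc. apply Rmult_le_compat_r.
        { left; apply Rinv_0_lt_compat, INR_fact_lt_0. }
        apply Rmult_le_compat_l; [apply Cmod_ge_0|].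
        pose proof (Cmod_ge_0 w).
        apply pow_incr. split; [apply Rmult_le_pos; lra|]. nra. }
  assert (F0 : F 0 = 1%C).
  { unfold F. replace (- (RtoC 0 * w))%C with (RtoC 0) by ring. rewrite Cexp_0.
    clear. induction k as [|k IH].
    - rewrite partial_sum_S. unfold Cfact. simpl. field.
    - rewrite partial_sum_S, Cmult_plus_distr_l, IH. simpl Cpow. unfold Cdiv. beta_ring. }
  assert (F1 : F 1 = (Cexp (- w) * partial_sum (fun n => w ^ n / Cfact n) (S k))%C).
  { unfold F. replace (- (RtoC 1 * w))%C with (- w)%C by ring. f_equal.
    apply partial_sum_ext. intros. replace (RtoC 1 * w)%C with w by ring. reflexivity. }
  rewrite F0, F1 in M.
  set (Q := partial_sum _ (S k)) in *.
  replace (Cexp w - Q)%C with (Cexp w * - (Cexp (- w) * Q - 1))%C.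
  2:{ rewrite Cexp_opp. field. apply Cexp_neq_0. }
  rewrite Cmod_mult, Cmod_opp, Cmod_Cexp.
  replace (2 * Cmod w) with (Cmod w + Cmod w) by ring. rewrite exp_plus, Rmult_assoc.
  apply Rmult_le_compat.
  - left; apply exp_pos.
  - apply Cmod_ge_0.
  - apply exp_le, Re_le_Cmod'.
  - exact M.
Qed.

Lemma geometric_decay (u : nat -> R) (rho : R) (k0 : nat) :
  0 <= rho < 1 -> (forall k, 0 <= u k) ->
  (forall k, (k0 <= k)%nat -> u (S k) <= rho * u k) ->
  is_lim_seq u 0.
Proof.
  intros Hr Hu H.
  apply (is_lim_seq_incr_n u k0).
  apply is_lim_seq_le_le with (u := fun _ => 0) (w := fun n => u k0 * rho ^ n).
  - intros n. split; [apply Hu|].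
    induction n as [|n IH]; simpl.
    + lra.
    + eapply Rle_trans; [apply H; lia|]. nra.
  - apply is_lim_seq_const.
  - replace (Finite 0) with (Rbar_mult (u k0) 0) by (simpl; f_equal; ring).
    apply is_lim_seq_scal_l. apply is_lim_seq_geom. rewrite Rabs_right; lra.
Qed.

Lemma binomial_remainder_decay b r : 0 <= r < 1 ->
  is_lim_seq (fun k => INR (S k) * Cmod (bin_coef b (S k)) * r ^ (S k)) 0.
Proof.
  intros Hr.
  destruct (Req_dec r 0) as [->|Hr0].
  { apply is_lim_seq_ext with (fun _ => 0); [|apply is_lim_seq_const].
    intros n. simpl. beta_ring. }
  set (rho := (1 + r) / 2).
  destruct (INR_unbounded (Cmod b * r / (rho - r))) as [k0 Hk0].
  apply (geometric_decay _ rho k0).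
  - unfold rho; lra.
  - intros k. apply Rmult_le_pos; [apply Rmult_le_pos|apply pow_le; lra].
    + apply pos_INR.
    + apply Cmod_ge_0.
  - intros k Hk.
    pose proof (f_equal Cmod (bin_coef_S b (S k))) as E.
    rewrite !Cmod_mult, Cmod_R, Rabs_right in E by (apply Rle_ge, pos_INR).
    rewrite E.
    assert (P : Cmod (b + RtoC (INR (S k))) * r <= rho * INR (S k)).
    { assert (L : Cmod (b + RtoC (INR (S k))) <= Cmod b + INR (S k)).
      { eapply Rle_trans; [apply Cmod_triangle|]. rewrite Cmod_R, Rabs_right; [lra|].
        apply Rle_ge, pos_INR. }
      assert (Hk1 : INR k0 <= INR (S k)) by (apply le_INR; lia).
      assert (Q : Cmod b * r <= (rho - r) * INR (S k)).
      { assert (0 < rho - r) by (unfold rho; lra).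
        replace (Cmod b * r) with ((rho - r) * (Cmod b * r / (rho - r))) by (field; lra).
        apply Rmult_le_compat_l; lra. }
      nra. }
    assert (X : 0 <= Cmod (bin_coef b (S k)) * r ^ S k).
    { apply Rmult_le_pos; [apply Cmod_ge_0|apply pow_le; lra]. }
    change (r ^ S (S k)) with (r * r ^ S k).
    replace (Cmod (b + RtoC (INR (S k))) * Cmod (bin_coef b (S k)) * (r * r ^ S k))
      with (Cmod (b + RtoC (INR (S k))) * r * (Cmod (bin_coef b (S k)) * r ^ S k)) by ring.
    replace (rho * (INR (S k) * Cmod (bin_coef b (S k)) * r ^ S k))
      with (rho * INR (S k) * (Cmod (bin_coef b (S k)) * r ^ S k)) by ring.
    apply Rmult_le_compat_r; auto.
Qed.

Lemma exponential_remainder_decay r : 0 <= r ->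
  is_lim_seq (fun k => r ^ (S k) / INR (fact k)) 0.
Proof.
  intros Hr. destruct (INR_unbounded (2 * r)) as [k0 Hk0].
  apply (geometric_decay _ (1 / 2) k0).
  - lra.
  - intros k. apply Rdiv_le_0_compat; [apply pow_le; lra|apply INR_fact_lt_0].
  - intros k Hk. rewrite fact_simpl, mult_INR.
    pose proof (INR_fact_lt_0 k).
    assert (L : 2 * r <= INR (S k)).
    { assert (INR k0 <= INR (S k)) by (apply le_INR; lia). lra. }
    assert (P : 0 < INR (S k)) by (apply lt_0_INR; lia).
    change (r ^ S (S k)) with (r * r ^ S k).
    replace (r * r ^ S k / (INR (S k) * INR (fact k)))
      with (r / INR (S k) * (r ^ S k / INR (fact k))) by (field; lra).
    apply Rmult_le_compat_r.
    + apply Rdiv_le_0_compat; [apply pow_le; lra|lra].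
    + apply Rmult_le_reg_r with (INR (S k)); auto. unfold Rdiv.
      rewrite Rmult_assoc, Rinv_l by lra. lra.
Qed.

(** * Primitives on star-shaped domains *)

Definition ccont (G : C -> C) (z : C) : Prop :=
  forall eps, 0 < eps ->
    exists d, 0 < d /\ forall w, Cmod (w - z) < d -> Cmod (G w - G z) < eps.

Lemma clim_ccont {T} Ft {FF : Filter Ft} (G : C -> C) (f : T -> C) z :
  ccont G z -> clim Ft f z -> clim Ft (fun x => G (f x)) (G z).
Proof.
  intros HG Hf eps He. destruct (HG eps He) as (d & Hd & H).
  generalize (Hf d Hd). apply filter_imp. intros x; apply H.
Qed.

(** Punctual continuity as a limit along the filter of small discs, so that the
    algebra of limits applies. *)
Definition discs (z : C) (P : C -> Prop) : Prop :=
  exists d, 0 < d /\ forall w, Cmod (w - z) < d -> P w.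

Global Instance discs_filter z : Filter (discs z).
Proof.
  constructor.
  - exists 1; split; [lra|auto].
  - intros P Q (d & Hd & HP) (e & He & HQ). exists (Rmin d e). split.
    + apply Rmin_glb_lt; auto.
    + intros w Hw. pose proof (Rmin_l d e). pose proof (Rmin_r d e).
      split; [apply HP|apply HQ]; lra.
  - intros P Q I (d & Hd & HP). exists d; split; auto.
Qed.

Lemma ccont_clim G z : ccont G z <-> clim (discs z) G (G z).
Proof. split; intros H; exact H. Qed.

Lemma ccont_id z : ccont (fun w => w) z.
Proof. intros eps He. exists eps; auto. Qed.

Lemma ccont_const k z : ccont (fun _ => k) z.
Proof. apply (clim_const (discs z) k). Qed.

Lemma ccont_plus G H z : ccont G z -> ccont H z -> ccont (fun w => G w + H w)%C z.
Proof. intros A B. apply (clim_plus (discs z) G H); auto. Qed.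

Lemma ccont_minus G H z : ccont G z -> ccont H z -> ccont (fun w => G w - H w)%C z.
Proof. intros A B. apply (clim_minus (discs z) G H); auto. Qed.

Lemma ccont_mult G H z : ccont G z -> ccont H z -> ccont (fun w => G w * H w)%C z.
Proof. intros A B. apply (clim_mult (discs z) G H); auto. Qed.

Lemma ccont_comp G H z : ccont G (H z) -> ccont H z -> ccont (fun w => G (H w)) z.
Proof. intros A B. apply (clim_ccont (discs z) G H); auto. Qed.

Lemma ccont_of_bounded_derivative G G' z d M : 0 < d ->
  (forall w, Cmod (w - z) < d -> hol G w (G' w) /\ Cmod (G' w) <= M) -> ccont G z.
Proof.
  intros Hd H eps He.
  assert (HM : 0 <= M).
  { destruct (H z) as [_ B].
    - replace (z - z)%C with (RtoC 0) by ring. rewrite Cmod_0; auto.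
    - eapply Rle_trans; [apply Cmod_ge_0|exact B]. }
  exists (Rmin d (eps / (M + 1))). split.
  { apply Rmin_glb_lt; auto. apply Rdiv_lt_0_compat; lra. }
  intros w Hw. pose proof (Rmin_l d (eps / (M + 1))). pose proof (Rmin_r d (eps / (M + 1))).
  assert (In : forall t, 0 <= t <= 1 -> Cmod (z + RtoC t * (w - z) - z) < d).
  { intros t Ht. replace (z + RtoC t * (w - z) - z)%C with (RtoC t * (w - z))%C by ring.
    rewrite Cmod_mult, Cmod_R, Rabs_right by lra. pose proof (Cmod_ge_0 (w - z)). nra. }
  pose proof (mean_value_bound (fun t => G (z + RtoC t * (w - z))%C)
    (fun t => G' (z + RtoC t * (w - z)) * (w - z))%C (M * Cmod (w - z))) as MV.
  cbv beta in MV.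
  replace (z + RtoC 1 * (w - z))%C with w in MV by ring.
  replace (z + RtoC 0 * (w - z))%C with z in MV by ring.
  eapply Rle_lt_trans.
  - apply MV.
    + intros t Ht. apply (proj1 (H _ (In t Ht)) (fun t => z + RtoC t * (w - z))%C t); auto.
      apply cder_line.
    + intros t Ht. rewrite Cmod_mult. apply Rmult_le_compat_r; [apply Cmod_ge_0|].
      apply H, In, Ht.
  - pose proof (Cmod_ge_0 (w - z)).
    replace eps with ((M + 1) * (eps / (M + 1))) by (field; lra). nra.
Qed.

Lemma ccont_Cexp z : ccont Cexp z.
Proof.
  apply (ccont_of_bounded_derivative Cexp Cexp z 1 (exp (Re z + 1)) ltac:(lra)).
  intros w Hw. split; [apply hol_Cexp|]. rewrite Cmod_Cexp. apply exp_le.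
  pose proof (fst_le_Cmod (w - z)) as B. simpl in B. apply Rabs_le_between in B.
  unfold Re. lra.
Qed.

Lemma off_cut_open z w : off_cut z -> Cmod (w - z) < (Cmod z + Re z) / 2 -> off_cut w.
Proof.
  unfold off_cut. intros Hz B.
  pose proof (fst_le_Cmod (w - z)) as B1. simpl in B1. apply Rabs_le_between in B1.
  pose proof (Cmod_diff_ge z w) as B2. rewrite Cmod_minus_sym in B2. unfold Re in *. lra.
Qed.

Lemma ccont_Cinv (z : C) : z <> 0%C -> ccont Cinv z.
Proof.
  intros Hz eps He. pose proof (proj1 (Cmod_gt_0 z) Hz) as Pz.
  set (m := Cmod z) in *.
  exists (Rmin (m / 2) (eps * (m * m / 2))). split.
  { apply Rmin_glb_lt; [lra|]. apply Rmult_lt_0_compat; [lra|nra]. }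
  intros w Hw. pose proof (Rmin_l (m / 2) (eps * (m * m / 2))).
  pose proof (Rmin_r (m / 2) (eps * (m * m / 2))).
  pose proof (Cmod_diff_ge z w) as B. rewrite Cmod_minus_sym in B. fold m in B.
  assert (Pw : m / 2 < Cmod w) by lra.
  assert (Hw0 : w <> 0%C) by (apply Cmod_gt_0; lra).
  replace (/ w - / z)%C with (- (w - z) / (w * z))%C by (field; auto).
  rewrite Cmod_div, Cmod_opp, Cmod_mult.
  2:{ apply Cmult_neq_0; auto. }
  fold m. apply Rmult_lt_reg_r with (Cmod w * m); [nra|].
  unfold Rdiv. rewrite Rmult_assoc, Rinv_l by nra. 
  apply Rlt_le_trans with (eps * (m * m / 2)); [lra|].
  apply Rmult_le_compat_l; [lra|]. nra.
Qed.

Lemma ccont_Clog z : off_cut z -> ccont Clog z.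
Proof.
  intros Hz. pose proof (off_cut_neq_0 z Hz) as Nz.
  pose proof (proj1 (Cmod_gt_0 z) Nz) as Pz.
  pose proof Hz as Pz2. unfold off_cut in Pz2.
  apply (ccont_of_bounded_derivative Clog Cinv z
           (Rmin (Cmod z / 2) ((Cmod z + Re z) / 2)) (/ (Cmod z / 2))).
  { apply Rmin_glb_lt; lra. }
  intros w Hw. pose proof (Rmin_l (Cmod z / 2) ((Cmod z + Re z) / 2)).
  pose proof (Rmin_r (Cmod z / 2) ((Cmod z + Re z) / 2)).
  assert (Ow : off_cut w) by (apply (off_cut_open z); auto; lra).
  split; [apply hol_Clog, Ow|].
  rewrite Cmod_inv by (apply off_cut_neq_0, Ow).
  apply Rinv_le_contravar; [lra|].
  pose proof (Cmod_diff_ge z w) as B. rewrite Cmod_minus_sym in B. lra.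
Qed.

Lemma clim_fst_prod t s : clim (locally ((t, s) : R * R)) (fun p => RtoC (fst p)) (RtoC t).
Proof.
  intros eps He. exists (mkposreal _ He). intros [u v] [B _].
  rewrite <- RtoC_minus, Cmod_R. exact B.
Qed.

Lemma clim_snd_prod t s : clim (locally ((t, s) : R * R)) (fun p => RtoC (snd p)) (RtoC s).
Proof.
  intros eps He. exists (mkposreal _ He). intros [u v] [_ B].
  rewrite <- RtoC_minus, Cmod_R. exact B.
Qed.

(** Cauchy's theorem for a star-shaped domain: the radial integral is a
    primitive, because the derivative of its integrand in the endpoint is an
    exact derivative in the radial variable. *)
Lemma star_primitive (D : C -> Prop) (z0 : C) (G G' : C -> C) :
  (forall z, D z -> discs z D) ->
  (forall z s, D z -> 0 <= s <= 1 -> D (z0 + RtoC s * (z - z0))%C) ->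
  (forall z, D z -> hol G z (G' z) /\ ccont G z /\ ccont G' z) ->
  exists P : C -> C, forall (p q : C) (t : R), D (p + RtoC t * q)%C ->
    cder (fun u => P (p + RtoC u * q)%C) t (q * G (p + RtoC t * q))%C.
Proof.
  intros Hopen Hstar HG.
  set (K := fun (z : C) (s : R) => ((z - z0) * G (z0 + RtoC s * (z - z0)))%C).
  exists (fun z => (RInt (fun s => fst (K z s)) 0 1, RInt (fun s => snd (K z s)) 0 1)).
  intros p q t Dt.
  set (gam := fun u : R => (p + RtoC u * q)%C).
  set (zeta := fun u s : R => (z0 + RtoC s * (gam u - z0))%C).
  set (K1 := fun u s : R => (q * G (zeta u s) + RtoC s * (gam u - z0) * q * G' (zeta u s))%C).
  assert (Lgam : forall s, clim (locally ((t, s) : R * R)) (fun x => gam (fst x)) (gam t)).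
  { intros s. apply clim_plus; [typeclasses eauto|apply clim_const; typeclasses eauto|].
    apply clim_mult; [typeclasses eauto|apply clim_fst_prod|apply clim_const; typeclasses eauto]. }
  assert (Lzeta : forall s, clim (locally ((t, s) : R * R)) (fun x => zeta (fst x) (snd x)) (zeta t s)).
  { intros s. apply clim_plus; [typeclasses eauto|apply clim_const; typeclasses eauto|].
    apply clim_mult; [typeclasses eauto|apply clim_snd_prod|].
    apply clim_minus; [typeclasses eauto|apply Lgam|apply clim_const; typeclasses eauto]. }
  assert (Dzeta : forall s, 0 <= s <= 1 -> D (zeta t s)).
  { intros s Hs. apply Hstar; auto. }
  assert (LK1 : forall s, 0 <= s <= 1 ->
     clim (locally ((t, s) : R * R)) (fun x => K1 (fst x) (snd x)) (K1 t s)).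
  { intros s Hs. destruct (HG _ (Dzeta s Hs)) as (_ & C1 & C2). unfold K1.
    apply clim_plus; [typeclasses eauto| |].
    - apply clim_scal; [typeclasses eauto|]. apply clim_ccont; auto. typeclasses eauto.
    - apply clim_mult; [typeclasses eauto| |apply clim_ccont; auto; typeclasses eauto].
      apply clim_mult; [typeclasses eauto| |apply clim_const; typeclasses eauto].
      apply clim_mult; [typeclasses eauto|apply clim_snd_prod|].
      apply clim_minus; [typeclasses eauto|apply Lgam|apply clim_const; typeclasses eauto]. }
  assert (DK : forall u s, D (zeta u s) -> cder (fun u' => K (gam u') s) u (K1 u s)).
  { intros u s Hd. destruct (HG _ Hd) as (H & _). unfold K.
    assert (Dg : cder (fun u' => gam u' - z0)%C u q).
    { eapply cder_val; [apply cder_minus; [apply cder_line|apply cder_const]|ring]. }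
    eapply cder_val.
    - apply cder_mult; [exact Dg|].
      apply (H (fun u' => z0 + RtoC s * (gam u' - z0))%C u (RtoC s * q)%C); [reflexivity|].
      eapply cder_val; [apply cder_plus; [apply cder_const|apply cder_scal, Dg]|ring].
    - unfold K1, zeta. ring. }
  (* the same K1 is the derivative in s of s q G, hence integrates to q G at s = 1 *)
  assert (DK2 : forall s, 0 <= s <= 1 ->
     cder (fun s' => RtoC s' * (q * G (zeta t s')))%C s (K1 t s)).
  { intros s Hs. destruct (HG _ (Dzeta s Hs)) as (H & _).
    eapply cder_val.
    - apply cder_mult; [apply cder_id|]. apply cder_scal.
      apply (H (fun s' => zeta t s') s (gam t - z0)%C); [reflexivity|].
      apply cder_line.
    - unfold K1. ring. }
  assert (Loc : locally t (fun u => D (gam u))).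
  { destruct (Hopen _ Dt) as (d & Hd & Hb).
    generalize (cder_cont _ _ _ d (cder_line p q t) Hd). apply filter_imp.
    intros u; apply Hb. }
  assert (Loc2 : forall s, 0 <= s <= 1 ->
            locally ((t, s) : R * R) (fun x => D (zeta (fst x) (snd x)))).
  { intros s Hs. destruct (Hopen _ (Dzeta s Hs)) as (d & Hd & Hb).
    generalize (Lzeta s d Hd). apply filter_imp. intros x; apply Hb. }
  assert (Comp : forall h : C -> R,
    (forall f u v, cder f u v -> is_derive (fun s => h (f s)) u (h v)) ->
    (forall z w, Rabs (h z - h w) <= Cmod (z - w)) ->
    is_derive (fun u => RInt (fun s => h (K (gam u) s)) 0 1) t (h (q * G (gam t))%C)).
  { intros h Hh Hl.
    assert (Der : forall u s, D (zeta u s) ->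
              Derive (fun u' => h (K (gam u') s)) u = h (K1 u s)).
    { intros u s Hd. apply is_derive_unique. apply Hh, DK, Hd. }
    assert (Rm : Rmin 0 1 = 0) by (apply Rmin_left; lra).
    assert (RM : Rmax 0 1 = 1) by (apply Rmax_right; lra).
    eapply is_derive_val.
    - apply (is_derive_RInt_param (fun u s => h (K (gam u) s)) 0 1 t).
      + rewrite Rm, RM. revert Loc. apply filter_imp. intros u Hu s Hs.
        eexists. apply Hh. apply DK. apply Hstar; auto.
      + rewrite Rm, RM. intros s Hs eps.
        apply locally_2d_locally.
        rewrite (Der t s (Dzeta s Hs)).
        generalize (filter_and _ _ (Loc2 s Hs) (LK1 s Hs eps (cond_pos eps))).
        apply filter_imp. intros [u v] [A B]. simpl in A, B.
        change (Rabs (Derive (fun u' : R => h (K (gam u') v)) u - h (K1 t s)) < eps).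
        rewrite (Der u v A). eapply Rle_lt_trans; [apply Hl|exact B].
      + revert Loc. apply filter_imp. intros u Hu.
        apply (ex_RInt_continuous (V := R_CompleteNormedModule)).
        rewrite Rm, RM. intros s Hs.
        destruct (HG _ (Hstar _ s Hu Hs)) as (H & _).
        apply (ex_derive_continuous (K := R_AbsRing) (V := R_NormedModule)). eexists.
        apply Hh. unfold K. apply cder_scal.
        apply (H (fun s => z0 + RtoC s * (gam u - z0))%C s (gam u - z0)%C); [reflexivity|].
        apply cder_line.
    - transitivity (RInt (fun s => h (K1 t s)) 0 1).
      + apply RInt_ext. rewrite Rm, RM. intros s Hs. apply Der, Dzeta. lra.
      + apply is_RInt_unique.
        replace (h (q * G (gam t))%C) with
          (minus (h (RtoC 1 * (q * G (zeta t 1)))%C) (h (RtoC 0 * (q * G (zeta t 0)))%C)).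
        * apply (is_RInt_derive (V := R_CompleteNormedModule)
                   (fun s => h (RtoC s * (q * G (zeta t s)))%C)).
          { rewrite Rm, RM. intros s Hs. apply Hh, DK2, Hs. }
          { rewrite Rm, RM. intros s Hs. apply filterlim_locally. intros eps.
            destruct (LK1 s Hs eps (cond_pos eps)) as [d Hd].
            exists d. intros s' Hs'. eapply Rle_lt_trans; [apply (Hl (K1 t s') (K1 t s))|].
            apply (Hd (t, s')). split; [apply ball_center|exact Hs']. }
        * replace (RtoC 0 * (q * G (zeta t 0)))%C with (RtoC 0) by ring.
          assert (h0 : h (RtoC 0) = 0).
          { pose proof (is_derive_unique _ _ _ (Hh _ 0 _ (cder_const (RtoC 0) 0))) as E.
            etransitivity; [symmetry; exact E|exact (Derive_const (h (RtoC 0)) 0)]. }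
          rewrite h0.
          replace (RtoC 1 * (q * G (zeta t 1)))%C with (q * G (gam t))%C.
          { unfold minus, plus, opp; simpl. ring. }
          { unfold zeta. replace (z0 + RtoC 1 * (gam t - z0))%C with (gam t) by ring. ring. } }
  split; simpl.
  - apply (Comp fst).
    + intros f u v H; apply H.
    + intros z w. apply (fst_le_Cmod (z - w)).
  - apply (Comp snd).
    + intros f u v H; apply H.
    + intros z w. apply (snd_le_Cmod (z - w)).
Qed.

(** * The Gamma integral and its rotation *)

Lemma is_derive_Rpower a t : 0 < t ->
  is_derive (fun s => Rpower s a) t (a * Rpower t (a - 1)).
Proof.
  intros Ht. unfold Rpower. auto_derive; [exact Ht|].
  replace ((a - 1) * ln t) with (a * ln t + - ln t) by ring.
  rewrite exp_plus, exp_Ropp, exp_ln by auto. field. lra.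
Qed.

Lemma Rpower_pos t a : 0 < Rpower t a.
Proof. apply exp_pos. Qed.

Lemma Rpower_small t a e : 0 < a -> 0 < e -> 0 < t < Rpower e (/ a) -> Rpower t a < e.
Proof.
  intros Ha He [Ht H].
  replace e with (Rpower (Rpower e (/ a)) a).
  2:{ rewrite Rpower_mult, Rinv_l, Rpower_1; auto; lra. }
  apply Rlt_Rpower_l; auto.
Qed.

Lemma Rpower_le_pow t a n : 1 <= t -> a <= INR n -> Rpower t a <= t ^ n.
Proof. intros H1 H2. rewrite <- Rpower_pow by lra. apply Rle_Rpower; auto. Qed.

Lemma pow_le_exp u n : 0 <= u -> u ^ n <= INR (fact n) * exp u.
Proof.
  intros Hu. pose proof (INR_fact_lt_0 n).
  pose proof (exp_ge_taylor u n Hu) as T.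
  assert (L : u ^ n / INR (fact n) <= sum_f_R0 (fun k => u ^ k / INR (fact k)) n).
  { destruct n as [|n]; [simpl; lra|]. rewrite tech5.
    assert (0 <= sum_f_R0 (fun k => u ^ k / INR (fact k)) n); [|lra].
    apply cond_pos_sum. intros k. apply Rdiv_le_0_compat; [apply pow_le; auto|apply INR_fact_lt_0]. }
  replace (u ^ n) with (INR (fact n) * (u ^ n / INR (fact n))) by (field; lra).
  apply Rmult_le_compat_l; lra.
Qed.

Lemma at_right_0_lt e : 0 < e -> at_right 0 (fun t => 0 < t < e).
Proof.
  intros He. exists (mkposreal _ He). intros y B Hy.
  change (Rabs (y - 0) < e) in B. apply Rabs_def2 in B. lra.
Qed.

(** The bound that makes all boundary terms on the half-line vanish. *)
Lemma gamma_decay (F : R -> C) (K alpha kappa : R) : 0 < alpha -> 0 < kappa ->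
  (forall t, 0 < t -> Cmod (F t) <= K * (Rpower t alpha * exp (- (kappa * t)))) ->
  clim (at_right 0) F 0%C /\ clim (rend p_infty) F 0%C.
Proof.
  intros Ha Hk H.
  assert (HK : 0 <= K).
  { specialize (H 1 ltac:(lra)). pose proof (Cmod_ge_0 (F 1)).
    pose proof (Rpower_pos 1 alpha). pose proof (exp_pos (- (kappa * 1))).
    apply Rnot_lt_le. intros L.
    assert (0 < Rpower 1 alpha * exp (- (kappa * 1))) by (apply Rmult_lt_0_compat; auto). nra. }
  split.
  - intros eps He. set (e := eps / (K + 1)).
    assert (e0 : 0 < e) by (apply Rdiv_lt_0_compat; lra).
    generalize (at_right_0_lt _ (exp_pos (/ alpha * ln e))). apply filter_imp.
    intros t [Ht1 Ht2]. replace (F t - 0)%C with (F t) by ring.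
    eapply Rle_lt_trans; [apply H; auto|].
    pose proof (Rpower_small t alpha e Ha e0 (conj Ht1 Ht2)).
    assert (X : exp (- (kappa * t)) <= 1).
    { rewrite <- exp_0. apply exp_le. nra. }
    pose proof (Rpower_pos t alpha). pose proof (exp_pos (- (kappa * t))).
    apply Rle_lt_trans with (K * e).
    + apply Rmult_le_compat_l; auto. nra.
    + replace eps with ((K + 1) * e) by (unfold e; field; lra). nra.
  - intros eps He.
    destruct (INR_unbounded (alpha + 1)) as [n Hn].
    set (M := INR (fact n) / kappa ^ n).
    assert (M0 : 0 < M) by (apply Rdiv_lt_0_compat; [apply INR_fact_lt_0|apply pow_lt; auto]).
    exists (Rmax 1 (K * M / eps)). intros t Ht.
    assert (T1 : 1 < t) by (eapply Rle_lt_trans; [apply Rmax_l|exact Ht]).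
    assert (T2 : K * M / eps < t) by (eapply Rle_lt_trans; [apply Rmax_r|exact Ht]).
    replace (F t - 0)%C with (F t) by ring.
    eapply Rle_lt_trans; [apply H; lra|].
    assert (B1 : t * Rpower t alpha <= M * exp (kappa * t)).
    { replace (t * Rpower t alpha) with (Rpower t (alpha + 1)).
      2:{ rewrite Rpower_plus, Rpower_1 by lra. ring. }
      eapply Rle_trans; [apply Rpower_le_pow; [lra|left; exact Hn]|].
      pose proof (pow_le_exp (kappa * t) n ltac:(nra)) as B. rewrite Rpow_mult_distr in B.
      pose proof (pow_lt kappa n Hk).
      apply Rmult_le_reg_l with (kappa ^ n); auto.
      replace (kappa ^ n * (M * exp (kappa * t))) with (INR (fact n) * exp (kappa * t))
        by (unfold M; field; lra). exact B. }
    assert (B2 : t * (Rpower t alpha * exp (- (kappa * t))) <= M).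
    { replace M with (M * exp (kappa * t) * exp (- (kappa * t))).
      - rewrite <- Rmult_assoc. apply Rmult_le_compat_r; [left; apply exp_pos|exact B1].
      - rewrite Rmult_assoc, <- exp_plus. replace (kappa * t + - (kappa * t)) with 0 by ring.
        rewrite exp_0; ring. }
    apply Rmult_lt_reg_l with t; [lra|].
    replace (t * (K * (Rpower t alpha * exp (- (kappa * t)))))
      with (K * (t * (Rpower t alpha * exp (- (kappa * t))))) by ring.
    apply Rle_lt_trans with (K * M); [apply Rmult_le_compat_l; auto|].
    replace (K * M) with (K * M / eps * eps) by (field; lra).
    apply Rmult_lt_compat_r; auto.
Qed.

(** Antiderivatives on an interval differ by a constant, so each of them computes
    the integral. *)
Lemma nint_antiderivative (p : R) q f l F : Rbar_lt p q -> is_nint p q f l ->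
  (forall t, p < t -> Rbar_lt t q -> cder F t (f t)) ->
  exists la lb, clim (at_right p) F la /\ clim (rend q) F lb /\ l = (lb - la)%C.
Proof.
  intros Hpq (G & la & lb & H & H1 & H2 & ->) HF.
  pose proof (rend_filter q (lt_not_m _ _ Hpq)) as FFq.
  destruct (interior_point p q Hpq) as [m [Hm1 Hm2]].
  assert (Le : forall x y : R, p < x -> Rbar_lt y q -> x <= y ->
     Cmod ((F y - G y) - (F x - G x)) <= 0).
  { intros x y Hx Hy Hxy. replace 0 with (fst (RtoC 0) - fst (RtoC 0)) by (simpl; ring).
    apply (antiderivative_increment p q (fun t => F t - G t)%C (fun t => f t - f t)%C
             (fun _ => RtoC 0) (fun _ => 0)); auto.
    - intros; apply cder_minus; auto.
    - intros; apply cder_const.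
    - intros t _ _. replace (f t - f t)%C with (RtoC 0) by ring. rewrite Cmod_0; lra. }
  set (k := (F m - G m)%C).
  assert (E : forall t : R, p < t /\ Rbar_lt t q -> (G t + k)%C = F t).
  { intros t [A B].
    assert (Z : Cmod ((F t - G t) - k) <= 0).
    { destruct (Rle_dec m t).
      - apply Le; auto.
      - rewrite Cmod_minus_sym. apply Le; auto. lra. }
    pose proof (Cmod_ge_0 ((F t - G t) - k)).
    assert (Z0 : Cmod ((F t - G t) - k) = 0) by lra.
    apply Cmod_eq_0 in Z0.
    replace (F t) with (((F t - G t) - k) + (G t + k))%C by ring. rewrite Z0. ring. }
  exists (la + k)%C, (lb + k)%C. split; [|split].
  - apply (clim_ext_loc (at_right p) (fun t => G t + k)%C).
    + generalize (at_right_inside p q Hpq). apply filter_imp. exact E.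
    + apply (clim_plus (at_right p) G (fun _ => k)); [exact H1|apply (clim_const (at_right p))].
  - apply (clim_ext_loc (rend q) (fun t => G t + k)%C).
    + generalize (rend_inside p q Hpq). apply filter_imp. exact E.
    + apply (clim_plus (rend q) G (fun _ => k)); [exact H2|apply (clim_const (rend q))].
  - ring.
Qed.

Lemma nint_real (p : R) q g l : Rbar_lt p q ->
  is_nint p q (fun t => RtoC (g t)) l -> l = RtoC (fst l).
Proof.
  intros Hpq H. apply (nint_unique p q (fun t => RtoC (g t))); auto.
  destruct H as (F & la & lb & H & H1 & H2 & ->).
  pose proof (rend_filter q (lt_not_m _ _ Hpq)) as FFq.
  exists (fun t => RtoC (fst (F t))), (RtoC (fst la)), (RtoC (fst lb)).
  split; [|split; [|split]].
  - intros t A B. apply cder_RtoC. apply (proj1 (H t A B)).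
  - apply clim_RtoC; [typeclasses eauto|]. apply filterlim_Re; auto. typeclasses eauto.
  - apply clim_RtoC; [typeclasses eauto|]. apply filterlim_Re; auto. typeclasses eauto.
  - apply C_ext; simpl; ring.
Qed.

Definition gamma_integrand (a : C) (t : R) : C :=
  (Cpower (RtoC t) (a - 1) * RtoC (exp (- t)))%C.

Lemma cder_gamma_power a w t : 0 < t ->
  cder (fun s => Cpower (RtoC s) a * Cexp (- (w * RtoC s)))%C t
    (a * (Cpower (RtoC t) (a - 1) * Cexp (- (w * RtoC t)))
     - w * (Cpower (RtoC t) a * Cexp (- (w * RtoC t))))%C.
Proof.
  intros Ht. eapply cder_val.
  - apply cder_mult; [apply cder_Cpower_R; auto|].
    apply (hol_Cexp (- (w * RtoC t))%C (fun s => - (w * RtoC s))%C); [reflexivity|].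
    apply cder_opp, cder_scal, cder_id.
  - cbv beta. ring.
Qed.

Lemma gamma_integrand_exp a t :
  gamma_integrand a t = (Cpower (RtoC t) (a - 1) * Cexp (- (1 * RtoC t)))%C.
Proof.
  unfold gamma_integrand. f_equal. rewrite <- Cexp_R. f_equal. rewrite RtoC_opp. ring.
Qed.

Lemma ccontR_gamma_integrand a t : 0 < t -> ccontR (gamma_integrand a) t.
Proof.
  intros Ht. eapply cder_ccontR.
  eapply cder_ext; [intros s; symmetry; apply gamma_integrand_exp|].
  apply cder_gamma_power, Ht.
Qed.

(** This function has an explicit primitive, behaves like t^(alpha-1) at 0 and decays
    only polynomially, so that a multiple of it dominates the Gamma integrand. *)
Lemma nint_majorant alpha : 0 < alpha ->
  is_nint 0 p_infty
    (fun t => RtoC (Rpower t (alpha - 1) / (1 + Rpower t alpha) ^ 2)) (RtoC (/ alpha)).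
Proof.
  intros Ha.
  exists (fun t => RtoC (- / (alpha * (1 + Rpower t alpha)))), (RtoC (- / alpha)), (RtoC 0).
  split; [|split; [|split]].
  - intros t Ht _. apply cder_RtoC.
    pose proof (is_derive_Rpower alpha t Ht) as D.
    pose proof (Rpower_pos t alpha).
    assert (E : ex_derive (fun s => Rpower s alpha) t) by (eexists; exact D).
    set (h := fun s => Rpower s alpha) in *.
    assert (U : Derive h t = alpha * Rpower t (alpha - 1)) by exact (is_derive_unique _ _ _ D).
    change (is_derive (fun s => - / (alpha * (1 + h s))) t (Rpower t (alpha - 1) / (1 + h t) ^ 2)).
    assert (0 < h t) by (unfold h; auto).
    auto_derive.
    + split; auto. split; auto. nra.
    + change (fun x => h x) with h. rewrite U. field. lra.
  - intros eps He.
    set (e := alpha * eps). assert (e0 : 0 < e) by (apply Rmult_lt_0_compat; auto).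
    generalize (at_right_0_lt _ (exp_pos (/ alpha * ln e))). apply filter_imp.
    intros t [Ht1 Ht2].
    pose proof (Rpower_small t alpha e Ha e0 (conj Ht1 Ht2)) as S.
    pose proof (Rpower_pos t alpha).
    rewrite <- RtoC_minus, Cmod_R.
    replace (- / (alpha * (1 + Rpower t alpha)) - - / alpha)
      with (Rpower t alpha / alpha * / (1 + Rpower t alpha)) by (field; lra).
    assert (I1 : 0 < / (1 + Rpower t alpha) <= 1).
    { split; [apply Rinv_0_lt_compat; lra|].
      rewrite <- Rinv_1. apply Rinv_le_contravar; lra. }
    assert (I2 : 0 < Rpower t alpha / alpha) by (apply Rdiv_lt_0_compat; lra).
    rewrite Rabs_right by nra.
    apply Rle_lt_trans with (Rpower t alpha / alpha); [nra|].
    apply Rmult_lt_reg_r with alpha; auto. unfold Rdiv. rewrite Rmult_assoc, Rinv_l by lra.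
    unfold e in S. lra.
  - intros eps He. exists (Rmax 1 (Rpower (/ (alpha * eps)) (/ alpha))). intros t Ht.
    assert (ae : 0 < alpha * eps) by (apply Rmult_lt_0_compat; auto).
    assert (T1 : 1 < t) by (eapply Rle_lt_trans; [apply Rmax_l|exact Ht]).
    assert (T2 : Rpower (/ (alpha * eps)) (/ alpha) < t) by (eapply Rle_lt_trans; [apply Rmax_r|exact Ht]).
    assert (B : / (alpha * eps) < Rpower t alpha).
    { replace (/ (alpha * eps)) with (Rpower (Rpower (/ (alpha * eps)) (/ alpha)) alpha).
      - apply Rlt_Rpower_l; auto. split; auto. apply Rpower_pos.
      - rewrite Rpower_mult, Rinv_l, Rpower_1; auto; try lra. apply Rinv_0_lt_compat; auto. }
    rewrite <- RtoC_minus, Cmod_R.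
    pose proof (Rpower_pos t alpha).
    replace (- / (alpha * (1 + Rpower t alpha)) - 0) with (- / (alpha * (1 + Rpower t alpha))) by ring.
    rewrite Rabs_Ropp, Rabs_right.
    2:{ apply Rle_ge. left. apply Rinv_0_lt_compat. nra. }
    rewrite <- (Rinv_inv eps). apply Rinv_lt_contravar.
    + apply Rmult_lt_0_compat; [apply Rinv_0_lt_compat; auto|nra].
    + replace (/ eps) with (alpha * / (alpha * eps)) by (field; lra). nra.
  - apply C_ext; simpl; ring.
Qed.

Lemma nint_gamma_exists a : 0 < Re a ->
  exists l, is_nint 0 p_infty (gamma_integrand a) l.
Proof.
  intros Ha. set (alpha := Re a) in *.
  destruct (INR_unbounded alpha) as [n Hn].
  (* (1 + t^alpha)^2 <= 4 (1 + t)^(2n) and (1 + t)^(2n) <= (2n)! e^(1 + t) *)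
  set (K := 4 * (INR (fact (2 * n)) * exp 1)).
  assert (KB : forall t, 0 < t -> exp (- t) * (1 + Rpower t alpha) ^ 2 <= K).
  { intros t Ht.
    assert (B : 1 + Rpower t alpha <= 2 * (1 + t) ^ n).
    { assert (B1 : Rpower t alpha <= (1 + t) ^ n).
      { apply Rle_trans with (Rpower (1 + t) alpha).
        - apply Rle_Rpower_l; lra.
        - apply Rpower_le_pow; lra. }
      pose proof (pow_R1_Rle (1 + t) n ltac:(lra)). lra. }
    pose proof (Rpower_pos t alpha).
    assert (B2 : (1 + Rpower t alpha) ^ 2 <= 4 * (1 + t) ^ (2 * n)).
    { replace (4 * (1 + t) ^ (2 * n)) with ((2 * (1 + t) ^ n) ^ 2).
      - apply pow_incr. lra.
      - rewrite Rpow_mult_distr, <- pow_mult, (Nat.mul_comm n 2). ring. }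
    pose proof (pow_le_exp (1 + t) (2 * n) ltac:(lra)) as B3.
    apply Rle_trans with (exp (- t) * (4 * (INR (fact (2 * n)) * exp (1 + t)))).
    - apply Rmult_le_compat_l; [left; apply exp_pos|]. lra.
    - unfold K. rewrite exp_plus.
      replace (exp (- t) * (4 * (INR (fact (2 * n)) * (exp 1 * exp t))))
        with (4 * (INR (fact (2 * n)) * exp 1) * (exp (- t) * exp t)) by ring.
      rewrite <- exp_plus. replace (- t + t) with 0 by ring. rewrite exp_0. lra. }
  apply (nint_exists 0 p_infty _
    (fun t => K * (Rpower t (alpha - 1) / (1 + Rpower t alpha) ^ 2)) (RtoC K * RtoC (/ alpha))%C I).
  - intros; apply ccontR_gamma_integrand; auto.
  - apply nint_ext with (f := fun t => (RtoC K * RtoC (Rpower t (alpha - 1) / (1 + Rpower t alpha) ^ 2))%C).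
    { intros. symmetry. apply RtoC_mult. }
    apply nint_scal; [exact I|]. apply nint_majorant, Ha.
  - intros t Ht _. unfold gamma_integrand.
    rewrite Cmod_mult, Cmod_Cpower_R, Cmod_R, Rabs_right by (auto; left; apply exp_pos).
    change (Re (a - 1)) with (alpha + - 1). fold (alpha - 1).
    specialize (KB t Ht). pose proof (Rpower_pos t alpha).
    assert (Q : 0 < (1 + Rpower t alpha) ^ 2) by (apply pow_lt; lra).
    replace (K * (Rpower t (alpha - 1) / (1 + Rpower t alpha) ^ 2))
      with (Rpower t (alpha - 1) * (K / (1 + Rpower t alpha) ^ 2)) by (field; lra).
    apply Rmult_le_compat_l; [left; apply Rpower_pos|].
    apply Rmult_le_reg_r with ((1 + Rpower t alpha) ^ 2); auto.
    unfold Rdiv. rewrite Rmult_assoc, Rinv_l by lra. lra.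
Qed.

Lemma nint_Gamma a : 0 < Re a -> is_nint 0 p_infty (gamma_integrand a) (CGamma a).
Proof.
  intros Ha. destruct (nint_gamma_exists a Ha) as [l Hl].
  replace (CGamma a) with l; [exact Hl|].
  unfold CGamma.
  assert (Z0 : Z.to_nat (up (- Re a)) = 0%nat).
  { destruct (archimed (- Re a)) as [_ A].
    assert (L : (up (- Re a) < 1)%Z) by (apply lt_IZR; lra). lia. }
  rewrite Z0. cbv zeta. simpl poch.
  replace (a + RtoC (INR 0))%C with a by (simpl; ring).
  unfold Gamma_integral. change (fun t : R => (Cpower (RtoC t) (a - 1) * RtoC (exp (- t)))%C)
    with (gamma_integrand a).
  rewrite (nint_RInt_gen (gamma_integrand a) l).
  - field.
  - intros; apply ccontR_gamma_integrand; auto.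
  - exact Hl.
Qed.

(** Integration by parts, in the form that t^a e^(-t) vanishes at both ends. *)
Lemma CGamma_succ a : 0 < Re a -> CGamma (a + 1) = (a * CGamma a)%C.
Proof.
  intros Ha.
  assert (Ha1 : 0 < Re (a + 1)) by (unfold Re in *; simpl; lra).
  pose proof (nint_minus 0 p_infty _ _ _ _ I (nint_scal 0 p_infty _ _ a I (nint_Gamma a Ha))
    (nint_Gamma (a + 1) Ha1)) as H.
  destruct (gamma_decay (fun t => Cpower (RtoC t) a * Cexp (- (1 * RtoC t)))%C 1 (Re a) 1 Ha ltac:(lra))
    as [L1 L2].
  { intros t Ht. rewrite Cmod_mult, Cmod_Cpower_R, Cmod_Cexp by auto.
    replace (Re (- (1 * RtoC t))) with (- (1 * t)) by (unfold Re; simpl; ring). lra. }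
  assert (H0 : is_nint 0 p_infty (fun t => a * gamma_integrand a t - gamma_integrand (a + 1) t)%C 0%C).
  { exists (fun t => Cpower (RtoC t) a * Cexp (- (1 * RtoC t)))%C, 0%C, 0%C.
    split; [|split; [|split]]; auto; [|ring].
    intros t Ht _. rewrite !gamma_integrand_exp.
    eapply cder_val; [apply cder_gamma_power, Ht|].
    replace (a + 1 - 1)%C with a by ring. ring. }
  pose proof (nint_unique 0 p_infty _ _ _ I H H0) as E.
  replace (CGamma (a + 1)) with (a * CGamma a - (a * CGamma a - CGamma (a + 1)))%C by ring.
  rewrite E. ring.
Qed.

Lemma CGamma_poch a n : 0 < Re a -> CGamma (a + RtoC (INR n)) = (poch a n * CGamma a)%C.
Proof.
  intros Ha. induction n as [|n IH].
  - simpl. replace (a + 0)%C with a by ring. ring.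
  - rewrite S_INR, RtoC_plus, Cplus_assoc, CGamma_succ, IH, poch_S; [ring|].
    unfold Re in *. simpl. pose proof (pos_INR n). lra.
Qed.

Lemma ccont_Cpower a z : off_cut z -> ccont (fun w => Cpower w a) z.
Proof.
  intros Hz. apply (ccont_comp Cexp (fun w => a * Clog w)%C); [apply ccont_Cexp|].
  apply ccont_mult; [apply ccont_const|apply ccont_Clog, Hz].
Qed.

(** Euler's integral along the ray through w: the primitive of z^(a-1) e^(-z) in the
    right half-plane takes nearly equal values at t and t w when t tends to an end. *)
Lemma nint_Gamma_ray a w : 0 < Re a -> 0 < Re w ->
  is_nint 0 p_infty (fun t => Cpower (RtoC t) (a - 1) * Cexp (- (w * RtoC t)))%C
    (CGamma a * Cpower w (- a))%C.
Proof.
  intros Ha Hw.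
  pose proof (off_cut_Re w Hw) as Ow.
  set (G := fun z => (Cpower z (a - 1) * Cexp (- z))%C).
  set (G' := fun z => ((a - 1) * Cpower z (a - 1 - 1) * Cexp (- z) - Cpower z (a - 1) * Cexp (- z))%C).
  destruct (star_primitive (fun z => 0 < Re z) 1%C G G') as [P HP].
  - intros z Hz. exists (Re z). split; auto. intros v Hv.
    pose proof (fst_le_Cmod (v - z)) as B. simpl in B. apply Rabs_le_between in B.
    unfold Re in *. lra.
  - intros z s Hz Hs. unfold Re in *. simpl. nra.
  - intros z Hz. pose proof (off_cut_Re z Hz) as Oz.
    assert (CE : ccont (fun z => Cexp (- z)) z).
    { apply (ccont_comp Cexp Copp); [apply ccont_Cexp|].
      apply ccont_clim. intros eps He. exists eps. split; auto. intros v Hv.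
      replace (- v - - z)%C with (- (v - z))%C by ring. rewrite Cmod_opp. exact Hv. }
    split; [|split].
    + eapply hol_val.
      * apply hol_mult; [apply hol_Cpower, Oz|].
        apply (hol_comp Cexp Copp); [apply hol_Cexp|].
        apply hol_ext with (G := fun v => ((-1) * v)%C); [intros; ring|].
        apply hol_scal, hol_id.
      * unfold G'. ring.
    + apply ccont_mult; [apply ccont_Cpower, Oz|exact CE].
    + apply ccont_minus; apply ccont_mult; auto; [|apply ccont_Cpower, Oz].
      apply ccont_mult; [apply ccont_const|apply ccont_Cpower, Oz].
  - assert (HP1 : forall t : R, 0 < t -> cder (fun s => P (RtoC s)) t (gamma_integrand a t)).
    { intros t Ht. pose proof (HP 0%C 1%C t) as D.
      assert (Hd : 0 < Re (0 + RtoC t * 1)) by (unfold Re; simpl; lra).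
      specialize (D Hd). eapply cder_val.
      - eapply cder_ext; [|exact D]. intros s. cbv beta. f_equal. ring.
      - rewrite gamma_integrand_exp. unfold G. replace (0 + RtoC t * 1)%C with (RtoC t) by ring.
        replace (1 * RtoC t)%C with (RtoC t) by ring. ring. }
    destruct (nint_antiderivative 0 p_infty _ _ (fun s => P (RtoC s)) I (nint_Gamma a Ha)
      (fun t Ht _ => HP1 t Ht)) as (la & lb & L1 & L2 & E).
    set (kappa := Rmin 1 (Re w)).
    assert (kp : 0 < kappa) by (apply Rmin_glb_lt; lra).
    assert (k1 : kappa <= 1) by apply Rmin_l.
    assert (k2 : kappa <= Re w) by apply Rmin_r.
    set (R0 := 1 + Cmod (w - 1)).
    set (B := exp (Rabs (Re (a - 1)) * (Rabs (ln kappa) + Rabs (ln R0)) + Rabs (Im (a - 1)) * PI)).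
    set (mu := fun u : R => (1 + RtoC u * (w - 1))%C).
    assert (Hmu : forall u, 0 <= u <= 1 -> kappa <= Re (mu u) /\ kappa <= Cmod (mu u) <= R0).
    { intros u Hu. assert (kappa <= Re (mu u)).
      { unfold mu, Re in *. simpl. nra. }
      split; auto. split.
      - eapply Rle_trans; [exact H|]. apply Re_le_Cmod'.
      - unfold mu, R0. eapply Rle_trans; [apply Cmod_triangle|]. rewrite Cmod_1.
        rewrite Cmod_mult, Cmod_R, Rabs_right by lra. pose proof (Cmod_ge_0 (w - 1)). nra. }
    destruct (gamma_decay (fun t => P (RtoC t * w) - P (RtoC t))%C (Cmod (w - 1) * B) (Re a) kappa Ha kp)
      as [M1 M2].
    { intros t Ht.
      set (q := (RtoC t * (w - 1))%C).
      assert (Eq : forall u, (RtoC t + RtoC u * q)%C = (RtoC t * mu u)%C)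
        by (intros; unfold q, mu; ring).
      set (Kt := Cmod (w - 1) * B * (Rpower t (Re a) * exp (- (kappa * t)))).
      pose proof (mean_value_bound (fun u => P (RtoC t + RtoC u * q)%C)
        (fun u => q * G (RtoC t + RtoC u * q))%C Kt) as MV.
      cbv beta in MV.
      replace (RtoC t + RtoC 1 * q)%C with (RtoC t * w)%C in MV by (unfold q; ring).
      replace (RtoC t + RtoC 0 * q)%C with (RtoC t) in MV by ring.
      assert (Pos : forall u, 0 <= u <= 1 -> 0 < Re (RtoC t * mu u)).
      { intros u Hu. destruct (Hmu u Hu) as [A _].
        replace (Re (RtoC t * mu u)) with (t * Re (mu u)) by (unfold Re; simpl; ring).
        apply Rmult_lt_0_compat; lra. }
      apply MV.
      - intros u Hu. apply HP. rewrite Eq. apply Pos, Hu.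
      - intros u Hu. rewrite Eq. unfold G, q.
        destruct (Hmu u Hu) as [A1 A2].
        assert (Omu : off_cut (mu u)) by (apply off_cut_Re; lra).
        rewrite !Cmod_mult, Cmod_R, Rabs_right by lra.
        rewrite Cpower_scale, Cmod_mult, Cmod_Cpower_R, Cmod_Cexp by auto.
        pose proof (Cmod_Cpower_le (mu u) (a - 1) kappa R0 Omu kp A2) as Bd. fold B in Bd.
        unfold Kt.
        replace (Rpower t (Re a)) with (t * Rpower t (Re (a - 1))).
        2:{ replace (Re a) with (1 + Re (a - 1)) by (unfold Re; simpl; ring).
            rewrite Rpower_plus, Rpower_1 by auto. reflexivity. }
        assert (Ex : exp (Re (- (RtoC t * mu u))) <= exp (- (kappa * t))).
        { apply exp_le.
          replace (Re (- (RtoC t * mu u))) with (- (t * Re (mu u))) by (unfold Re; simpl; ring). nra. }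
        pose proof (Cmod_ge_0 (w - 1)). pose proof (Rpower_pos t (Re (a - 1))).
        pose proof (Cmod_ge_0 (Cpower (mu u) (a - 1))).
        pose proof (exp_pos (Re (- (RtoC t * mu u)))).
        replace (t * Cmod (w - 1) * (Rpower t (Re (a - 1)) * Cmod (Cpower (mu u) (a - 1)) * exp (Re (- (RtoC t * mu u)))))
          with (t * Cmod (w - 1) * Rpower t (Re (a - 1)) *
             (Cmod (Cpower (mu u) (a - 1)) * exp (Re (- (RtoC t * mu u))))) by ring.
        replace (Cmod (w - 1) * B * (t * Rpower t (Re (a - 1)) * exp (- (kappa * t))))
          with (t * Cmod (w - 1) * Rpower t (Re (a - 1)) * (B * exp (- (kappa * t)))) by ring.
        apply Rmult_le_compat_l.
        + repeat apply Rmult_le_pos; lra.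
        + apply Rmult_le_compat; lra. }
    assert (Main : is_nint 0 p_infty (fun t => w * G (RtoC t * w))%C (CGamma a)).
    { exists (fun t => P (RtoC t * w)%C), la, lb. split; [|split; [|split]]; auto.
      - intros t Ht _. pose proof (HP 0%C w t) as D.
        assert (Hd : 0 < Re (0 + RtoC t * w)) by (unfold Re in *; simpl; nra).
        specialize (D Hd). eapply cder_val.
        + eapply cder_ext; [|exact D]. intros s. cbv beta. f_equal. ring.
        + replace (0 + RtoC t * w)%C with (RtoC t * w)%C by ring. reflexivity.
      - eapply clim_close; [typeclasses eauto|exact M1|exact L1].
      - eapply clim_close; [apply (Rbar_locally_filter p_infty)|exact M2|exact L2]. }
    eapply nint_val.
    + eapply nint_ext; [|apply (nint_scal 0 p_infty _ _ (Cpower w (- a)) I Main)].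
      intros t Ht _. unfold G. rewrite Cpower_scale by auto.
      rewrite (Cpower_minus_1 w) by (apply off_cut_neq_0; auto).
      rewrite Cpower_opp. replace (RtoC t * w)%C with (w * RtoC t)%C by ring.
      field. split; [apply off_cut_neq_0; auto|apply Cpower_neq_0].
    + ring.
Qed.

Definition GammaR (alpha : R) : R := fst (CGamma (RtoC alpha)).

Lemma nint_GammaR alpha kappa : 0 < alpha -> 0 < kappa ->
  is_nint 0 p_infty (fun t => RtoC (Rpower t (alpha - 1) * exp (- (kappa * t))))
    (RtoC (GammaR alpha * Rpower kappa (- alpha))).
Proof.
  intros Ha Hk.
  assert (E : CGamma (RtoC alpha) = RtoC (GammaR alpha)).
  { apply (nint_real 0 p_infty (fun t => Rpower t (alpha - 1) * exp (- t))); [exact I|].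
    eapply nint_ext; [|apply nint_Gamma; exact Ha].
    intros t Ht _. unfold gamma_integrand. rewrite <- RtoC_minus, Cpower_R by auto.
    symmetry. apply RtoC_mult. }
  eapply nint_val.
  - eapply nint_ext; [|apply (nint_Gamma_ray (RtoC alpha) (RtoC kappa)); auto].
    intros t Ht _. rewrite <- RtoC_minus, Cpower_R, <- RtoC_mult, <- RtoC_opp, Cexp_R by auto.
    symmetry. apply RtoC_mult.
  - rewrite E, <- RtoC_opp, Cpower_R by auto. symmetry. apply RtoC_mult.
Qed.

Lemma GammaR_pos alpha : 0 < alpha -> 0 < GammaR alpha.
Proof.
  intros Ha.
  pose proof (nint_GammaR alpha 1 Ha ltac:(lra)) as H.
  destruct H as (F & la & lb & H & H1 & H2 & E).
  assert (P1 : Rpower 1 (- alpha) = 1).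
  { unfold Rpower. rewrite ln_1, Rmult_0_r, exp_0. reflexivity. }
  rewrite P1, Rmult_1_r in E. apply (f_equal fst) in E. simpl in E. rewrite E.
  set (f := fun t => Rpower t (alpha - 1) * exp (- (1 * t))) in *.
  assert (fp : forall t, 0 < f t) by (intros; apply Rmult_lt_0_compat; [apply Rpower_pos|apply exp_pos]).
  assert (Inc : forall x y, 0 < x -> x <= y -> fst (F x) <= fst (F y)).
  { intros x y Hx Hxy. apply (is_derive_le (fun t => fst (F t)) f); auto.
    - intros t Ht. apply (proj1 (H t ltac:(lra) I)).
    - intros. left; apply fp. }
  assert (Str : fst (F 1) < fst (F 2)).
  { destruct (MVT_gen (fun t => fst (F t)) 1 2 f) as [c [Hc Ec]].
    - intros t Ht. rewrite Rmin_left in Ht by lra. apply (proj1 (H t ltac:(lra) I)).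
    - intros t Ht. rewrite Rmin_left in Ht by lra. apply derivable_continuous_pt.
      exists (f t). apply is_derive_Reals, (proj1 (H t ltac:(lra) I)).
    - pose proof (fp c). nra. }
  assert (A : Rbar_le (fst la) (fst (F 1))).
  { apply (filterlim_le (F := at_right 0) (fun t => fst (F t)) (fun _ => fst (F 1))).
    - generalize (at_right_0_lt 1 ltac:(lra)). apply filter_imp. intros t Ht. apply Inc; lra.
    - apply filterlim_Re; auto. typeclasses eauto.
    - apply filterlim_const. }
  assert (B : Rbar_le (fst (F 2)) (fst lb)).
  { apply (filterlim_le (F := Rbar_locally p_infty) (fun _ => fst (F 2)) (fun t => fst (F t))).
    - exists 2. intros t Ht. apply Inc; lra.
    - apply filterlim_const.
    - apply (filterlim_Re (rend p_infty)); auto. }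
  simpl in A, B. lra.
Qed.

(** * Beta integrals *)

Definition nint (p : R) (q : Rbar) (f : R -> C) : C :=
  epsilon (inhabits (RtoC 0)) (is_nint p q f).

Lemma nint_correct p q f l : is_nint p q f l -> is_nint p q f (nint p q f).
Proof. intros H. exact (epsilon_spec (inhabits (RtoC 0)) (is_nint p q f) (ex_intro _ l H)). Qed.

Lemma nint_eq (p : R) q f l : Rbar_lt p q -> is_nint p q f l -> nint p q f = l.
Proof. intros Hpq H. apply (nint_unique p q f); auto. eapply nint_correct; eauto. Qed.

Lemma at_left_1_lt e : 0 < e -> e <= 1 -> at_left 1 (fun t => 0 < 1 - t < e).
Proof.
  intros He He1. exists (mkposreal _ He). intros y B Hy.
  change (Rabs (y - 1) < e) in B. apply Rabs_def2 in B. lra.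
Qed.

Lemma is_derive_one_minus t : is_derive (fun s => 1 - s) t (-1).
Proof.
  eapply is_derive_val.
  - apply (is_derive_minus (K := R_AbsRing) (V := R_NormedModule) (fun _ => 1) (fun t => t)).
    + apply (is_derive_const (K := R_AbsRing) (V := R_NormedModule)).
    + apply (is_derive_id (K := R_AbsRing)).
  - unfold minus, plus, opp, zero, one; simpl. ring.
Qed.

Lemma nint_reflect f l : is_nint 0 1 f l -> is_nint 0 1 (fun t => f (1 - t)) l.
Proof.
  intros (F & la & lb & H & H1 & H2 & ->).
  exists (fun t => (-1) * F (1 - t)%R)%C, ((-1) * lb)%C, ((-1) * la)%C.
  split; [|split; [|split]].
  - intros t A B. simpl in B. eapply cder_val.
    + apply cder_scal. apply (cder_comp F (fun t => 1 - t) t (f (1 - t)) (-1)).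
      * apply H; simpl; lra.
      * apply is_derive_one_minus.
    + apply C_ext; simpl; ring.
  - apply clim_scal; [typeclasses eauto|]. intros eps He.
    destruct (H2 eps He) as [d Hd]. exists d. intros y B Hy. apply Hd.
    + change (Rabs (1 - y - 1) < d). change (Rabs (y - 0) < d) in B.
      replace (1 - y - 1) with (- (y - 0)) by ring. rewrite Rabs_Ropp. exact B.
    + lra.
  - apply (clim_scal (at_left 1)). intros eps He.
    destruct (H1 eps He) as [d Hd]. exists d. intros y B Hy. apply Hd.
    + change (Rabs (1 - y - 0) < d). change (Rabs (y - 1) < d) in B.
      replace (1 - y - 0) with (- (y - 1)) by ring. rewrite Rabs_Ropp. exact B.
    + lra.
  - ring.
Qed.

Lemma clim_0_Rpower {T} Ft {FF : Filter Ft} (F : T -> C) (u : T -> R) alpha : 0 < alpha ->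
  (forall e, 0 < e -> Ft (fun x => 0 < u x < e)) ->
  Ft (fun x => Cmod (F x) <= Rpower (u x) alpha) -> clim Ft F 0%C.
Proof.
  intros Ha Hu HF eps He.
  generalize (filter_and _ _ HF (Hu _ (exp_pos (/ alpha * ln eps)))).
  apply filter_imp. intros x [A B].
  replace (F x - 0)%C with (F x) by ring.
  eapply Rle_lt_trans; [exact A|]. apply Rpower_small; auto.
Qed.

Lemma at_left_1_any e : 0 < e -> at_left 1 (fun t => 0 < 1 - t < e).
Proof.
  intros He. generalize (at_left_1_lt (Rmin e 1) (Rmin_glb_lt _ _ _ He Rlt_0_1) (Rmin_r _ _)).
  apply filter_imp. intros t Ht. pose proof (Rmin_l e 1). lra.
Qed.

Lemma lt_0_1 : Rbar_lt 0 1.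
Proof. simpl; lra. Qed.

Lemma nint_power a : 0 < Re a ->
  is_nint 0 1 (fun t => Cpower (RtoC t) (a - 1)) (/ a)%C.
Proof.
  intros Ha. assert (Na : a <> 0%C) by (intros ->; simpl in Ha; lra).
  assert (D : forall t, 0 < t -> cder (fun s => / a * Cpower (RtoC s) a)%C t (Cpower (RtoC t) (a - 1))).
  { intros t Ht. eapply cder_val; [apply cder_scal, cder_Cpower_R, Ht|]. field; auto. }
  exists (fun s => / a * Cpower (RtoC s) a)%C, (/ a * 0)%C, (/ a * Cpower (RtoC 1) a)%C.
  split; [|split; [|split]].
  - intros; apply D; auto.
  - apply clim_scal; [typeclasses eauto|].
    apply (clim_0_Rpower _ _ (fun t => t) (Re a) Ha); [apply at_right_0_lt|].
    generalize (at_right_0_lt 1 ltac:(lra)). apply filter_imp. intros t Ht.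
    rewrite Cmod_Cpower_R by lra. lra.
  - intros eps He. apply filter_le_within. apply (cder_cont _ _ _ _ (D 1 ltac:(lra)) He).
  - rewrite Cpower_one. ring.
Qed.

Definition beta_weight (a d : C) (t : R) : C :=
  (Cpower (RtoC t) (a - 1) * Cpower (RtoC (1 - t)) (d - 1))%C.

Lemma cder_beta_power a d t : 0 < t < 1 ->
  cder (fun s => Cpower (RtoC s) a * Cpower (RtoC (1 - s)) d)%C t
    (a * beta_weight a (d + 1) t - d * beta_weight (a + 1) d t)%C.
Proof.
  intros Ht. eapply cder_val.
  - apply cder_mult; [apply cder_Cpower_R; lra|].
    apply (cder_comp (fun s => Cpower (RtoC s) d) (fun s => 1 - s) t).
    + apply cder_Cpower_R; lra.
    + apply is_derive_one_minus.
  - unfold beta_weight. replace (d + 1 - 1)%C with d by ring. replace (a + 1 - 1)%C with a by ring.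
    replace (RtoC (-1)) with (- (1))%C by (apply C_ext; simpl; ring). ring.
Qed.

Lemma ccontR_beta_weight a d t : 0 < t < 1 -> ccontR (beta_weight a d) t.
Proof. intros Ht. eapply cder_ccontR. apply cder_beta_power, Ht. Qed.

Lemma ccontR_mult f g t : ccontR f t -> ccontR g t -> ccontR (fun s => f s * g s)%C t.
Proof.
  intros [A B] [A' B']. split; simpl.
  - apply (continuous_minus (V := R_NormedModule));
      apply (continuous_mult (K := R_AbsRing)); auto.
  - apply (continuous_plus (V := R_NormedModule));
      apply (continuous_mult (K := R_AbsRing)); auto.
Qed.

Definition beta_weightR (alpha beta t : R) : R :=
  Rpower t (alpha - 1) * Rpower (1 - t) (beta - 1).

Lemma Cmod_beta_weight a d t : 0 < t < 1 ->
  Cmod (beta_weight a d t) = beta_weightR (Re a) (Re d) t.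
Proof.
  intros Ht. unfold beta_weight. rewrite Cmod_mult, !Cmod_Cpower_R by lra. reflexivity.
Qed.

Lemma beta_weight_R alpha beta t : 0 < t < 1 ->
  beta_weight (RtoC alpha) (RtoC beta) t = RtoC (beta_weightR alpha beta t).
Proof.
  intros Ht. unfold beta_weight. rewrite <- !RtoC_minus, !Cpower_R by lra.
  rewrite <- RtoC_mult. reflexivity.
Qed.

Lemma Rpower_half u e : 1 / 2 <= u < 1 -> Rpower u e <= 1 + Rpower (1 / 2) e.
Proof.
  intros Hu. pose proof (Rpower_pos (1 / 2) e).
  destruct (Rle_dec 0 e).
  - assert (Rpower u e <= Rpower 1 e) by (apply Rle_Rpower_l; lra).
    replace (Rpower 1 e) with 1 in *; [lra|].
    unfold Rpower. rewrite ln_1, Rmult_0_r, exp_0. reflexivity.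
  - assert (Rpower u e <= Rpower (1 / 2) e); [|lra].
    unfold Rpower. apply exp_le.
    assert (ln (1 / 2) <= ln u) by (apply ln_le; lra). nra.
Qed.

Lemma beta_weightR_le alpha beta t : 0 < t < 1 ->
  beta_weightR alpha beta t <=
  (1 + Rpower (1 / 2) (beta - 1)) * Rpower t (alpha - 1)
  + (1 + Rpower (1 / 2) (alpha - 1)) * Rpower (1 - t) (beta - 1).
Proof.
  intros Ht. unfold beta_weightR.
  pose proof (Rpower_pos (1 / 2) (alpha - 1)). pose proof (Rpower_pos (1 / 2) (beta - 1)).
  pose proof (Rpower_pos t (alpha - 1)). pose proof (Rpower_pos (1 - t) (beta - 1)).
  destruct (Rle_dec t (1 / 2)).
  - pose proof (Rpower_half (1 - t) (beta - 1) ltac:(lra)). nra.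
  - pose proof (Rpower_half t (alpha - 1) ltac:(lra)). nra.
Qed.

Lemma nint_beta_weightR_exists alpha beta : 0 < alpha -> 0 < beta ->
  exists l, is_nint 0 1 (fun t => RtoC (beta_weightR alpha beta t)) l.
Proof.
  intros Ha Hb.
  set (A := 1 + Rpower (1 / 2) (beta - 1)). set (B := 1 + Rpower (1 / 2) (alpha - 1)).
  pose proof (nint_power (RtoC alpha) Ha) as I1.
  pose proof (nint_reflect _ _ (nint_power (RtoC beta) Hb)) as I2.
  pose proof (nint_plus 0 1 _ _ _ _ lt_0_1 (nint_scal 0 1 _ _ (RtoC A) lt_0_1 I1)
                (nint_scal 0 1 _ _ (RtoC B) lt_0_1 I2)) as I3.
  refine (nint_exists 0 1 _ (fun t => A * Rpower t (alpha - 1) + B * Rpower (1 - t) (beta - 1)) _ lt_0_1 _ _ _).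
  - intros t Ht1 Ht2. simpl in Ht2.
    pose proof (ccontR_beta_weight (RtoC alpha) (RtoC beta) t ltac:(lra)) as [C1 C2].
    assert (L : locally t (fun s => 0 < s < 1)).
    { apply filter_and; [apply (open_gt 0); lra|apply (open_lt 1); lra]. }
    split; simpl.
    + eapply continuous_ext_loc; [|exact C1]. revert L. apply filter_imp. intros s Hs.
      rewrite beta_weight_R by lra. reflexivity.
    + eapply continuous_ext_loc; [|exact C2]. revert L. apply filter_imp. intros s Hs.
      rewrite beta_weight_R by lra. reflexivity.
  - eapply nint_ext; [|exact I3]. intros t Ht1 Ht2. simpl in Ht2. cbv beta.
    rewrite <- !RtoC_minus, !Cpower_R, <- !RtoC_mult, <- RtoC_plus by lra. reflexivity.
  - intros t Ht1 Ht2. simpl in Ht2. rewrite Cmod_R, Rabs_right.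
    + apply beta_weightR_le. lra.
    + left. apply Rmult_lt_0_compat; apply Rpower_pos.
Qed.

Definition BetaR (alpha beta : R) : R := fst (nint 0 1 (fun t => RtoC (beta_weightR alpha beta t))).

Lemma nint_BetaR alpha beta : 0 < alpha -> 0 < beta ->
  is_nint 0 1 (fun t => RtoC (beta_weightR alpha beta t)) (RtoC (BetaR alpha beta)).
Proof.
  intros Ha Hb. destruct (nint_beta_weightR_exists alpha beta Ha Hb) as [l Hl].
  pose proof (nint_correct _ _ _ _ Hl) as H.
  unfold BetaR. rewrite <- (nint_real 0 1 _ _ lt_0_1 H). exact H.
Qed.

Lemma nint_beta_exists a d f M : 0 < Re a -> 0 < Re d ->
  (forall t, 0 < t < 1 -> ccontR f t) -> (forall t, 0 < t < 1 -> Cmod (f t) <= M) ->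
  is_nint 0 1 (fun t => beta_weight a d t * f t)%C (nint 0 1 (fun t => beta_weight a d t * f t)%C).
Proof.
  intros Ha Hd Hf HM.
  assert (exists l, is_nint 0 1 (fun t => beta_weight a d t * f t)%C l) as [l Hl].
  { refine (nint_exists 0 1 _ (fun t => M * beta_weightR (Re a) (Re d) t) (RtoC M * RtoC (BetaR (Re a) (Re d)))%C lt_0_1 _ _ _).
    - intros t H1 H2. simpl in H2. apply ccontR_mult; [apply ccontR_beta_weight|apply Hf]; lra.
    - eapply nint_ext; [|apply nint_scal; [apply lt_0_1|apply nint_BetaR; auto]].
      intros; symmetry; apply RtoC_mult.
    - intros t H1 H2. simpl in H2. rewrite Cmod_mult, Cmod_beta_weight, Rmult_comm by lra.
      apply Rmult_le_compat_r; [|apply HM; lra].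
      rewrite <- (Cmod_beta_weight a d) by lra. apply Cmod_ge_0. }
  eapply nint_correct; eauto.
Qed.

Lemma nint_beta_bound a d f M l : 0 < Re a -> 0 < Re d ->
  (forall t, 0 < t < 1 -> Cmod (f t) <= M) ->
  is_nint 0 1 (fun t => beta_weight a d t * f t)%C l ->
  Cmod l <= M * BetaR (Re a) (Re d).
Proof.
  intros Ha Hd HM Hl.
  apply (nint_bound 0 1 _ _ (fun t => M * beta_weightR (Re a) (Re d) t) _ lt_0_1 Hl).
  - rewrite RtoC_mult. eapply nint_ext; [|apply nint_scal; [apply lt_0_1|apply nint_BetaR; auto]].
    intros; symmetry; apply RtoC_mult.
  - intros t H1 H2. simpl in H2. rewrite Cmod_mult, Cmod_beta_weight, Rmult_comm by lra.
    apply Rmult_le_compat_r; [|apply HM; lra].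
    rewrite <- (Cmod_beta_weight a d) by lra. apply Cmod_ge_0.
Qed.

Definition Beta (a d : C) : C := nint 0 1 (beta_weight a d).

Lemma nint_Beta a d : 0 < Re a -> 0 < Re d -> is_nint 0 1 (beta_weight a d) (Beta a d).
Proof.
  intros Ha Hd.
  assert (E : forall t, (beta_weight a d t * 1)%C = beta_weight a d t) by (intros; ring).
  apply (nint_correct _ _ _ (nint 0 1 (fun t => beta_weight a d t * 1)%C)).
  eapply nint_ext; [intros; apply E|].
  apply (nint_beta_exists a d (fun _ => 1%C) 1); auto.
  - intros t _. apply (cder_ccontR _ _ _ (cder_const 1%C t)).
  - intros t _. rewrite Cmod_1. lra.
Qed.

Lemma beta_power_limits a d : 0 < Re a -> 0 < Re d ->
  clim (at_right 0) (fun s => Cpower (RtoC s) a * Cpower (RtoC (1 - s)) d)%C 0%C /\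
  clim (at_left 1) (fun s => Cpower (RtoC s) a * Cpower (RtoC (1 - s)) d)%C 0%C.
Proof.
  intros Ha Hd.
  assert (One : forall u e, 0 < u < 1 -> 0 < e -> Rpower u e <= 1).
  { intros u e Hu He. replace 1 with (Rpower 1 e).
    - apply Rle_Rpower_l; lra.
    - unfold Rpower. rewrite ln_1, Rmult_0_r, exp_0. reflexivity. }
  split.
  - apply (clim_0_Rpower _ _ (fun t => t) (Re a) Ha); [apply at_right_0_lt|].
    generalize (at_right_0_lt 1 ltac:(lra)). apply filter_imp. intros t Ht.
    rewrite Cmod_mult, !Cmod_Cpower_R by lra.
    pose proof (One (1 - t) (Re d) ltac:(lra) Hd). pose proof (Rpower_pos t (Re a)). nra.
  - apply (clim_0_Rpower _ _ (fun t => 1 - t) (Re d) Hd); [apply at_left_1_any|].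
    generalize (at_left_1_lt 1 ltac:(lra) ltac:(lra)). apply filter_imp. intros t Ht.
    rewrite Cmod_mult, !Cmod_Cpower_R by lra.
    pose proof (One t (Re a) ltac:(lra) Ha). pose proof (Rpower_pos (1 - t) (Re d)). nra.
Qed.

(** The first relation integrates the derivative of t^a (1-t)^d, which vanishes at
    both ends; the second one inserts 1 = t + (1 - t). *)
Lemma Beta_recurrences a d : 0 < Re a -> 0 < Re d ->
  (a * Beta a (d + 1))%C = (d * Beta (a + 1) d)%C /\
  Beta a d = (Beta (a + 1) d + Beta a (d + 1))%C.
Proof.
  intros Ha Hd.
  assert (Ha1 : 0 < Re (a + 1)) by (unfold Re in *; simpl; lra).
  assert (Hd1 : 0 < Re (d + 1)) by (unfold Re in *; simpl; lra).
  pose proof (nint_Beta a d Ha Hd) as I0.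
  pose proof (nint_Beta (a + 1) d Ha1 Hd) as I1.
  pose proof (nint_Beta a (d + 1) Ha Hd1) as I2.
  split.
  - pose proof (nint_minus 0 1 _ _ _ _ lt_0_1 (nint_scal 0 1 _ _ a lt_0_1 I2)
      (nint_scal 0 1 _ _ d lt_0_1 I1)) as I3.
    destruct (beta_power_limits a d Ha Hd) as [L1 L2].
    assert (I4 : is_nint 0 1 (fun t => a * beta_weight a (d + 1) t - d * beta_weight (a + 1) d t)%C 0%C).
    { exists (fun s => Cpower (RtoC s) a * Cpower (RtoC (1 - s)) d)%C, 0%C, 0%C.
      split; [|split; [|split]]; auto; [|ring].
      intros t H1 H2. simpl in H2. apply cder_beta_power; lra. }
    pose proof (nint_unique 0 1 _ _ _ lt_0_1 I3 I4) as E.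
    replace (a * Beta a (d + 1))%C with
      ((a * Beta a (d + 1) - d * Beta (a + 1) d) + d * Beta (a + 1) d)%C by ring.
    rewrite E. ring.
  - apply (nint_unique 0 1 _ _ _ lt_0_1 I0).
    eapply nint_ext; [|apply (nint_plus 0 1 _ _ _ _ lt_0_1 I1 I2)].
    intros t H1 H2. simpl in H2. unfold beta_weight.
    replace (a + 1 - 1)%C with (a - 1 + 1)%C by ring.
    replace (d + 1 - 1)%C with (d - 1 + 1)%C by ring.
    rewrite (Cpower_plus _ (a - 1)), (Cpower_plus _ (d - 1)).
    rewrite !Cpower_1 by (apply RtoC_neq_0; lra). rewrite RtoC_minus. ring.
Qed.

Lemma Beta_succ_l a d : 0 < Re a -> 0 < Re d ->
  ((a + d) * Beta (a + 1) d)%C = (a * Beta a d)%C.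
Proof.
  intros Ha Hd. destruct (Beta_recurrences a d Ha Hd) as [E1 E2].
  rewrite E2, Cmult_plus_distr_l, E1. ring.
Qed.

Lemma Beta_succ_r a d : 0 < Re a -> 0 < Re d ->
  ((a + d) * Beta a (d + 1))%C = (d * Beta a d)%C.
Proof.
  intros Ha Hd. destruct (Beta_recurrences a d Ha Hd) as [E1 E2].
  rewrite E2, Cmult_plus_distr_l, <- E1. ring.
Qed.

Lemma Re_plus_nat a n : 0 < Re a -> 0 < Re (a + RtoC (INR n)).
Proof. intros H. unfold Re in *. simpl. pose proof (pos_INR n). lra. Qed.

Lemma Beta_poch_l a d n : 0 < Re a -> 0 < Re d ->
  (poch (a + d) n * Beta (a + RtoC (INR n)) d)%C = (poch a n * Beta a d)%C.
Proof.
  intros Ha Hd. induction n as [|n IH].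
  - simpl. replace (a + 0)%C with a by ring. reflexivity.
  - rewrite !poch_S.
    transitivity (poch (a + d) n * ((a + RtoC (INR n) + d) * Beta (a + RtoC (INR n) + 1) d))%C.
    { rewrite S_INR, RtoC_plus, Cplus_assoc. ring. }
    rewrite Beta_succ_l by (auto using Re_plus_nat).
    transitivity ((a + RtoC (INR n)) * (poch (a + d) n * Beta (a + RtoC (INR n)) d))%C; [ring|].
    rewrite IH. ring.
Qed.

Lemma Beta_poch_r a d n : 0 < Re a -> 0 < Re d ->
  (poch (a + d) n * Beta a (d + RtoC (INR n)))%C = (poch d n * Beta a d)%C.
Proof.
  intros Ha Hd. induction n as [|n IH].
  - simpl. replace (d + 0)%C with d by ring. reflexivity.
  - rewrite !poch_S.
    transitivity (poch (a + d) n * ((a + (d + RtoC (INR n))) * Beta a (d + RtoC (INR n) + 1)))%C.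
    { rewrite S_INR, RtoC_plus, Cplus_assoc. ring. }
    rewrite Beta_succ_r by (auto using Re_plus_nat).
    transitivity ((d + RtoC (INR n)) * (poch (a + d) n * Beta a (d + RtoC (INR n))))%C; [ring|].
    rewrite IH. ring.
Qed.

Lemma Beta_1_r a : 0 < Re a -> Beta a 1 = (/ a)%C.
Proof.
  intros Ha. apply nint_eq; [apply lt_0_1|].
  eapply nint_ext; [|apply nint_power, Ha].
  intros t H1 H2. simpl in H2. unfold beta_weight.
  replace (1 - 1)%C with (RtoC 0) by ring. rewrite Cpower_0. ring.
Qed.

Lemma nint_nonneg (p : R) q g l : Rbar_lt p q -> is_nint p q (fun t => RtoC (g t)) (RtoC l) ->
  (forall t, p < t -> Rbar_lt t q -> 0 <= g t) -> 0 <= l.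
Proof.
  intros Hpq H Hg. rewrite <- Cmod_0.
  apply (nint_bound p q (fun _ => 0%C) 0%C g l); auto.
  - apply nint_zero, Hpq.
  - intros. rewrite Cmod_0. auto.
Qed.

(** Compares integrals over one of the two parts of the half-line with a Gamma
    integral over all of it. *)
Lemma nint_bound_sub f l g lg : is_nint 0 p_infty (fun t => RtoC (g t)) (RtoC lg) ->
  (forall t, 0 < t -> 0 <= g t) ->
  (is_nint 0 1 f l -> (forall t, 0 < t < 1 -> Cmod (f t) <= g t) -> Cmod l <= lg) /\
  (is_nint 1 p_infty f l -> (forall t, 1 < t -> Cmod (f t) <= g t) -> Cmod l <= lg).
Proof.
  intros Hg Pos.
  destruct (nint_restrict_l 0 1 p_infty _ _ ltac:(lra) I Hg) as [l1 H1].
  destruct (nint_restrict_r 0 1 p_infty _ _ ltac:(lra) I Hg) as [l2 H2].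
  pose proof (nint_split 0 1 p_infty _ _ _ _ ltac:(lra) I Hg H1 H2) as E.
  pose proof (nint_real 0 1 _ _ lt_0_1 H1) as E1.
  pose proof (nint_real 1 p_infty _ _ I H2) as E2.
  rewrite E1 in H1. rewrite E2 in H2. apply (f_equal fst) in E. simpl in E.
  assert (P1 : 0 <= fst l1) by (apply (nint_nonneg 0 1 _ _ lt_0_1 H1); intros; apply Pos; auto).
  assert (P2 : 0 <= fst l2).
  { apply (nint_nonneg 1 p_infty _ _ I H2); intros t Ht _; apply Pos; lra. }
  split; intros Hf B.
  - apply Rle_trans with (fst l1); [|lra].
    apply (nint_bound 0 1 _ _ _ _ lt_0_1 Hf H1). intros t A A'. apply B. simpl in A'. lra.
  - apply Rle_trans with (fst l2); [|lra].
    apply (nint_bound 1 p_infty _ _ _ _ I Hf H2). intros t A _. apply B. lra.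
Qed.

Lemma Bernoulli_ge u n : 0 <= u <= 1 -> 1 - INR n * u <= (1 - u) ^ n.
Proof.
  intros Hu. induction n as [|n IH]; [simpl; lra|].
  rewrite S_INR. simpl. pose proof (pos_INR n).
  destruct (Rle_dec 0 (1 - INR n * u)).
  - apply Rle_trans with ((1 - u) * (1 - INR n * u)); [nra|]. apply Rmult_le_compat_l; lra.
  - pose proof (pow_le (1 - u) n ltac:(lra)).
    assert (0 <= (1 - u) * (1 - u) ^ n) by (apply Rmult_le_pos; lra). nra.
Qed.

Lemma exp_pow t n : exp (- (INR n * t)) = exp (- t) ^ n.
Proof.
  induction n as [|n IH].
  - simpl. rewrite Rmult_0_l, Ropp_0, exp_0. reflexivity.
  - rewrite S_INR. simpl. rewrite <- IH, <- exp_plus. f_equal. ring.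
Qed.

Lemma one_minus_le_exp t : 1 - t <= exp (- t).
Proof. pose proof (exp_ineq1_le (- t)). lra. Qed.

(** The upper bound is Bernoulli's inequality for (1 - t^2)^n together with
    1 - t^2 <= (1 - t) e^t. *)
Lemma exp_minus_pow t n : 0 < t < 1 ->
  0 <= exp (- (INR n * t)) - (1 - t) ^ n <= INR n * t ^ 2 * exp (- (INR n * t)).
Proof.
  intros Ht. rewrite exp_pow. split.
  - assert ((1 - t) ^ n <= exp (- t) ^ n); [|lra].
    apply pow_incr. split; [lra|apply one_minus_le_exp].
  - assert (B : (1 - INR n * t ^ 2) * exp (- t) ^ n <= (1 - t) ^ n); [|lra].
    assert (B1 : 1 - INR n * t ^ 2 <= (1 - t ^ 2) ^ n) by (apply Bernoulli_ge; nra).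
    assert (B2 : ((1 - t ^ 2) * exp (- t)) ^ n <= (1 - t) ^ n).
    { apply pow_incr. pose proof (exp_pos (- t)). split; [apply Rmult_le_pos; nra|].
      pose proof (one_minus_le_exp (- t)) as K. rewrite Ropp_involutive in K.
      assert (E : exp t * exp (- t) = 1).
      { rewrite <- exp_plus. replace (t + - t) with 0 by ring. apply exp_0. }
      assert ((1 + t) * exp (- t) <= 1).
      { rewrite <- E. apply Rmult_le_compat_r; lra. }
      replace ((1 - t ^ 2) * exp (- t)) with ((1 - t) * ((1 + t) * exp (- t))) by ring. nra. }
    rewrite Rpow_mult_distr in B2.
    assert (0 <= exp (- t) ^ n) by (apply pow_le; left; apply exp_pos). nra.
Qed.

(** Comparison of (1 - t)^n with e^(-nt) turns the Beta integral with a large second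
    argument into the Gamma integral. *)
Lemma Beta_large a e K : 0 < Re a -> 0 < Re (e + 1) ->
  (forall t, 0 < t < 1 -> Cmod (Cpower (RtoC (1 - t)) e - 1) <= K * t) ->
  clim eventually
    (fun n => Cpower (RtoC (INR n)) a * Beta a (e + 1 + RtoC (INR n)))%C (CGamma a).
Proof.
  intros Ha He HK. set (alpha := Re a) in *.
  assert (K0 : 0 <= K).
  { specialize (HK (1 / 2) ltac:(lra)). pose proof (Cmod_ge_0 (Cpower (RtoC (1 - 1 / 2)) e - 1)). lra. }
  set (K1 := (K + 1) * GammaR (alpha + 1) + GammaR (alpha + 2)).
  assert (G1 : 0 < GammaR (alpha + 1)) by (apply GammaR_pos; lra).
  assert (G2 : 0 < GammaR (alpha + 2)) by (apply GammaR_pos; lra).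
  assert (Main : forall n, (1 <= n)%nat ->
     Cmod (Cpower (RtoC (INR n)) a * Beta a (e + 1 + RtoC (INR n)) - CGamma a)
     <= K1 / INR n).
  { intros n Hn. assert (Pn : 0 < INR n) by (apply lt_0_INR; lia).
    pose proof (nint_Gamma_ray a (RtoC (INR n)) Ha Pn) as IG.
    destruct (nint_restrict_l 0 1 p_infty _ _ ltac:(lra) I IG) as [g1 H1].
    destruct (nint_restrict_r 0 1 p_infty _ _ ltac:(lra) I IG) as [g2 H2].
    pose proof (nint_split 0 1 p_infty _ _ _ _ ltac:(lra) I IG H1 H2) as E.
    pose proof (nint_Beta a (e + 1 + RtoC (INR n)) Ha (Re_plus_nat _ _ He)) as IB.
    pose proof (nint_minus 0 1 _ _ _ _ lt_0_1 IB H1) as ID.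
    pose proof (nint_GammaR (alpha + 1) (INR n) ltac:(lra) Pn) as GR1.
    pose proof (nint_GammaR (alpha + 2) (INR n) ltac:(lra) Pn) as GR2.
    set (X := Rpower (INR n) (- (alpha + 1))).
    assert (EX : INR n * Rpower (INR n) (- (alpha + 2)) = X).
    { unfold X. replace (- (alpha + 1)) with (1 + - (alpha + 2)) by ring.
      rewrite (Rpower_plus 1), Rpower_1 by auto. reflexivity. }
    (* beyond t = 1 raising the exponent alpha - 1 to alpha gains a factor 1 / n *)
    assert (T2 : Cmod g2 <= GammaR (alpha + 1) * X).
    { apply (proj2 (nint_bound_sub _ g2 _ _ GR1
        (fun t Ht => Rlt_le _ _ (Rmult_lt_0_compat _ _ (Rpower_pos _ _) (exp_pos _)))) H2).
      intros t Ht. rewrite Cmod_mult, Cmod_Cpower_R, Cmod_Cexp by lra.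
      replace (Re (- (RtoC (INR n) * RtoC t))) with (- (INR n * t)) by (unfold Re; simpl; ring).
      apply Rmult_le_compat_r; [left; apply exp_pos|].
      apply Rle_Rpower; [lra|]. unfold alpha, Re; simpl; lra. }
    pose proof (nint_plus 0 p_infty _ _ _ _ I (nint_scal 0 p_infty _ _ (RtoC K) I GR1)
      (nint_scal 0 p_infty _ _ (RtoC (INR n)) I GR2)) as GR3.
    set (g3 := fun t => K * (Rpower t (alpha + 1 - 1) * exp (- (INR n * t)))
                        + INR n * (Rpower t (alpha + 2 - 1) * exp (- (INR n * t)))).
    assert (GR4 : is_nint 0 p_infty (fun t => RtoC (g3 t))
              (RtoC (K * (GammaR (alpha + 1) * X) + GammaR (alpha + 2) * X))).
    { eapply nint_val.
      - eapply nint_ext; [|exact GR3]. intros. cbv beta.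
        rewrite <- !RtoC_mult, <- RtoC_plus. reflexivity.
      - rewrite <- !RtoC_mult, <- RtoC_plus. f_equal. fold X.
        rewrite <- (Rmult_assoc (INR n)), (Rmult_comm (INR n)), Rmult_assoc, EX. ring. }
    assert (Pos3 : forall t, 0 < t -> 0 <= g3 t).
    { intros t Ht. unfold g3.
      pose proof (Rmult_lt_0_compat _ _ (Rpower_pos t (alpha + 1 - 1)) (exp_pos (- (INR n * t)))).
      pose proof (Rmult_lt_0_compat _ _ (Rpower_pos t (alpha + 2 - 1)) (exp_pos (- (INR n * t)))).
      apply Rplus_le_le_0_compat; apply Rmult_le_pos; lra. }
    assert (T1 : Cmod (Beta a (e + 1 + RtoC (INR n)) - g1)
                 <= K * (GammaR (alpha + 1) * X) + GammaR (alpha + 2) * X).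
    { apply (proj1 (nint_bound_sub _ _ _ _ GR4 Pos3) ID).
      intros t Ht. unfold beta_weight.
      replace (e + 1 + RtoC (INR n) - 1)%C with (e + RtoC (INR n))%C by ring.
      rewrite Cpower_plus_nat by (apply RtoC_neq_0; lra).
      replace (Cexp (- (RtoC (INR n) * RtoC t))) with (RtoC (exp (- (INR n * t)))).
      2:{ rewrite <- Cexp_R. f_equal. rewrite RtoC_opp, RtoC_mult. reflexivity. }
      rewrite <- RtoC_pow.
      pose proof (exp_minus_pow t n Ht) as EP.
      specialize (HK t Ht).
      set (Q := Cpower (RtoC (1 - t)) e) in *. set (u := (1 - t) ^ n) in *.
      set (v := exp (- (INR n * t))) in *.
      assert (u0 : 0 <= u) by (apply pow_le; lra).
      replace (Cpower (RtoC t) (a - 1) * (Q * RtoC u) - Cpower (RtoC t) (a - 1) * RtoC v)%C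
        with (Cpower (RtoC t) (a - 1) * ((Q - 1) * RtoC u - RtoC (v - u)))%C
        by (rewrite RtoC_minus; ring).
      rewrite Cmod_mult, Cmod_Cpower_R by lra.
      assert (B : Cmod ((Q - 1) * RtoC u - RtoC (v - u)) <= (K * t + INR n * t ^ 2) * v).
      { eapply Rle_trans; [apply Cmod_minus_le|].
        rewrite Cmod_mult, !Cmod_R, !Rabs_right by lra.
        pose proof (Cmod_ge_0 (Q - 1)). nra. }
      replace (g3 t) with (Rpower t (Re (a - 1)) * ((K * t + INR n * t ^ 2) * v)).
      - apply Rmult_le_compat_l; [left; apply Rpower_pos|exact B].
      - unfold g3. fold v.
        replace (alpha + 1 - 1) with (Re (a - 1) + 1) by (unfold alpha, Re; simpl; ring).
        replace (alpha + 2 - 1) with (Re (a - 1) + 1 + 1) by (unfold alpha, Re; simpl; ring).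
        rewrite !Rpower_plus, Rpower_1 by lra. ring. }
    assert (Nn : Cpower (RtoC (INR n)) a <> 0%C) by apply Cpower_neq_0.
    replace (Cpower (RtoC (INR n)) a * Beta a (e + 1 + RtoC (INR n)) - CGamma a)%C
      with (Cpower (RtoC (INR n)) a * ((Beta a (e + 1 + RtoC (INR n)) - g1) - g2))%C.
    2:{ replace (CGamma a) with (Cpower (RtoC (INR n)) a * (CGamma a * Cpower (RtoC (INR n)) (- a)))%C.
        - rewrite E. ring.
        - rewrite Cpower_opp. field. auto. }
    rewrite Cmod_mult, Cmod_Cpower_R by auto. fold alpha.
    apply Rle_trans with (Rpower (INR n) alpha * (K1 * X)).
    - apply Rmult_le_compat_l; [left; apply Rpower_pos|].
      eapply Rle_trans; [apply Cmod_minus_le|]. unfold K1. lra.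
    - right. unfold X. replace (- (alpha + 1)) with (- alpha + - (1)) by ring.
      rewrite Rpower_plus, !Rpower_Ropp, Rpower_1 by auto. field.
      split; [lra|]. apply Rgt_not_eq, Rpower_pos. }
  intros eps Heps.
  destruct (INR_unbounded (K1 / eps)) as [N HN].
  exists (S N). intros n Hn. eapply Rle_lt_trans; [apply Main; lia|].
  assert (Pn : 0 < INR n) by (apply lt_0_INR; lia).
  assert (INR N < INR n) by (apply lt_INR; lia).
  apply Rmult_lt_reg_r with (INR n); auto. unfold Rdiv at 1. rewrite Rmult_assoc, Rinv_l by lra.
  rewrite Rmult_1_r. replace K1 with (K1 / eps * eps) by (field; lra).
  rewrite (Rmult_comm eps). apply Rmult_lt_compat_r; lra.
Qed.

Lemma Cpower_one_minus_lipschitz e : 0 < Re e -> exists K,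
  forall t, 0 < t < 1 -> Cmod (Cpower (RtoC (1 - t)) e - 1) <= K * t.
Proof.
  intros He. set (rho := Re e) in *.
  destruct (INR_unbounded rho) as [n Hn].
  exists (Cmod e / rho * INR n). intros t Ht.
  rewrite Cmod_minus_sym.
  assert (MV : Cmod (Cpower (RtoC 1) e - Cpower (RtoC (1 - t)) e)
     <= Cmod e / rho * Rpower 1 rho - Cmod e / rho * Rpower (1 - t) rho).
  { apply (mean_value_inequality (fun s => Cpower (RtoC s) e)
      (fun s => e * Cpower (RtoC s) (e - 1))%C (fun s => Cmod e / rho * Rpower s rho)
      (fun s => Cmod e * Rpower s (rho - 1)) (1 - t) 1 ltac:(lra)).
    - intros s Hs. apply cder_Cpower_R. lra.
    - intros s Hs. eapply is_derive_val; [apply is_derive_scal, is_derive_Rpower; lra|].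
      simpl. field. lra.
    - intros s Hs. rewrite Cmod_mult, Cmod_Cpower_R by lra. right. reflexivity. }
  rewrite Cpower_one in MV.
  replace (Rpower 1 rho) with 1 in MV by (unfold Rpower; rewrite ln_1, Rmult_0_r, exp_0; reflexivity).
  eapply Rle_trans; [exact MV|].
  assert (B : 1 - INR n * t <= Rpower (1 - t) rho).
  { eapply Rle_trans; [apply Bernoulli_ge; lra|].
    rewrite <- Rpower_pow by lra. unfold Rpower. apply exp_le.
    assert (ln (1 - t) <= 0) by (rewrite <- ln_1; apply ln_le; lra). nra. }
  assert (0 <= Cmod e / rho) by (apply Rdiv_le_0_compat; [apply Cmod_ge_0|auto]).
  nra.
Qed.

Definition gauss_product (z : C) (n : nat) : C :=
  (Cpower (RtoC (INR n)) z * Cfact n / poch z (S n))%C.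

Lemma poch_neq_0 a n : 0 < Re a -> poch a n <> 0%C.
Proof.
  intros Ha. induction n as [|n IH]; simpl.
  - intros E. apply (f_equal fst) in E. simpl in E. lra.
  - apply Cmult_neq_0; auto. intros E. pose proof (Re_plus_nat a n Ha) as P.
    rewrite E in P. simpl in P. lra.
Qed.

Lemma poch_1 n : poch 1 n = Cfact n.
Proof.
  induction n as [|n IH].
  - unfold Cfact. simpl. reflexivity.
  - rewrite poch_S, IH, Cfact_S, S_INR, RtoC_plus. ring.
Qed.

(** Gauss's product is the Beta integral with integer second argument. *)
Lemma gauss_product_limit z : 0 < Re z -> clim eventually (gauss_product z) (CGamma z).
Proof.
  intros Hz.
  assert (E0 : 0 < Re (0 + 1)) by (simpl; lra).
  apply clim_ext_loc with (F := (fun n => Cpower (RtoC (INR n)) z * Beta z (0 + 1 + RtoC (INR n)))%C);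
    [typeclasses eauto| |].
  - exists O. intros n _. unfold gauss_product. unfold Cdiv. rewrite <- Cmult_assoc. f_equal.
    replace (0 + 1 + RtoC (INR n))%C with (1 + RtoC (INR n))%C by ring.
    pose proof (Beta_poch_r z 1 n Hz ltac:(simpl; lra)) as E.
    rewrite Beta_1_r, poch_1 in E by auto.
    assert (N1 : poch (z + 1) n <> 0%C) by (apply poch_neq_0; unfold Re in *; simpl; lra).
    assert (N2 : z <> 0%C) by (intros ->; simpl in Hz; lra).
    rewrite poch_shift.
    replace (Beta z (1 + RtoC (INR n))) with
      (poch (z + 1) n * Beta z (1 + RtoC (INR n)) / poch (z + 1) n)%C by (field; auto).
    rewrite E. field. auto.
  - apply (Beta_large z 0 0 Hz E0). intros t Ht. rewrite Cpower_0.
    replace (1 - 1)%C with (RtoC 0) by ring. rewrite Cmod_0. lra.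
Qed.

(** Raising the second argument by n multiplies Beta by a quotient of Pochhammer
    symbols, which is a quotient of Gauss products up to the factor n^a; both this
    quotient and n^a times the shifted Beta value have known limits. *)
Lemma Beta_Gamma a d : 0 < Re a -> 0 < Re d ->
  (Beta a d * CGamma (a + d))%C = (CGamma a * CGamma d)%C.
Proof.
  intros Ha Hd.
  assert (Hc : 0 < Re (a + d)) by (unfold Re in *; simpl; lra).
  assert (Hd1 : 0 < Re (d + 1)) by (unfold Re in *; simpl; lra).
  destruct (Cpower_one_minus_lipschitz d Hd) as [K HK].
  pose proof (Beta_large a d K Ha Hd1 HK) as L1.
  pose proof (gauss_product_limit d Hd) as L2.
  pose proof (gauss_product_limit (a + d) Hc) as L3.
  apply (clim_unique eventually (fun n => Beta a d * gauss_product (a + d) n)%C).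
  - apply clim_scal; auto. typeclasses eauto.
  - eapply clim_ext_loc; [typeclasses eauto| |apply clim_mult; [typeclasses eauto|exact L1|exact L2]].
    exists O. intros n _. unfold gauss_product.
    pose proof (Beta_poch_r a d (S n) Ha Hd) as E.
    rewrite S_INR, RtoC_plus in E.
    replace (d + (RtoC (INR n) + RtoC 1))%C with (d + 1 + RtoC (INR n))%C in E by ring.
    pose proof (poch_neq_0 d (S n) Hd) as N1. pose proof (poch_neq_0 (a + d) (S n) Hc) as N2.
    set (B1 := Beta a (d + 1 + RtoC (INR n))) in *. set (p1 := poch d (S n)) in *.
    set (p2 := poch (a + d) (S n)) in *.
    replace B1 with (p2 * B1 / p2)%C by (field; auto). rewrite E, (Cpower_plus _ a d).
    field. auto.
Qed.

(** Each factor satisfies |z + k| <= (x + k) (1 + w) <= (x + k) e^w with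
    w = y^2 / (x + k)^2, and the sum of 1 / (x + k)^2 is dominated by the telescoping
    sum of 1 / (x + k - 1) - 1 / (x + k). *)
Lemma poch_le_real z n : 0 < Re z ->
  Cmod (poch z (S n)) <= Cmod (poch (RtoC (Re z)) (S n))
   * exp (Im z ^ 2 * (/ (Re z) ^ 2 + / Re z - / (Re z + INR n))).
Proof.
  intros Hz. set (x := Re z) in *. set (y := Im z).
  assert (F : forall k, Cmod (z + RtoC (INR k)) <= Cmod (RtoC x + RtoC (INR k)) * exp (y ^ 2 * / (x + INR k) ^ 2)).
  { intros k. pose proof (pos_INR k).
    rewrite <- RtoC_plus, Cmod_R, Rabs_right by lra.
    set (u := x + INR k). assert (u0 : 0 < u) by (unfold u; lra).
    apply Rle_trans with (u * (1 + y ^ 2 * / u ^ 2)).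
    - pose proof (Cmod_sqr (z + RtoC (INR k))) as S.
      replace (fst (z + RtoC (INR k))%C) with u in S by (unfold u, x, Re; simpl; ring).
      replace (snd (z + RtoC (INR k))%C) with y in S by (unfold y, Im; simpl; ring).
      set (m := Cmod (z + RtoC (INR k))) in *.
      assert (m0 : 0 <= m) by apply Cmod_ge_0.
      assert (W : 0 <= y ^ 2 * / u ^ 2).
      { apply Rmult_le_pos; [nra|]. left; apply Rinv_0_lt_compat. nra. }
      assert (E : y * y = u * u * (y ^ 2 * / u ^ 2)) by (field; lra).
      apply Rnot_lt_le. intros L.
      set (w := y ^ 2 * / u ^ 2) in *.
      assert (u * (1 + w) * (u * (1 + w)) < m * m) by (apply Rmult_le_0_lt_compat; nra).
      nra.
    - apply Rmult_le_compat_l; [lra|]. apply exp_ineq1_le. }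
  induction n as [|n IH].
  - simpl poch. specialize (F O). simpl INR in *.
    rewrite !Cmult_1_l.
    replace (y ^ 2 * (/ x ^ 2 + / x - / (x + 0))) with (y ^ 2 * / (x + 0) ^ 2) by (field; lra).
    exact F.
  - rewrite poch_S, (poch_S (RtoC x) (S n)), !Cmod_mult.
    pose proof (pos_INR n). specialize (F (S n)). rewrite S_INR in *.
    set (A := Cmod (poch (RtoC x) (S n))) in *.
    assert (A0 : 0 <= A) by apply Cmod_ge_0.
    eapply Rle_trans.
    { apply Rmult_le_compat; [apply Cmod_ge_0|apply Cmod_ge_0|exact IH|exact F]. }
    set (B := Cmod (RtoC x + RtoC (INR n + 1))).
    assert (B0 : 0 <= B) by apply Cmod_ge_0.
    replace (A * exp (y ^ 2 * (/ x ^ 2 + / x - / (x + INR n))) * (B * exp (y ^ 2 * / (x + (INR n + 1)) ^ 2)))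
      with (A * B * (exp (y ^ 2 * (/ x ^ 2 + / x - / (x + INR n))) * exp (y ^ 2 * / (x + (INR n + 1)) ^ 2))) by ring.
    apply Rmult_le_compat_l; [apply Rmult_le_pos; auto|].
    rewrite <- exp_plus, <- Rmult_plus_distr_l. apply exp_le.
    apply Rmult_le_compat_l; [nra|].
    assert (D : / (x + (INR n + 1)) ^ 2 <= / (x + INR n) - / (x + (INR n + 1))); [|lra].
    replace (/ (x + INR n) - / (x + (INR n + 1))) with (/ ((x + INR n) * (x + (INR n + 1)))) by (field; lra).
    apply Rinv_le_contravar; nra.
Qed.

(** In Gauss's product the modulus at z is at least a fixed multiple of the value
    at Re z, where the integrand of the Gamma integral is positive. *)
Lemma CGamma_neq_0 z : 0 < Re z -> CGamma z <> 0%C.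
Proof.
  intros Hz E0.
  set (x := Re z) in *. set (M := exp (Im z ^ 2 * (/ x ^ 2 + / x))).
  assert (B : Cmod (CGamma (RtoC x)) <= M * Cmod (CGamma z)).
  { apply (clim_Cmod_le eventually (gauss_product (RtoC x)) _ (fun n => M * Cmod (gauss_product z n))).
    - apply gauss_product_limit. exact Hz.
    - pose proof (gauss_product_limit z Hz) as L.
      apply (clim_RtoC eventually). 
      intros eps He. assert (M0 : 0 < M) by apply exp_pos.
      destruct (L (eps / M)) as [N HN]; [apply Rdiv_lt_0_compat; auto|].
      exists N. intros n Hn. specialize (HN n Hn).
      rewrite <- RtoC_minus, Cmod_R, <- Rmult_minus_distr_l, Rabs_mult, (Rabs_right M) by lra.
      apply Rle_lt_trans with (M * Cmod (gauss_product z n - CGamma z)).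
      + apply Rmult_le_compat_l; [lra|].
        pose proof (Cmod_diff_ge (gauss_product z n) (CGamma z)).
        pose proof (Cmod_diff_ge (CGamma z) (gauss_product z n)) as D2.
        rewrite Cmod_minus_sym in D2. apply Rabs_le; lra.
      + replace eps with (M * (eps / M)) by (field; lra). apply Rmult_lt_compat_l; auto.
    - exists 1%nat. intros n Hn. assert (Pn : 0 < INR n) by (apply lt_0_INR; lia).
      unfold gauss_product.
      pose proof (poch_neq_0 z (S n) Hz) as N1. pose proof (poch_neq_0 (RtoC x) (S n) Hz) as N2.
      rewrite !Cmod_div, !Cmod_mult, !Cmod_Cpower_R by auto.
      change (Re (RtoC x)) with x. fold x.
      set (A := Rpower (INR n) x * Cmod (Cfact n)).
      assert (A0 : 0 <= A) by (apply Rmult_le_pos; [left; apply Rpower_pos|apply Cmod_ge_0]).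
      pose proof (poch_le_real z n Hz) as P. fold x in P.
      apply Cmod_gt_0 in N1. apply Cmod_gt_0 in N2.
      set (p := Cmod (poch z (S n))) in *. set (q := Cmod (poch (RtoC x) (S n))) in *.
      assert (P2 : p <= q * M).
      { eapply Rle_trans; [exact P|]. apply Rmult_le_compat_l; [lra|]. apply exp_le.
        apply Rmult_le_compat_l; [nra|].
        assert (0 < / (x + INR n)) by (apply Rinv_0_lt_compat; lra). lra. }
      apply Rmult_le_reg_r with (p * q); [nra|].
      replace (A / q * (p * q)) with (A * p) by (field; lra).
      replace (M * (A / p) * (p * q)) with (A * (q * M)) by (field; lra).
      apply Rmult_le_compat_l; auto. }
  rewrite E0, Cmod_0, Rmult_0_r in B.
  pose proof (GammaR_pos x Hz) as P. unfold GammaR in P.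
  pose proof (fst_le_Cmod (CGamma (RtoC x))) as F. rewrite Rabs_right in F by lra. lra.
Qed.

Lemma Beta_neq_0 a d : 0 < Re a -> 0 < Re d -> Beta a d <> 0%C.
Proof.
  intros Ha Hd E. pose proof (Beta_Gamma a d Ha Hd) as H. rewrite E in H.
  apply (Cmult_neq_0 _ _ (CGamma_neq_0 a Ha) (CGamma_neq_0 d Hd)).
  rewrite <- H. ring.
Qed.

(** * Euler integrals and their series *)

Lemma clim_of_dist_le {T} Ft {FF : Filter Ft} (u : T -> C) l (g : T -> R) :
  filterlim g Ft (locally 0) -> Ft (fun x => Cmod (u x - l) <= g x) -> clim Ft u l.
Proof.
  intros H1 H2 eps He.
  apply (proj1 (filterlim_locally _ _)) with (eps := mkposreal _ He) in H1.
  generalize (filter_and _ _ H1 H2). apply filter_imp. intros x [A B].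
  change (Rabs (g x - 0) < eps) in A. apply Rabs_def2 in A. lra.
Qed.

Lemma nint_partial_sum (p : R) q (f : nat -> R -> C) (l : nat -> C) N : Rbar_lt p q ->
  (forall n, is_nint p q (f n) (l n)) ->
  is_nint p q (fun t => partial_sum (fun n => f n t) N) (partial_sum l N).
Proof.
  intros Hpq H. induction N as [|N IH].
  - apply nint_zero, Hpq.
  - rewrite partial_sum_S. eapply nint_ext; [|apply (nint_plus p q _ _ _ _ Hpq IH (H N))].
    intros t _ _. cbv beta. symmetry. apply partial_sum_S.
Qed.

(** Uniform convergence on (0, 1) is enough for termwise integration against the
    Beta weight, the total mass of which is finite. *)
Lemma nint_beta_series a d (u : nat -> R -> C) (f : R -> C) (M : nat -> R) (eps : nat -> R) :
  0 < Re a -> 0 < Re d ->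
  (forall n t, 0 < t < 1 -> ccontR (u n) t) ->
  (forall n t, 0 < t < 1 -> Cmod (u n t) <= M n) ->
  (forall t, 0 < t < 1 -> ccontR f t) ->
  is_lim_seq eps 0 ->
  (forall k t, 0 < t < 1 -> Cmod (f t - partial_sum (fun n => u n t) (S k)) <= eps k) ->
  clim eventually
    (fun k => partial_sum (fun n => nint 0 1 (fun t => beta_weight a d t * u n t)%C) (S k))
    (nint 0 1 (fun t => beta_weight a d t * f t)%C).
Proof.
  intros Ha Hd Cu Mu Cf Le He.
  assert (If : is_nint 0 1 (fun t => beta_weight a d t * f t)%C
                 (nint 0 1 (fun t => beta_weight a d t * f t)%C)).
  { apply (nint_beta_exists a d f (M 0%nat + eps 0%nat)); auto. intros t Ht.
    specialize (He 0%nat t Ht). rewrite partial_sum_S in He. simpl in He.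
    replace (f t) with (u 0%nat t + (f t - (0 + u 0%nat t)))%C by ring.
    eapply Rle_trans; [apply Cmod_triangle|]. specialize (Mu 0%nat t Ht). lra. }
  apply (clim_of_dist_le _ _ _ (fun k => eps k * BetaR (Re a) (Re d))).
  - pose proof (is_lim_seq_scal_r eps (BetaR (Re a) (Re d)) 0 Le) as K.
    simpl in K. rewrite Rmult_0_l in K. exact K.
  - exists 0%nat. intros k _. rewrite Cmod_minus_sym.
    apply (nint_beta_bound a d (fun t => f t - partial_sum (fun n => u n t) (S k))%C); auto.
    assert (Ip : forall n, is_nint 0 1 (fun t => beta_weight a d t * u n t)%C
               (nint 0 1 (fun t => beta_weight a d t * u n t)%C)).
    { intros n. apply (nint_beta_exists a d (u n) (M n)); auto. }
    eapply nint_ext;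
      [|apply (nint_minus 0 1 _ _ _ _ lt_0_1 If (nint_partial_sum 0 1 _ _ (S k) lt_0_1 Ip))].
    intros t _ _. cbv beta. rewrite partial_sum_scal. ring.
Qed.

Lemma CSeries_eq u l : clim eventually (fun k => partial_sum u (S k)) l -> CSeries u = l.
Proof.
  intros H. unfold CSeries.
  assert (S1 : forall k, fst (partial_sum u (S k)) = sum_n (fun n => Re (u n)) k).
  { induction k as [|k IH]; [rewrite partial_sum_S; simpl; rewrite sum_O; unfold Re; ring|].
    rewrite partial_sum_S, sum_Sn, <- IH. reflexivity. }
  assert (S2 : forall k, snd (partial_sum u (S k)) = sum_n (fun n => Im (u n)) k).
  { induction k as [|k IH]; [rewrite partial_sum_S; simpl; rewrite sum_O; unfold Im; ring|].
    rewrite partial_sum_S, sum_Sn, <- IH. reflexivity. }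
  apply C_ext; simpl; apply is_series_unique; apply filterlim_locally; intros eps;
    generalize (H eps (cond_pos eps)); apply filter_imp; intros k B.
  - change (Rabs (sum_n (fun n => Re (u n)) k - fst l) < eps). rewrite <- S1.
    eapply Rle_lt_trans; [|exact B]. apply (fst_le_Cmod (partial_sum u (S k) - l)).
  - change (Rabs (sum_n (fun n => Im (u n)) k - snd l) < eps). rewrite <- S2.
    eapply Rle_lt_trans; [|exact B]. apply (snd_le_Cmod (partial_sum u (S k) - l)).
Qed.

(** Quantitative distance from the cut, stable under small perturbations. *)
Definition cut_gap (kappa : R) (z : C) : Prop := kappa <= Cmod z + Re z.

Lemma cut_gap_off_cut kappa z : 0 < kappa -> cut_gap kappa z -> off_cut z.
Proof. unfold cut_gap, off_cut. lra. Qed.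

Lemma cut_gap_Cmod kappa z : cut_gap kappa z -> kappa / 2 <= Cmod z.
Proof. unfold cut_gap. pose proof (Re_le_Cmod' z). lra. Qed.

Lemma cut_gap_near kappa z w : cut_gap kappa z -> Cmod (w - z) <= kappa / 4 -> cut_gap (kappa / 2) w.
Proof.
  unfold cut_gap. intros Hz B.
  pose proof (fst_le_Cmod (w - z)) as B1. simpl in B1. apply Rabs_le_between in B1.
  pose proof (Cmod_diff_ge z w) as B2. rewrite Cmod_minus_sym in B2. unfold Re in *. lra.
Qed.

Lemma off_cut_Im z : Im z <> 0 -> off_cut z.
Proof.
  intros H. unfold off_cut. pose proof (Cmod_sqr z) as S. pose proof (Re_ge_Cmod z) as B.
  fold (Re z) (Im z) in S.
  destruct (Req_dec (Cmod z + Re z) 0) as [E|E]; [|lra].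
  exfalso. assert (Re z = - Cmod z) as R0 by lra. rewrite R0 in S. apply H. nra.
Qed.

Lemma off_cut_segment z t : slit_plane z -> 0 <= t <= 1 -> off_cut (1 - RtoC t * z).
Proof.
  intros Hz Ht. destruct (Req_dec (Im z) 0) as [E|E].
  - assert (L : Re z < 1) by (apply Rnot_le_lt; intro; apply Hz; auto).
    destruct (Req_dec t 0) as [->|Nt].
    + replace (1 - RtoC 0 * z)%C with (RtoC 1) by ring. apply off_cut_R. lra.
    + apply off_cut_Re. unfold Re, Im in *. simpl. rewrite E. nra.
  - destruct (Req_dec t 0) as [->|Nt].
    + replace (1 - RtoC 0 * z)%C with (RtoC 1) by ring. apply off_cut_R. lra.
    + apply off_cut_Im. unfold Re, Im in *. simpl.
      intro K. apply (Rmult_integral_contrapositive t (snd z)); [tauto|]. lra.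
Qed.

Lemma slit_gap z : slit_plane z ->
  exists kappa, 0 < kappa /\ forall t, 0 <= t <= 1 -> cut_gap kappa (1 - RtoC t * z).
Proof.
  intros Hz.
  set (f := fun t => Cmod (1 - RtoC t * z) + Re (1 - RtoC t * z)).
  destruct (continuity_ab_min f 0 1 ltac:(lra)) as [m [Hm Im]].
  - intros t _ eps He. pose proof (Cmod_ge_0 z) as Z.
    exists (eps / (2 * Cmod z + 1)). split; [apply Rdiv_lt_0_compat; lra|].
    intros s [_ Hs]. simpl in *. unfold R_dist in *.
    assert (E : (1 - RtoC s * z - (1 - RtoC t * z) = - (RtoC (s - t) * z))%C)
      by (rewrite RtoC_minus; ring).
    assert (A : Cmod (1 - RtoC s * z - (1 - RtoC t * z)) = Rabs (s - t) * Cmod z)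
      by (rewrite E, Cmod_opp, Cmod_mult, Cmod_R; reflexivity).
    set (u := (1 - RtoC s * z)%C) in *. set (v := (1 - RtoC t * z)%C) in *.
    change (Rabs (Cmod u + Re u - (Cmod v + Re v)) < eps).
    clear E. clearbody u v.
    pose proof (Cmod_diff_ge u v). pose proof (Cmod_diff_ge v u) as D.
    rewrite (Cmod_minus_sym v u) in D.
    pose proof (fst_le_Cmod (u - v)) as B. simpl in B. apply Rabs_le_between in B.
    apply Rle_lt_trans with (2 * (Rabs (s - t) * Cmod z)).
    + rewrite A in *. unfold Re. apply Rabs_le. lra.
    + pose proof (Rabs_pos (s - t)).
      replace eps with ((2 * Cmod z + 1) * (eps / (2 * Cmod z + 1))) by (field; lra). nra.
  - exists (f m). split; [exact (off_cut_segment z m Hz Im)|]. intros t Ht. apply Hm, Ht.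
Qed.

Definition euler_factor (b z : C) (t : R) : C := Cpower (1 - RtoC t * z) (- b).

Lemma cder_one_minus_line z t : cder (fun s => 1 - RtoC s * z)%C t (- z)%C.
Proof.
  eapply cder_ext; [|eapply cder_val; [apply (cder_line 1 (- z) t)|reflexivity]].
  intros s. cbv beta. ring.
Qed.

Lemma ccontR_Cpower_segment z b t : off_cut (1 - RtoC t * z) ->
  ccontR (fun t => Cpower (1 - RtoC t * z) b) t.
Proof.
  intros H. eapply cder_ccontR.
  apply (hol_Cpower _ b H (fun t => 1 - RtoC t * z)%C t (- z)%C); [reflexivity|].
  apply cder_one_minus_line.
Qed.

Lemma power_bound kappa R0 b : 0 < kappa -> exists M, 0 < M /\
  forall z, cut_gap kappa z -> Cmod z <= R0 -> Cmod (Cpower z b) <= M.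
Proof.
  intros Hk. eexists. split; [|intros z Hz HR; apply (Cmod_Cpower_le z b (kappa / 2) R0)].
  - apply exp_pos.
  - apply (cut_gap_off_cut kappa); auto.
  - lra.
  - split; auto. apply cut_gap_Cmod; auto.
Qed.

Lemma Cmod_one_minus_le z t : 0 <= t <= 1 -> Cmod (1 - RtoC t * z) <= 1 + Cmod z.
Proof.
  intros Ht. eapply Rle_trans; [apply Cmod_minus_le|].
  rewrite Cmod_1, Cmod_mult, Cmod_R, Rabs_right by lra. pose proof (Cmod_ge_0 z). nra.
Qed.

Lemma slit_disc z : Cmod z < 1 -> slit_plane z.
Proof.
  intros Hz [_ H]. pose proof (Re_le_Cmod' z). lra.
Qed.

Lemma beta_weight_shift a d n t : 0 < t ->
  (beta_weight a d t * RtoC t ^ n)%C = beta_weight (a + RtoC (INR n)) d t.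
Proof.
  intros Ht. unfold beta_weight.
  replace (a + RtoC (INR n) - 1)%C with (a - 1 + RtoC (INR n))%C by ring.
  rewrite (Cpower_plus_nat _ (a - 1)) by (apply RtoC_neq_0; lra). ring.
Qed.

Definition euler_integral (a d b z : C) : C :=
  nint 0 1 (fun t => beta_weight a d t * euler_factor b z t)%C.

Lemma RtoC_pow_le t z n : 0 < t < 1 -> Cmod ((RtoC t * z) ^ n) <= Cmod z ^ n.
Proof.
  intros Ht. rewrite Cmod_pow, Cmod_mult, Cmod_R, Rabs_right by lra.
  apply pow_incr. pose proof (Cmod_ge_0 z). split; [apply Rmult_le_pos; lra|nra].
Qed.

Lemma ccontR_scal_pow k z n t : ccontR (fun t => k * (RtoC t * z) ^ n)%C t.
Proof.
  destruct n as [|n].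
  - apply (cder_ccontR _ t 0%C). apply (cder_ext (fun _ => k)).
    + intros; simpl; ring.
    + apply cder_const.
  - eapply cder_ccontR. apply cder_scal. apply (cder_Cpow (fun t => RtoC t * z)%C).
    apply cder_mult; [apply cder_id|apply cder_const].
Qed.

Definition moebius (z : C) (t : R) : C := (RtoC t / (1 - RtoC t * z))%C.

Lemma cder_moebius z t : off_cut (1 - RtoC t * z) -> exists v, cder (moebius z) t v.
Proof.
  intros Off. eexists.
  apply (cder_mult (fun s => RtoC s) (fun s => / (1 - RtoC s * z))%C); [apply cder_id|].
  eapply cder_ext_loc with (f := fun s => Cpower (1 - RtoC s * z) (- (1))).
  - assert (He : 0 < (Cmod (1 - RtoC t * z) + Re (1 - RtoC t * z)) / 2)
      by (unfold off_cut in Off; lra).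
    generalize (cder_cont _ _ _ _ (cder_one_minus_line z t) He). apply filter_imp.
    intros s B. apply off_cut_open in B; auto.
    rewrite Cpower_opp, Cpower_1 by (apply off_cut_neq_0, B). reflexivity.
  - apply (hol_Cpower _ _ Off (fun s => 1 - RtoC s * z)%C); [reflexivity|].
    apply cder_one_minus_line.
Qed.

Definition euler_coef (a d b z : C) (n : nat) : C :=
  (bin_coef b n * nint 0 1 (fun t => beta_weight a d t * (euler_factor b z t * moebius z t ^ n)))%C.

(** The factor 1 - t (z + h) is (1 - t z) (1 - h w) with w = t / (1 - t z), so the
    binomial series in h w can be integrated term by term as long as |h w| is bounded
    away from 1 and the segments from 1 - t z stay off the cut.  Base point 0 gives the
    Gauss series, the other base points give analyticity. *)
Lemma euler_integral_expansion a d b z h kappa q :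
  0 < Re a -> 0 < Re d -> 0 < kappa -> 0 <= q < 1 ->
  (forall t s, 0 <= t <= 1 -> 0 <= s <= 1 -> cut_gap kappa (1 - RtoC t * z - RtoC s * (RtoC t * h))) ->
  (forall t, 0 < t < 1 -> Cmod (moebius z t * h) <= q) ->
  clim eventually (fun k => partial_sum (fun n => euler_coef a d b z n * h ^ n)%C (S k))
    (euler_integral a d b (z + h)).
Proof.
  intros Ha Hd kp Hq Gap Hwh.
  set (R0 := 1 + Cmod z + Cmod h).
  destruct (power_bound kappa R0 (- b) kp) as (M1 & M1p & HM1).
  destruct (power_bound kappa R0 (b - 1) kp) as (M2 & M2p & HM2).
  assert (Upper : forall t s, 0 <= t <= 1 -> 0 <= s <= 1 ->
    Cmod (1 - RtoC t * z - RtoC s * (RtoC t * h)) <= R0).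
  { intros t s Ht Hs.
    eapply Rle_trans; [apply Cmod_minus_le|]. pose proof (Cmod_one_minus_le z t Ht).
    rewrite !Cmod_mult, !Cmod_R, !Rabs_right by lra. pose proof (Cmod_ge_0 h).
    assert (0 <= t * Cmod h <= Cmod h) by nra. unfold R0. nra. }
  assert (Gap0 : forall t, 0 <= t <= 1 ->
    cut_gap kappa (1 - RtoC t * z) /\ Cmod (1 - RtoC t * z) <= R0).
  { intros t Ht. pose proof (Gap t 0 Ht ltac:(lra)) as A. pose proof (Upper t 0 Ht ltac:(lra)) as B.
    replace (1 - RtoC t * z - RtoC 0 * (RtoC t * h))%C with (1 - RtoC t * z)%C in A, B by ring.
    auto. }
  assert (Low : forall t, 0 <= t <= 1 -> kappa / 2 <= Cmod (1 - RtoC t * z)).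
  { intros t Ht. apply cut_gap_Cmod, Gap0, Ht. }
  assert (Hw : forall t, 0 < t < 1 -> Cmod (moebius z t) <= 2 / kappa).
  { intros t Ht. specialize (Low t ltac:(lra)). unfold moebius.
    rewrite Cmod_div, Cmod_R, Rabs_right by (try (apply Cmod_gt_0); lra).
    apply Rmult_le_reg_r with (Cmod (1 - RtoC t * z)); [lra|].
    unfold Rdiv at 1. rewrite Rmult_assoc, Rinv_l by lra.
    apply Rle_trans with (2 / kappa * (kappa / 2)).
    - replace (2 / kappa * (kappa / 2)) with 1 by (field; lra). lra.
    - apply Rmult_le_compat_l; [apply Rdiv_le_0_compat; lra|lra]. }
  assert (Fb : forall t, 0 < t < 1 -> Cmod (euler_factor b z t) <= M1).
  { intros t Ht. destruct (Gap0 t ltac:(lra)) as [A B]. apply HM1; auto. }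
  assert (Off : forall t, 0 < t < 1 -> off_cut (1 - RtoC t * z)).
  { intros t Ht. apply (cut_gap_off_cut kappa); auto. apply Gap0. lra. }
  assert (Cu : forall n t, 0 < t < 1 -> ccontR (fun t => euler_factor b z t * moebius z t ^ n)%C t).
  { intros n t Ht. apply ccontR_mult; [apply ccontR_Cpower_segment, Off, Ht|].
    destruct (cder_moebius z t (Off t Ht)) as [v Dv]. destruct n as [|n].
    - exact (cder_ccontR _ t _ (cder_const 1%C t)).
    - eapply cder_ccontR. apply cder_Cpow, Dv. }
  assert (Bu : forall n t, 0 < t < 1 ->
    Cmod (euler_factor b z t * moebius z t ^ n) <= M1 * (2 / kappa) ^ n).
  { intros n t Ht. rewrite Cmod_mult, Cmod_pow.
    apply Rmult_le_compat; auto using Cmod_ge_0, pow_le.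
    apply pow_incr. split; [apply Cmod_ge_0|apply Hw, Ht]. }
  pose proof (nint_beta_series a d
    (fun n t => bin_coef b n * h ^ n * (euler_factor b z t * moebius z t ^ n))%C
    (euler_factor b (z + h)) (fun n => Cmod (bin_coef b n * h ^ n) * (M1 * (2 / kappa) ^ n))
    (fun k => M1 * M1 * (M2 * R0 * (INR (S k) * Cmod (bin_coef b (S k)) * q ^ (S k)))) Ha Hd) as L.
  eapply clim_ext_loc; [typeclasses eauto| |apply L]; clear L.
  - exists 0%nat. intros k _. apply partial_sum_ext. intros n _. unfold euler_coef.
    apply nint_eq; [apply lt_0_1|].
    eapply nint_val; [eapply nint_ext; [|apply (nint_scal 0 1 _ _ (bin_coef b n * h ^ n)%C lt_0_1
       (nint_beta_exists a d _ _ Ha Hd (Cu n) (Bu n)))]|cbv beta; ring].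
    intros t Ht _. cbv beta. ring.
  - intros n t Ht. apply ccontR_mult; [|apply Cu, Ht].
    exact (cder_ccontR _ t _ (cder_const (bin_coef b n * h ^ n)%C t)).
  - intros n t Ht. rewrite Cmod_mult. apply Rmult_le_compat_l; [apply Cmod_ge_0|]. apply Bu, Ht.
  - intros t Ht. apply ccontR_Cpower_segment.
    replace (1 - RtoC t * (z + h))%C with (1 - RtoC t * z - RtoC 1 * (RtoC t * h))%C by ring.
    apply (cut_gap_off_cut kappa); auto. apply Gap; lra.
  - assert (K := binomial_remainder_decay b q Hq).
    apply (is_lim_seq_scal_l _ (M2 * R0)) in K. apply (is_lim_seq_scal_l _ (M1 * M1)) in K.
    simpl in K. rewrite !Rmult_0_r in K. exact K.
  - intros k t Ht.
    assert (Nz : (1 - RtoC t * z)%C <> RtoC 0) by (apply off_cut_neq_0, Off, Ht).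
    pose proof (binomial_remainder_inv (1 - RtoC t * z) (RtoC t * h) b (M2 * R0) (M1 * M1) k) as R1.
    assert (Ew : (RtoC t * h / (1 - RtoC t * z))%C = (moebius z t * h)%C)
      by (unfold moebius, Cdiv; ring).
    rewrite Ew in R1.
    unfold euler_factor at 1.
    replace (1 - RtoC t * (z + h))%C with (1 - RtoC t * z - RtoC t * h)%C by ring.
    rewrite (partial_sum_ext _ (fun n => Cpower (1 - RtoC t * z) (- b) *
               (bin_coef b n * (moebius z t * h) ^ n))%C), partial_sum_scal.
    2:{ intros n _. unfold euler_factor. rewrite Cpow_mult_l. ring. }
    eapply Rle_trans; [apply R1|].
    + intros s Hs. apply (cut_gap_off_cut kappa); auto. apply Gap; lra.
    + intros s Hs. apply Rmult_le_compat; try apply Cmod_ge_0.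
      * apply HM2; [apply Gap|apply Upper]; lra.
      * apply Gap0. lra.
    + apply Rmult_le_compat; try apply Cmod_ge_0; [|apply (Fb t Ht)].
      replace (RtoC t * h)%C with (RtoC 1 * (RtoC t * h))%C by ring.
      apply HM1; [apply Gap|apply Upper]; lra.
    + apply Rmult_le_compat_l; [nra|].
      apply Rmult_le_compat_l.
      { apply Rmult_le_pos; [lra|]. unfold R0. pose proof (Cmod_ge_0 z). pose proof (Cmod_ge_0 h). lra. }
      apply Rmult_le_compat_l; [apply Rmult_le_pos; [apply pos_INR|apply Cmod_ge_0]|].
      apply pow_incr. split; [apply Cmod_ge_0|apply Hwh, Ht].
Qed.

Lemma euler_integral_series a d b z : 0 < Re a -> 0 < Re d -> Cmod z < 1 ->
  clim eventually
    (fun k => partial_sum (fun n => bin_coef b n * z ^ n * Beta (a + RtoC (INR n)) d)%C (S k))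
    (euler_integral a d b z).
Proof.
  intros Ha Hd Hz. destruct (slit_gap z (slit_disc z Hz)) as (kappa & kp & Gap).
  assert (Ew : forall t, moebius 0 t = RtoC t).
  { intros t. unfold moebius. replace (1 - RtoC t * 0)%C with (RtoC 1) by ring. field. }
  replace (euler_integral a d b z) with (euler_integral a d b (0 + z)) by (f_equal; ring).
  eapply clim_ext_loc; [typeclasses eauto| |
    apply (euler_integral_expansion a d b 0 z kappa (Cmod z) Ha Hd kp (conj (Cmod_ge_0 z) Hz))].
  - exists 0%nat. intros k _. apply partial_sum_ext. intros n _. unfold euler_coef.
    rewrite (nint_eq 0 1 _ (Beta (a + RtoC (INR n)) d) lt_0_1); [ring|].
    eapply nint_ext; [|apply (nint_Beta _ _ (Re_plus_nat a n Ha) Hd)].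
    intros t Ht _. unfold euler_factor. rewrite Ew, <- beta_weight_shift by auto.
    replace (1 - RtoC t * 0)%C with (RtoC 1) by ring. rewrite Cpower_one. ring.
  - intros t s Ht Hs.
    replace (1 - RtoC t * 0 - RtoC s * (RtoC t * z))%C with (1 - RtoC (s * t) * z)%C
      by (rewrite RtoC_mult; ring).
    apply Gap. nra.
  - intros t Ht. rewrite Ew. pose proof (RtoC_pow_le t z 1 Ht) as B.
    rewrite pow_1 in B. simpl in B. rewrite Cmult_1_r in B. exact B.
Qed.

Lemma euler_integral_analytic a d b z : 0 < Re a -> 0 < Re d -> slit_plane z ->
  exists r, 0 < r /\ forall h, Cmod h < r ->
    clim eventually (fun k => partial_sum (fun n => euler_coef a d b z n * h ^ n)%C (S k))
      (euler_integral a d b (z + h)).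
Proof.
  intros Ha Hd Sz. destruct (slit_gap z Sz) as (kappa & kp & Gap).
  exists (kappa / 4). split; [lra|]. intros h Hh.
  apply (euler_integral_expansion a d b z h (kappa / 2) (1 / 2) Ha Hd); [lra|lra| |].
  - intros t s Ht Hs. apply (cut_gap_near kappa (1 - RtoC t * z)); [apply Gap; auto|].
    replace (1 - RtoC t * z - RtoC s * (RtoC t * h) - (1 - RtoC t * z))%C
      with (- (RtoC (s * t) * h))%C by (rewrite RtoC_mult; ring).
    rewrite Cmod_opp, Cmod_mult, Cmod_R, Rabs_right by nra.
    pose proof (Cmod_ge_0 h). assert (0 <= s * t <= 1) by nra. nra.
  - intros t Ht. pose proof (cut_gap_Cmod _ _ (Gap t ltac:(lra))) as Low.
    unfold moebius, Cdiv. rewrite !Cmod_mult, Cmod_inv, Cmod_R, Rabs_right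
      by (try (apply Cmod_gt_0); lra).
    apply Rmult_le_reg_r with (Cmod (1 - RtoC t * z)); [lra|].
    replace (t * / Cmod (1 - RtoC t * z) * Cmod h * Cmod (1 - RtoC t * z)) with (t * Cmod h)
      by (field; lra).
    pose proof (Cmod_ge_0 h). nra.
Qed.

(** * The principal branch of the Gauss function *)

Lemma pow_n_Cpow (z : C) n : pow_n (K := C_AbsRing) z n = (z ^ n)%C.
Proof. induction n as [|n IH]; simpl; [reflexivity|]. rewrite IH. reflexivity. Qed.

Lemma sum_n_partial_sum (u : nat -> C) k :
  sum_n (G := C_NormedModule) u k = partial_sum u (S k).
Proof.
  induction k as [|k IH].
  - rewrite sum_O, partial_sum_S. simpl. ring.
  - rewrite sum_Sn, IH, (partial_sum_S u (S k)). reflexivity.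
Qed.

Lemma is_pseries_clim u h l :
  is_pseries (K := C_AbsRing) (V := C_NormedModule) u h l <->
  clim eventually (fun k => partial_sum (fun n => u n * h ^ n)%C (S k)) l.
Proof.
  assert (E : forall k, sum_n (G := C_NormedModule)
       (fun n => scal (K := C_AbsRing) (V := C_NormedModule) (pow_n h n) (u n)) k
     = partial_sum (fun n => u n * h ^ n)%C (S k)).
  { intros k. rewrite sum_n_partial_sum. apply partial_sum_ext. intros n _.
    rewrite pow_n_Cpow. unfold scal; simpl. unfold mult; simpl. ring. }
  unfold is_pseries, is_series.
  rewrite (filterlim_locally_ball_norm (K := C_AbsRing) (U := C_NormedModule)).
  split; intros H.
  - intros eps He. generalize (H (mkposreal _ He)). apply filter_imp. intros k B.
    unfold ball_norm in B. rewrite E in B. exact B.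
  - intros eps. generalize (H eps (cond_pos eps)). apply filter_imp. intros k B.
    unfold ball_norm. rewrite E. exact B.
Qed.

Lemma eventually_le_bounded (u : nat -> R) K N :
  (forall n, (N <= n)%nat -> u n <= K) -> exists K', forall n, u n <= K'.
Proof.
  induction N as [|N IH] in K |- *; intros H.
  - exists K. intros; apply H; lia.
  - apply (IH (Rmax K (u N))). intros n Hn.
    destruct (Nat.eq_dec n N) as [->|]; [apply Rmax_r|].
    eapply Rle_trans; [apply H; lia|apply Rmax_l].
Qed.

Lemma series_terms_bounded (u : nat -> C) l :
  clim eventually (fun k => partial_sum u (S k)) l -> exists K, forall n, Cmod (u n) <= K.
Proof.
  intros H. destruct (H 1 ltac:(lra)) as [N HN].
  apply (eventually_le_bounded _ 2 (S N)). intros n Hn.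
  destruct n as [|n]; [lia|].
  pose proof (HN (S n) ltac:(lia)) as A. pose proof (HN n ltac:(lia)) as B.
  rewrite (partial_sum_S u (S n)) in A.
  replace (u (S n)) with ((partial_sum u (S n) + u (S n) - l) - (partial_sum u (S n) - l))%C by ring.
  eapply Rle_trans; [apply Cmod_minus_le|]. lra.
Qed.

Lemma geometric_tail (v : nat -> C) h K q n : 0 <= q <= 1 / 2 ->
  (forall j, Cmod (v j * h ^ j) <= K * q ^ j) -> (forall j, (j < n)%nat -> v j = RtoC 0) ->
  forall m, Cmod (partial_sum (fun j => v j * h ^ j)%C (S (n + m)) - v n * h ^ n)
            <= K * (2 * q ^ (S n) - 2 * q ^ (S (n + m))).
Proof.
  intros Hq Hb Hz. induction m as [|m IH].
  - rewrite Nat.add_0_r, partial_sum_S.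
    replace (partial_sum (fun j => v j * h ^ j)%C n) with (RtoC 0).
    + replace (0 + v n * h ^ n - v n * h ^ n)%C with (RtoC 0) by ring. rewrite Cmod_0. lra.
    + clear Hb. induction n as [|n IH]; [reflexivity|].
      rewrite partial_sum_S, <- IH, Hz by (intros; try apply Hz; lia). ring.
  - rewrite Nat.add_succ_r, (partial_sum_S _ (S (n + m))).
    specialize (Hb (S (n + m))).
    set (P := partial_sum _ (S (n + m))) in *.
    replace (P + v (S (n + m)) * h ^ S (n + m) - v n * h ^ n)%C
      with ((P - v n * h ^ n) + v (S (n + m)) * h ^ S (n + m))%C by ring.
    eapply Rle_trans; [apply Cmod_triangle|].
    assert (Kp : 0 <= K * q ^ S (n + m)) by (eapply Rle_trans; [apply Cmod_ge_0|exact Hb]).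
    change (q ^ S (S (n + m))) with (q * q ^ S (n + m)). nra.
Qed.

Lemma pow_div u v n : (u / v) ^ n = u ^ n / v ^ n.
Proof. unfold Rdiv. rewrite Rpow_mult_distr, pow_inv. reflexivity. Qed.

(** A first nonzero coefficient would dominate the rest of the series near the centre,
    in particular at the zeros that accumulate there. *)
Lemma power_series_zero (v : nat -> C) (g : C -> C) (r s0 : R) (e : C) :
  0 < r -> 0 < s0 -> e <> RtoC 0 ->
  (forall h, Cmod h < r -> clim eventually (fun k => partial_sum (fun n => v n * h ^ n)%C (S k)) (g h)) ->
  (forall s, 0 < s < s0 -> g (RtoC s * e)%C = RtoC 0) ->
  forall h, Cmod h < r -> g h = RtoC 0.
Proof.
  intros Hr Hs0 He Hg Hz.
  set (rho := r / 2). assert (rp : 0 < rho) by (unfold rho; lra).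
  destruct (series_terms_bounded _ _ (Hg (RtoC rho)
     ltac:(rewrite Cmod_R, Rabs_right; unfold rho; lra))) as [K HK].
  assert (Bd : forall h j, Cmod (v j * h ^ j) <= K * (Cmod h / rho) ^ j).
  { intros h j. specialize (HK j). rewrite Cmod_mult, Cmod_pow in *.
    rewrite Cmod_R, Rabs_right in HK by lra.
    pose proof (pow_lt rho j rp).
    rewrite pow_div.
    replace (Cmod (v j) * Cmod h ^ j) with ((Cmod (v j) * rho ^ j) * (Cmod h ^ j / rho ^ j)) by (field; lra).
    apply Rmult_le_compat_r; auto. apply Rdiv_le_0_compat; auto. apply pow_le, Cmod_ge_0. }
  assert (Pe : 0 < Cmod e) by (apply Cmod_gt_0; auto).
  assert (V : forall n, forall j, (j < n)%nat -> v j = RtoC 0).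
  { induction n as [|n IH]; intros j Hj; [lia|].
    destruct (Nat.eq_dec j n) as [->|]; [|apply IH; lia].
    apply Cmod_eq_0. apply Rle_antisym; [|apply Cmod_ge_0].
    apply le_epsilon. intros eps Heps. rewrite Rplus_0_l.
    assert (K0 : 0 <= K) by (eapply Rle_trans; [apply Cmod_ge_0|apply (HK 0%nat)]).
    set (D := 2 * K * Cmod e / rho ^ (S n)).
    assert (D0 : 0 <= D).
    { unfold D. apply Rdiv_le_0_compat; [|apply pow_lt; auto]. nra. }
    (* small enough for h to be a zero of g, for q <= 1/2 and for D s <= eps *)
    set (s := Rmin (s0 / 2) (Rmin (rho / 2 / Cmod e) (eps / (D + 1)))).
    assert (s1 : s <= s0 / 2) by apply Rmin_l.
    assert (s2 : s <= rho / 2 / Cmod e) by (eapply Rle_trans; [apply Rmin_r|apply Rmin_l]).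
    assert (s3 : s <= eps / (D + 1)) by (eapply Rle_trans; [apply Rmin_r|apply Rmin_r]).
    assert (sp : 0 < s).
    { unfold s. repeat apply Rmin_glb_lt; [lra| |]; repeat apply Rdiv_lt_0_compat; lra. }
    set (h := (RtoC s * e)%C).
    assert (Hh : Cmod h = s * Cmod e) by (unfold h; rewrite Cmod_mult, Cmod_R, Rabs_right; lra).
    assert (Hh1 : Cmod h <= rho / 2).
    { rewrite Hh. replace (rho / 2) with (rho / 2 / Cmod e * Cmod e) by (field; lra).
      apply Rmult_le_compat_r; lra. }
    assert (Hh2 : Cmod h < r) by (unfold rho in *; lra).
    set (q := Cmod h / rho).
    assert (Hq : 0 <= q <= 1 / 2).
    { unfold q. split; [apply Rdiv_le_0_compat; [apply Cmod_ge_0|auto]|].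
      apply Rmult_le_reg_r with rho; auto. unfold Rdiv at 1. rewrite Rmult_assoc, Rinv_l by lra. lra. }
    pose proof (Hg h Hh2) as L. unfold h in L at 2. rewrite Hz in L by lra. fold h in L.
    assert (LB : Cmod (0 - v n * h ^ n) <= K * (2 * q ^ (S n))).
    { apply (clim_Cmod_le eventually
        (fun k => partial_sum (fun j => v j * h ^ j)%C (S k) - v n * h ^ n)%C _
        (fun _ => K * (2 * q ^ (S n)))).
      - apply clim_minus; [typeclasses eauto|exact L|apply clim_const; typeclasses eauto].
      - apply filterlim_const.
      - exists n. intros k Hk. replace k with (n + (k - n))%nat by lia.
        eapply Rle_trans; [apply (geometric_tail v h K q n Hq (Bd h) IH)|].
        apply Rmult_le_compat_l; auto.
        pose proof (pow_le q (S (n + (k - n))) ltac:(lra)). lra. }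
    replace (0 - v n * h ^ n)%C with (- (v n * h ^ n))%C in LB by ring.
    rewrite Cmod_opp, Cmod_mult, Cmod_pow in LB.
    assert (Ph : 0 < Cmod h) by (rewrite Hh; apply Rmult_lt_0_compat; auto).
    pose proof (pow_lt _ n Ph) as Phn.
    assert (R1 : Cmod (v n) <= D * s).
    { apply Rmult_le_reg_r with (Cmod h ^ n); auto.
      eapply Rle_trans; [exact LB|]. right. unfold D, q.
      rewrite pow_div. simpl. rewrite Hh. field. 
      split; [apply Rgt_not_eq, pow_lt; auto|lra]. }
    eapply Rle_trans; [exact R1|].
    apply Rle_trans with (D * (eps / (D + 1))); [apply Rmult_le_compat_l; auto|].
    replace eps with ((D + 1) * (eps / (D + 1))) at 2 by (field; lra).
    assert (0 < eps / (D + 1)) by (apply Rdiv_lt_0_compat; lra). nra. }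
  intros h Hh. apply (clim_unique eventually _ _ _ (Hg h Hh)).
  eapply clim_ext_loc; [typeclasses eauto| |apply clim_const; typeclasses eauto].
  exists 0%nat. intros k _. symmetry.
  transitivity (partial_sum (fun n => 0 * h ^ n)%C (S k)).
  - apply partial_sum_ext. intros n _. rewrite (V (S n) n) by lia. reflexivity.
  - rewrite (partial_sum_scal 0 (fun n => h ^ n)%C). ring.
Qed.

Lemma slit_plane_scale z t : slit_plane z -> 0 <= t <= 1 -> slit_plane (RtoC t * z).
Proof.
  unfold slit_plane, Re, Im. intros Hz Ht [H1 H2]. simpl in *. apply Hz.
  destruct (Req_dec t 0) as [->|Nt]; [lra|].
  assert (snd z = 0) by nra. split; auto. nra.
Qed.

(** The slit plane is star-shaped about 0, so the supremum of the initial part of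
    the segment from 0 on which two continuations agree is its endpoint. *)
Lemma identity_theorem_slit (f g : C -> C) :
  (forall z, slit_plane z -> analytic_at f z) ->
  (forall z, slit_plane z -> analytic_at g z) ->
  (forall z, Cmod z < 1 -> f z = g z) ->
  forall z, slit_plane z -> f z = g z.
Proof.
  intros Af Ag Hd x Hx.
  destruct (Rlt_dec (Cmod x) 1) as [L|NL]; [auto|].
  set (E := fun t => 0 <= t <= 1 /\ forall s, 0 <= s <= t -> f (RtoC s * x)%C = g (RtoC s * x)%C).
  assert (X0 : 1 <= Cmod x) by lra.
  assert (Nx : x <> RtoC 0) by (intros ->; rewrite Cmod_0 in X0; lra).
  (* t0 x has modulus 1/2, inside the disc where f and g agree *)
  set (t0 := / (2 * Cmod x)).
  assert (t0p : 0 < t0 <= 1 / 2).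
  { unfold t0. split; [apply Rinv_0_lt_compat; lra|].
    replace (1 / 2) with (/ (2 * 1)) by field. apply Rinv_le_contravar; lra. }
  assert (Et0 : E t0).
  { split; [lra|]. intros s Hs. apply Hd. rewrite Cmod_mult, Cmod_R, Rabs_right by lra.
    apply Rle_lt_trans with (t0 * Cmod x); [apply Rmult_le_compat_r; lra|].
    unfold t0. replace (/ (2 * Cmod x) * Cmod x) with (1 / 2) by (field; lra). lra. }
  destruct (completeness E) as [T [T1 T2]].
  { exists 1. intros t [Ht _]. lra. }
  { exists t0. exact Et0. }
  assert (HT : t0 <= T <= 1).
  { split; [apply T1, Et0|]. apply T2. intros t [Ht _]. lra. }
  assert (Below : forall s, 0 <= s < T -> f (RtoC s * x)%C = g (RtoC s * x)%C).
  { intros s Hs. destruct (classic (exists t, E t /\ s < t)) as [(t & [_ Et] & Hst)|N].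
    - apply Et. lra.
    - exfalso. assert (T <= s); [|lra]. apply T2. intros t Et. apply Rnot_lt_le. intro.
      apply N. exists t; auto. }
  pose proof (slit_plane_scale x T Hx ltac:(lra)) as ST.
  destruct (Af _ ST) as (u & r1 & r1p & Hu). destruct (Ag _ ST) as (v & r2 & r2p & Hv).
  set (r := Rmin r1 r2). assert (rp : 0 < r) by (apply Rmin_glb_lt; auto).
  assert (Vanish : forall h, Cmod h < r -> (f (RtoC T * x + h) - g (RtoC T * x + h))%C = RtoC 0).
  { apply (power_series_zero (fun n => u n - v n)%C
      (fun h => f (RtoC T * x + h) - g (RtoC T * x + h))%C r T (- x)%C); auto.
    - lra.
    - intros E0. apply Nx. replace x with (- - x)%C by ring. rewrite E0. ring.
    - intros h Hh. pose proof (Rmin_l r1 r2). pose proof (Rmin_r r1 r2). fold r in H, H0.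
      pose proof (proj1 (is_pseries_clim _ _ _) (Hu h ltac:(lra))) as L1.
      pose proof (proj1 (is_pseries_clim _ _ _) (Hv h ltac:(lra))) as L2.
      eapply clim_ext_loc; [typeclasses eauto| |apply (clim_minus eventually _ _ _ _ L1 L2)].
      exists 0%nat. intros k _.
      induction (S k) as [|m IH]; [simpl; ring|]. rewrite !partial_sum_S, <- IH. ring.
    - intros s Hs. replace (RtoC T * x + RtoC s * - x)%C with (RtoC (T - s) * x)%C
        by (rewrite RtoC_minus; ring).
      rewrite Below by lra. ring. }
  assert (Agree : forall s, 0 <= s -> s < T + r / Cmod x -> f (RtoC s * x)%C = g (RtoC s * x)%C).
  { intros s Hs0 Hs. destruct (Rlt_dec s T) as [L|L]; [apply Below; lra|].
    pose proof (Vanish (RtoC (s - T) * x)%C) as Z.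
    replace (RtoC T * x + RtoC (s - T) * x)%C with (RtoC s * x)%C in Z by (rewrite RtoC_minus; ring).
    rewrite <- (Cplus_0_l (g (RtoC s * x)%C)), <- Z; [ring|].
    rewrite Cmod_mult, Cmod_R, Rabs_right by lra.
    replace r with (r / Cmod x * Cmod x) by (field; lra).
    apply Rmult_lt_compat_r; lra. }
  assert (rx : 0 < r / Cmod x) by (apply Rdiv_lt_0_compat; lra).
  assert (T = 1).
  { apply Rle_antisym; [lra|]. apply Rnot_lt_le. intros L.
    set (T' := Rmin 1 (T + r / Cmod x / 2)).
    assert (T < T') by (apply Rmin_glb_lt; lra).
    assert (T' <= 1) by apply Rmin_l.
    assert (T' <= T + r / Cmod x / 2) by apply Rmin_r.
    assert (T' <= T); [|lra]. apply T1. split; [lra|]. intros s Hs. apply Agree; lra. }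
  specialize (Agree 1 ltac:(lra) ltac:(lra)). replace (RtoC 1 * x)%C with x in Agree by ring.
  exact Agree.
Qed.

Lemma Beta_ratio a d n : 0 < Re a -> 0 < Re d ->
  Beta (a + RtoC (INR n)) d = (poch a n / poch (a + d) n * Beta a d)%C.
Proof.
  intros Ha Hd. pose proof (Beta_poch_l a d n Ha Hd) as E.
  assert (N : poch (a + d) n <> RtoC 0) by (apply poch_neq_0; unfold Re in *; simpl; lra).
  replace (Beta (a + RtoC (INR n)) d)
    with (poch (a + d) n * Beta (a + RtoC (INR n)) d / poch (a + d) n)%C by (field; auto).
  rewrite E. field. auto.
Qed.

Lemma euler_is_principal_2F1 a d b : 0 < Re a -> 0 < Re d ->
  is_principal_2F1 a b (a + d) (fun z => euler_integral a d b z / Beta a d)%C.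
Proof.
  intros Ha Hd. pose proof (Beta_neq_0 a d Ha Hd) as NB. split.
  - intros z Hz. destruct (euler_integral_analytic a d b z Ha Hd Hz) as (r & rp & H).
    exists (fun n => / Beta a d * euler_coef a d b z n)%C, r. split; auto. intros h Hh.
    apply is_pseries_clim.
    replace (euler_integral a d b (z + h) / Beta a d)%C
      with (/ Beta a d * euler_integral a d b (z + h))%C by (unfold Cdiv; ring).
    eapply clim_ext_loc; [typeclasses eauto| |apply (clim_scal eventually _ (/ Beta a d)%C _ (H h Hh))].
    exists 0%nat. intros k _. cbv beta. rewrite <- partial_sum_scal.
    apply partial_sum_ext. intros; ring.
  - intros z Hz. apply is_pseries_clim.
    replace (euler_integral a d b z / Beta a d)%C
      with (/ Beta a d * euler_integral a d b z)%C by (unfold Cdiv; ring).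
    eapply clim_ext_loc; [typeclasses eauto| |
      apply (clim_scal eventually _ (/ Beta a d)%C _ (euler_integral_series a d b z Ha Hd Hz))].
    exists 0%nat. intros k _. cbv beta. rewrite <- partial_sum_scal.
    apply partial_sum_ext. intros n _. rewrite Beta_ratio by auto. unfold bin_coef. field.
    split; [|split; [apply Cfact_neq_0|exact NB]].
    apply poch_neq_0. unfold Re in *; simpl; lra.
Qed.

(** The branch picked by the definition and Euler's integral continue the same
    power series, so they agree on the slit plane. *)
Lemma hyp2F1_euler a d b z : 0 < Re a -> 0 < Re d -> slit_plane z ->
  (hyp2F1 a b (a + d) z * Beta a d)%C = euler_integral a d b z.
Proof.
  intros Ha Hd Hz. pose proof (Beta_neq_0 a d Ha Hd) as NB.
  pose proof (euler_is_principal_2F1 a d b Ha Hd) as P.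
  assert (Q : is_principal_2F1 a b (a + d) (hyp2F1 a b (a + d))).
  { unfold hyp2F1. apply epsilon_spec. exists (fun z => euler_integral a d b z / Beta a d)%C. exact P. }
  rewrite (identity_theorem_slit _ _ (proj1 Q) (proj1 P)); auto.
  - field. auto.
  - intros w Hw. pose proof (proj2 Q w Hw) as S1. pose proof (proj2 P w Hw) as S2.
    apply is_pseries_clim in S1. apply is_pseries_clim in S2.
    exact (clim_unique eventually _ _ _ S1 S2).
Qed.

(** * Euler's integral for the Humbert function *)

Definition humbert_integral (a d b x y : C) : C :=
  nint 0 1 (fun t => beta_weight a d t * (euler_factor b x t * Cexp (RtoC t * y)))%C.

Lemma slit_factor_bound b x : slit_plane x ->
  exists M, 0 < M /\ forall t, 0 <= t <= 1 -> Cmod (euler_factor b x t) <= M.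
Proof.
  intros Hx. destruct (slit_gap x Hx) as (kappa & kp & Gap).
  destruct (power_bound kappa (1 + Cmod x) (- b) kp) as (M & Mp & HM).
  exists M. split; auto. intros t Ht. apply HM; [apply Gap; auto|apply Cmod_one_minus_le; auto].
Qed.

Lemma humbert_integral_series a d b x y : 0 < Re a -> 0 < Re d -> slit_plane x ->
  clim eventually
    (fun k => partial_sum (fun n => y ^ n / Cfact n * euler_integral (a + RtoC (INR n)) d b x)%C (S k))
    (humbert_integral a d b x y).
Proof.
  intros Ha Hd Hx. destruct (slit_factor_bound b x Hx) as (M & Mp & HM).
  assert (Ce : forall t, 0 < t < 1 -> ccontR (euler_factor b x) t).
  { intros t Ht. apply ccontR_Cpower_segment, off_cut_segment; auto; lra. }
  pose proof (nint_beta_series a d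
    (fun n t => euler_factor b x t * (/ Cfact n * (RtoC t * y) ^ n))%C
    (fun t => euler_factor b x t * Cexp (RtoC t * y))%C
    (fun n => M * (Cmod (/ Cfact n) * Cmod y ^ n))
    (fun k => M * (exp (2 * Cmod y) * (Cmod y ^ (S k) / INR (fact k)))) Ha Hd) as L.
  eapply clim_ext_loc; [typeclasses eauto| |apply L]; clear L.
  - exists 0%nat. intros k _. apply partial_sum_ext. intros n _.
    assert (In : is_nint 0 1 (fun t => beta_weight (a + RtoC (INR n)) d t * euler_factor b x t)%C
                   (euler_integral (a + RtoC (INR n)) d b x)).
    { apply (nint_beta_exists _ _ _ M); auto using Re_plus_nat. intros t Ht. apply HM; lra. }
    apply nint_eq; [apply lt_0_1|].
    eapply nint_ext; [|apply (nint_scal 0 1 _ _ (y ^ n / Cfact n)%C lt_0_1 In)].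
    intros t Ht _. cbv beta. rewrite <- beta_weight_shift, Cpow_mult_l by auto.
    unfold Cdiv. ring.
  - intros n t Ht. apply ccontR_mult; [apply Ce, Ht|apply ccontR_scal_pow].
  - intros n t Ht. rewrite !Cmod_mult. apply Rmult_le_compat.
    + apply Cmod_ge_0.
    + apply Rmult_le_pos; apply Cmod_ge_0.
    + apply HM; lra.
    + apply Rmult_le_compat_l; [apply Cmod_ge_0|]. apply RtoC_pow_le, Ht.
  - intros t Ht. apply ccontR_mult; [apply Ce, Ht|]. eapply cder_ccontR.
    apply (hol_Cexp (RtoC t * y)%C (fun t => RtoC t * y)%C); [reflexivity|].
    apply cder_mult; [apply cder_id|apply cder_const].
  - assert (K := exponential_remainder_decay (Cmod y) (Cmod_ge_0 y)).
    apply (is_lim_seq_scal_l _ (exp (2 * Cmod y))) in K. apply (is_lim_seq_scal_l _ M) in K.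
    simpl in K. rewrite !Rmult_0_r in K. exact K.
  - intros k t Ht. rewrite partial_sum_scal.
    pose proof (exponential_remainder (RtoC t * y) k) as R0.
    replace (partial_sum (fun n => / Cfact n * (RtoC t * y) ^ n)%C (S k))
      with (partial_sum (fun n => (RtoC t * y) ^ n / Cfact n)%C (S k))
      by (apply partial_sum_ext; intros; unfold Cdiv; ring).
    set (P := partial_sum _ (S k)) in *.
    replace (euler_factor b x t * Cexp (RtoC t * y) - euler_factor b x t * P)%C
      with (euler_factor b x t * (Cexp (RtoC t * y) - P))%C by ring.
    rewrite Cmod_mult. apply Rmult_le_compat; [apply Cmod_ge_0|apply Cmod_ge_0|apply HM; lra|].
    eapply Rle_trans; [exact R0|].
    assert (B : Cmod (RtoC t * y) <= Cmod y).
    { rewrite Cmod_mult, Cmod_R, Rabs_right by lra. pose proof (Cmod_ge_0 y). nra. }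
    apply Rmult_le_compat.
    + left; apply exp_pos.
    + apply Rdiv_le_0_compat; [apply pow_le, Cmod_ge_0|apply INR_fact_lt_0].
    + apply exp_le. lra.
    + apply Rmult_le_compat_r; [left; apply Rinv_0_lt_compat, INR_fact_lt_0|].
      apply pow_incr. split; [apply Cmod_ge_0|exact B].
Qed.

(** The inner sum in the disc and the continued Gauss function outside of it are both
    Euler integrals with first parameter a + n; summing over n inside the integral
    produces the exponential. *)
Lemma Phi1_humbert_integral a d b x y : 0 < Re a -> 0 < Re d -> slit_plane x ->
  Phi1 a b (a + d) x y = (humbert_integral a d b x y / Beta a d)%C.
Proof.
  intros Ha Hd Hx. pose proof (Beta_neq_0 a d Ha Hd) as NB.
  assert (Nc : forall n, poch (a + d) n <> RtoC 0).
  { intros n. apply poch_neq_0. unfold Re in *; simpl; lra. }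
  assert (L : clim eventually
    (fun k => partial_sum (fun n => y ^ n / Cfact n * (euler_integral (a + RtoC (INR n)) d b x / Beta a d))%C (S k))
    (humbert_integral a d b x y / Beta a d)%C).
  { replace (humbert_integral a d b x y / Beta a d)%C
      with (/ Beta a d * humbert_integral a d b x y)%C by (unfold Cdiv; ring).
    eapply clim_ext_loc; [typeclasses eauto| |
      apply (clim_scal eventually _ (/ Beta a d)%C _ (humbert_integral_series a d b x y Ha Hd Hx))].
    exists 0%nat. intros k _. cbv beta. rewrite <- partial_sum_scal.
    apply partial_sum_ext. intros n _. unfold Cdiv. ring. }
  unfold Phi1. destruct (Rlt_dec (Cmod x) 1) as [Hd1|_].
  - unfold Phi1_double_series. apply CSeries_eq.
    eapply clim_ext_loc; [typeclasses eauto| |exact L].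
    exists 0%nat. intros k _. apply partial_sum_ext. intros n _. symmetry.
    apply CSeries_eq.
    replace (y ^ n / Cfact n * (euler_integral (a + RtoC (INR n)) d b x / Beta a d))%C
      with ((/ Beta a d * (y ^ n / Cfact n)) * euler_integral (a + RtoC (INR n)) d b x)%C
      by (unfold Cdiv; ring).
    eapply clim_ext_loc; [typeclasses eauto| |
      apply (clim_scal eventually _ (/ Beta a d * (y ^ n / Cfact n))%C _
         (euler_integral_series _ d b x (Re_plus_nat a n Ha) Hd Hd1))].
    exists 0%nat. intros j _. cbv beta. rewrite <- partial_sum_scal.
    apply partial_sum_ext. intros m _.
    replace (a + RtoC (INR n) + RtoC (INR m))%C with (a + RtoC (INR (m + n)))%C
      by (rewrite plus_INR, RtoC_plus; ring).
    rewrite Beta_ratio by auto. unfold bin_coef. field.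
    repeat split; auto; apply Cfact_neq_0.
  - unfold Phi1_continuation. apply CSeries_eq.
    eapply clim_ext_loc; [typeclasses eauto| |exact L].
    exists 0%nat. intros k _. apply partial_sum_ext. intros n _. symmetry.
    replace (a + d + RtoC (INR n))%C with (a + RtoC (INR n) + d)%C by ring.
    rewrite <- (hyp2F1_euler (a + RtoC (INR n)) d b x) by auto using Re_plus_nat.
    rewrite Beta_ratio by auto. field. repeat split; auto; apply Cfact_neq_0.
Qed.

(** * Asymptotic expansions along a segment *)

(** The bound is required up to s = 1 and not only near 0, because the remainder is
    integrated over the whole segment; z = s m runs from 0 to m. *)
Definition has_expansion (m : C) (A : R -> C) (c : nat -> C) : Prop :=
  forall N, exists K, forall s, 0 < s <= 1 ->
    Cmod (A s - partial_sum (fun n => c n * (RtoC s * m) ^ n)%C N) <= K * s ^ N.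

Definition convolution (c d : nat -> C) (n : nat) : C :=
  partial_sum (fun k => c k * d (n - k)%nat)%C (S n).

Lemma partial_sum_convolution c d z N :
  partial_sum (fun n => convolution c d n * z ^ n)%C N =
  partial_sum (fun k => c k * z ^ k * partial_sum (fun j => d j * z ^ j) (N - k))%C N.
Proof.
  induction N as [|N IH]; [reflexivity|].
  rewrite partial_sum_S, IH.
  rewrite (partial_sum_S (fun k => c k * z ^ k * partial_sum (fun j => d j * z ^ j) (S N - k))%C).
  replace (S N - N)%nat with 1%nat by lia.
  rewrite (partial_sum_ext (fun k => c k * z ^ k * partial_sum (fun j => d j * z ^ j) (S N - k))%C
    (fun k => c k * z ^ k * partial_sum (fun j => d j * z ^ j) (N - k)
              + z ^ N * (c k * d (N - k)%nat))%C).
  2:{ intros k Hk. replace (S N - k)%nat with (S (N - k)) by lia. rewrite partial_sum_S.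
      replace (z ^ N)%C with (z ^ k * z ^ (N - k))%C
        by (rewrite <- Cpow_add_r; f_equal; lia). ring. }
  rewrite partial_sum_plus, partial_sum_scal. unfold convolution.
  rewrite (partial_sum_S (fun k => c k * d (N - k)%nat)%C), Nat.sub_diag.
  rewrite (partial_sum_S _ 0). simpl partial_sum. simpl Cpow. ring.
Qed.

Lemma partial_sum_bound_exists (f : nat -> R -> C) (g : R -> R) N :
  (forall k, (k < N)%nat -> exists K, forall s, 0 < s <= 1 -> Cmod (f k s) <= K * g s) ->
  exists K, forall s, 0 < s <= 1 -> Cmod (partial_sum (fun k => f k s) N) <= K * g s.
Proof.
  induction N as [|N IH]; intros H.
  - exists 0. intros s _. simpl. rewrite Cmod_0. lra.
  - destruct IH as [K1 H1]; [intros; apply H; lia|].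
    destruct (H N ltac:(lia)) as [K2 H2].
    exists (K1 + K2). intros s Hs. rewrite partial_sum_S.
    eapply Rle_trans; [apply Cmod_triangle|]. specialize (H1 s Hs). specialize (H2 s Hs). lra.
Qed.

(** The error splits into the remainder of A times B and, for each k < N, the term
    c_k z^k times the remainder of B of order N - k. *)
Lemma expansion_mult m A B c d : has_expansion m A c -> has_expansion m B d ->
  has_expansion m (fun s => A s * B s)%C (convolution c d).
Proof.
  intros HA HB N.
  destruct (HB 0%nat) as [K0 H0]. destruct (HA N) as [KA H1].
  destruct (partial_sum_bound_exists
    (fun k s => c k * (RtoC s * m) ^ k
       * (B s - partial_sum (fun j => d j * (RtoC s * m) ^ j) (N - k)))%C (fun s => s ^ N) N)
    as [K2 H2].
  { intros k Hk. destruct (HB (N - k)%nat) as [K HK].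
    exists (Cmod (c k) * Cmod m ^ k * K). intros s Hs. specialize (HK s Hs).
    rewrite !Cmod_mult, Cmod_pow, Cmod_mult, Cmod_R, Rabs_right, Rpow_mult_distr by lra.
    replace (s ^ N) with (s ^ k * s ^ (N - k)) by (rewrite <- pow_add; f_equal; lia).
    pose proof (Cmod_ge_0 (c k)). pose proof (pow_le s k ltac:(lra)).
    pose proof (pow_le (Cmod m) k (Cmod_ge_0 m)).
    replace (Cmod (c k) * Cmod m ^ k * K * (s ^ k * s ^ (N - k)))
      with (Cmod (c k) * (s ^ k * Cmod m ^ k) * (K * s ^ (N - k))) by ring.
    apply Rmult_le_compat_l; auto.
    apply Rmult_le_pos; auto. apply Rmult_le_pos; auto. }
  exists (KA * K0 + K2). intros s Hs.
  specialize (H0 s Hs). specialize (H1 s Hs). specialize (H2 s Hs).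
  rewrite partial_sum_convolution. set (z := (RtoC s * m)%C) in *.
  simpl partial_sum in H0. replace (B s - 0)%C with (B s) in H0 by ring.
  simpl in H0. rewrite Rmult_1_r in H0.
  set (PA := partial_sum (fun n => c n * z ^ n)%C N) in *.
  assert (E : (A s * B s - partial_sum (fun k => c k * z ^ k * partial_sum (fun j => d j * z ^ j) (N - k)) N
     = (A s - PA) * B s
       + partial_sum (fun k => c k * z ^ k * (B s - partial_sum (fun j => d j * z ^ j) (N - k))) N)%C).
  { unfold PA. clear. induction N as [|N _].
    - simpl. ring.
    - generalize (S N). intros M.
      assert (Q : forall L, partial_sum (fun k => c k * z ^ k * (B s - partial_sum (fun j => d j * z ^ j) (M - k)))%C L
         = (B s * partial_sum (fun n => c n * z ^ n) L
            - partial_sum (fun k => c k * z ^ k * partial_sum (fun j => d j * z ^ j) (M - k)) L)%C).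
      { induction L as [|L IH]; [simpl; ring|]. rewrite !partial_sum_S, IH. ring. }
      rewrite Q. ring. }
  rewrite E. eapply Rle_trans; [apply Cmod_triangle|]. rewrite Cmod_mult.
  assert (Cmod (A s - PA) * Cmod (B s) <= KA * s ^ N * K0).
  { apply Rmult_le_compat; auto using Cmod_ge_0. }
  lra.
Qed.

Lemma expansion_power m kappa z e b : 0 < kappa ->
  (forall s, 0 <= s <= 1 -> cut_gap kappa (z - RtoC s * (m * e))) ->
  has_expansion m (fun s => Cpower (z - RtoC s * (m * e)) (- b))
    (fun n => Cpower z (- b) * (bin_coef b n * (e / z) ^ n))%C.
Proof.
  intros kp Gap N.
  set (R0 := Cmod z + Cmod (m * e)).
  destruct (power_bound kappa R0 (- b) kp) as (M1 & M1p & HM1).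
  destruct (power_bound kappa R0 (b - 1) kp) as (M2 & M2p & HM2).
  assert (Bd : forall s, 0 <= s <= 1 -> Cmod (z - RtoC s * (m * e)) <= R0).
  { intros s Hs. eapply Rle_trans; [apply Cmod_minus_le|].
    rewrite Cmod_mult, Cmod_R, Rabs_right by lra. pose proof (Cmod_ge_0 (m * e)). unfold R0. nra. }
  assert (Nz : z <> RtoC 0).
  { apply off_cut_neq_0, (cut_gap_off_cut kappa); auto. specialize (Gap 0 ltac:(lra)).
    replace (z - RtoC 0 * (m * e))%C with z in Gap by ring. exact Gap. }
  assert (Z1 : Cmod (Cpower z (- b)) <= M1).
  { specialize (Gap 0 ltac:(lra)). specialize (Bd 0 ltac:(lra)).
    replace (z - RtoC 0 * (m * e))%C with z in Gap, Bd by ring. auto. }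
  destruct N as [|k].
  { exists M1. intros s Hs. simpl. replace (Cpower (z - RtoC s * (m * e)) (- b) - 0)%C
      with (Cpower (z - RtoC s * (m * e)) (- b)) by ring.
    rewrite Rmult_1_r. apply HM1; [apply Gap; lra|apply Bd; lra]. }
  exists (M1 * M1 * (M2 * R0 * (INR (S k) * Cmod (bin_coef b (S k)) * Cmod (m * e / z) ^ (S k)))).
  intros s Hs.
  pose proof (binomial_remainder_inv z (RtoC s * (m * e)) b (M2 * R0) (M1 * M1) k) as R1.
  replace (partial_sum (fun n => Cpower z (- b) * (bin_coef b n * (e / z) ^ n) * (RtoC s * m) ^ n)%C (S k))
    with (Cpower z (- b) * partial_sum (fun n => bin_coef b n * (RtoC s * (m * e) / z) ^ n) (S k))%C.
  2:{ rewrite <- partial_sum_scal. apply partial_sum_ext. intros n _.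
      replace (RtoC s * (m * e) / z)%C with (e / z * (RtoC s * m))%C by (unfold Cdiv; ring).
      rewrite (Cpow_mult_l (e / z)). ring. }
  assert (In : forall s', 0 <= s' <= 1 -> 0 <= s' * s <= 1) by (intros; nra).
  assert (Eq : forall s', (z - RtoC s' * (RtoC s * (m * e)))%C = (z - RtoC (s' * s) * (m * e))%C)
    by (intros; rewrite RtoC_mult; ring).
  eapply Rle_trans; [apply R1|].
  - intros s' Hs'. rewrite Eq. apply (cut_gap_off_cut kappa); auto.
  - intros s' Hs'. rewrite Eq. apply Rmult_le_compat; auto using Cmod_ge_0.
    unfold R0. pose proof (Cmod_ge_0 (m * e)). lra.
  - apply Rmult_le_compat; auto using Cmod_ge_0. apply HM1; [apply Gap; lra|apply Bd; lra].
  - right. replace (RtoC s * (m * e) / z)%C with (RtoC s * (m * e / z))%C by (unfold Cdiv; ring).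
    rewrite (Cmod_mult (RtoC s)), Cmod_R, Rabs_right by lra.
    rewrite (Rpow_mult_distr s). ring.
Qed.

Lemma expansion_exp m y :
  has_expansion m (fun s => Cexp (RtoC s * m * y)) (fun n => y ^ n / Cfact n)%C.
Proof.
  intros N.
  assert (Bd : forall s, 0 < s <= 1 -> Cmod (RtoC s * m * y) = s * Cmod (m * y)).
  { intros s Hs. rewrite <- Cmult_assoc, Cmod_mult, Cmod_R, Rabs_right by lra. reflexivity. }
  pose proof (Cmod_ge_0 (m * y)) as P.
  destruct N as [|k].
  - exists (exp (Cmod (m * y))). intros s Hs. simpl.
    replace (Cexp (RtoC s * m * y) - 0)%C with (Cexp (RtoC s * m * y)) by ring.
    rewrite Cmod_Cexp, Rmult_1_r. apply exp_le. eapply Rle_trans; [apply Re_le_Cmod'|].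
    rewrite Bd by auto. nra.
  - exists (exp (2 * Cmod (m * y)) * (Cmod (m * y) ^ (S k) / INR (fact k))).
    intros s Hs. pose proof (exponential_remainder (RtoC s * m * y) k) as R0.
    replace (partial_sum (fun n => y ^ n / Cfact n * (RtoC s * m) ^ n)%C (S k))
      with (partial_sum (fun n => (RtoC s * m * y) ^ n / Cfact n)%C (S k)).
    2:{ apply partial_sum_ext. intros n _. rewrite (Cpow_mult_l (RtoC s * m)). unfold Cdiv. ring. }
    eapply Rle_trans; [exact R0|]. rewrite Bd by auto.
    rewrite Rpow_mult_distr. unfold Rdiv.
    rewrite (Rmult_assoc (s ^ S k)), (Rmult_comm (s ^ S k)), <- Rmult_assoc.
    apply Rmult_le_compat_r; [apply pow_le; lra|].
    apply Rmult_le_compat_r.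
    + apply Rmult_le_pos; [apply pow_le, P|left; apply Rinv_0_lt_compat, INR_fact_lt_0].
    + apply exp_le. nra.
Qed.

Lemma partial_sum_uniform_bound (x : nat -> C) N : exists S, 0 <= S /\
  forall (Q : nat -> C) q, 0 <= q -> (forall n, (n < N)%nat -> Cmod (Q n) <= q) ->
    Cmod (partial_sum (fun n => x n * Q n)%C N) <= S * q.
Proof.
  induction N as [|N [S [S0 IH]]].
  - exists 0. split; [lra|]. intros. simpl. rewrite Cmod_0. lra.
  - exists (S + Cmod (x N)). pose proof (Cmod_ge_0 (x N)). split; [lra|].
    intros Q q Hq H1. rewrite partial_sum_S. eapply Rle_trans; [apply Cmod_triangle|].
    specialize (IH Q q Hq ltac:(intros; apply H1; lia)). specialize (H1 N ltac:(lia)).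
    rewrite Cmod_mult. nra.
Qed.

Lemma ray_integrand_bound alpha w s : 0 < s ->
  Cmod (Cpower (RtoC s) (alpha - 1) * Cexp (- (w * RtoC s)))
  = Rpower s (Re alpha - 1) * exp (- (Re w * s)).
Proof.
  intros Hs. rewrite Cmod_mult, Cmod_Cpower_R, Cmod_Cexp by auto.
  replace (Re (alpha - 1)) with (Re alpha - 1) by (unfold Re; simpl; ring).
  replace (Re (- (w * RtoC s))) with (- (Re w * s)) by (unfold Re; simpl; ring).
  reflexivity.
Qed.

(** The arguments of - i lambda and of m have opposite signs, so their sum does not
    cross the cut. *)
Lemma Clog_minus_Ci_mult lambda m : 0 < Re m -> 0 < lambda * Im m ->
  Clog (- (Ci * RtoC lambda) * m) = (Clog (- (Ci * RtoC lambda)) + Clog m)%C.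
Proof.
  intros Hm Hl.
  assert (Om : off_cut m) by (apply off_cut_Re; auto).
  assert (Lm : lambda <> 0) by (intros ->; lra).
  assert (Oi : off_cut (- (Ci * RtoC lambda))).
  { apply off_cut_Im. unfold Im. simpl. lra. }
  apply Clog_mult; auto.
  assert (Ri : Re (- (Ci * RtoC lambda)) = 0) by (unfold Re; simpl; ring).
  assert (Ii : Im (- (Ci * RtoC lambda)) = - lambda) by (unfold Im; simpl; ring).
  assert (Mi : Cmod (- (Ci * RtoC lambda)) = Rabs lambda).
  { rewrite Cmod_opp, Cmod_mult, Cmod_Ci, Cmod_R. ring. }
  rewrite (Carg_off_cut _ Oi), (Carg_off_cut _ Om), Ri, Ii, Mi.
  pose proof (Re_le_Cmod' m) as Pm.
  set (q := Im m / (Cmod m + Re m)).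
  assert (Hq : 0 < lambda * q).
  { unfold q. replace (lambda * (Im m / (Cmod m + Re m))) with (lambda * Im m * / (Cmod m + Re m))
      by (field; lra).
    apply Rmult_lt_0_compat; auto. apply Rinv_0_lt_compat. lra. }
  pose proof (atan_bound q) as [B1 B2]. pose proof atan_1 as A1.
  destruct (Rlt_dec 0 lambda) as [P|P].
  - rewrite Rabs_right by lra.
    replace (- lambda / (lambda + 0)) with (- (1)) by (field; lra). rewrite atan_opp, A1.
    assert (0 < q) by nra. pose proof (atan_increasing 0 q ltac:(lra)). rewrite atan_0 in *. lra.
  - rewrite Rabs_left by lra.
    replace (- lambda / (- lambda + 0)) with 1 by (field; lra). rewrite A1.
    assert (q < 0) by nra. pose proof (atan_increasing q 0 ltac:(lra)). rewrite atan_0 in *. lra.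
Qed.

(** Watson's lemma along a segment that leaves 0 into the half-plane where
    e^(i lambda z) decays.  Completing each term to the full ray costs no more than
    the error term, since s^(alpha+n-1) increases with n for s >= 1. *)
Lemma watson (alpha m : C) (A : R -> C) (c : nat -> C) (N : nat) :
  0 < Re alpha -> 0 < Re m -> Im m <> 0 -> has_expansion m A c ->
  exists K, 0 <= K /\ forall lambda J, 0 < lambda * Im m ->
    is_nint 0 1 (fun s => m * Cpower (RtoC s * m) (alpha - 1) * A s
                          * Cexp (Ci * RtoC lambda * (RtoC s * m)))%C J ->
    Cmod (J - partial_sum (fun n => c n * CGamma (alpha + RtoC (INR n))
                 * Cpower (- (Ci * RtoC lambda)) (- alpha - RtoC (INR n)))%C N)
    <= K * Rpower (Rabs lambda) (- Re alpha - INR N).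
Proof.
  intros Ha Hm Him HA.
  assert (Om : off_cut m) by (apply off_cut_Re; auto).
  pose proof (off_cut_neq_0 m Om) as Nm.
  destruct (HA N) as [KA HKA].
  assert (KA0 : 0 <= KA).
  { specialize (HKA 1 ltac:(lra)). rewrite pow1, Rmult_1_r in HKA.
    eapply Rle_trans; [apply Cmod_ge_0|exact HKA]. }
  set (rho := Re alpha + INR N). pose proof (pos_INR N) as N0.
  assert (rp : 0 < rho) by (unfold rho; lra).
  set (x := fun n => (c n * (Cpower m alpha * m ^ n))%C).
  destruct (partial_sum_uniform_bound x N) as (S & S0 & HS).
  set (g0 := GammaR rho). assert (g0p : 0 < g0) by (apply GammaR_pos; auto).
  assert (Ip : 0 < Rabs (Im m)) by (apply Rabs_pos_lt; auto).
  set (M := Cmod (Cpower m alpha)). assert (M0 : 0 <= M) by apply Cmod_ge_0.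
  exists ((M * KA + S) * (g0 * Rpower (Rabs (Im m)) (- rho))). split.
  { apply Rmult_le_pos; [nra|]. apply Rmult_le_pos; [lra|left; apply Rpower_pos]. }
  intros lambda J Hl HJ.
  assert (Lm : lambda <> 0) by (intros ->; lra).
  assert (Lp : 0 < Rabs lambda) by (apply Rabs_pos_lt; auto).
  set (w := (- (Ci * RtoC lambda) * m)%C).
  assert (Rw : Re w = Rabs lambda * Rabs (Im m)).
  { rewrite <- Rabs_mult, Rabs_right by lra. unfold w, Re, Im. simpl. ring. }
  assert (Wp : 0 < Re w) by (rewrite Rw; apply Rmult_lt_0_compat; auto).
  pose proof (off_cut_Re w Wp) as Ow.
  set (q := g0 * Rpower (Re w) (- rho)).
  assert (q0 : 0 <= q) by (apply Rmult_le_pos; [lra|left; apply Rpower_pos]).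
  assert (Eq : q = g0 * Rpower (Rabs (Im m)) (- rho) * Rpower (Rabs lambda) (- Re alpha - INR N)).
  { unfold q. rewrite Rw. rewrite <- Rpower_mult_distr by auto.
    replace (- Re alpha - INR N) with (- rho) by (unfold rho; ring). ring. }
  set (f := fun n s => (Cpower (RtoC s) (alpha + RtoC (INR n) - 1) * Cexp (- (w * RtoC s)))%C).
  assert (HI : forall n, is_nint 0 p_infty (f n)
      (CGamma (alpha + RtoC (INR n)) * Cpower w (- (alpha + RtoC (INR n))))%C).
  { intros n. apply nint_Gamma_ray; auto using Re_plus_nat. }
  assert (HP : forall n, is_nint 0 1 (f n) (nint 0 1 (f n))).
  { intros n. destruct (nint_restrict_l 0 1 p_infty _ _ ltac:(lra) I (HI n)) as [l Hl'].
    eapply nint_correct; eauto. }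
  assert (HQ : forall n, is_nint 1 p_infty (f n) (nint 1 p_infty (f n))).
  { intros n. destruct (nint_restrict_r 0 1 p_infty _ _ ltac:(lra) I (HI n)) as [l Hl'].
    eapply nint_correct; eauto. }
  pose proof (nint_GammaR rho (Re w) rp Wp) as GR. fold g0 q in GR.
  assert (Pos : forall t, 0 < t -> 0 <= Rpower t (rho - 1) * exp (- (Re w * t))).
  { intros t _. apply Rmult_le_pos; left; [apply Rpower_pos|apply exp_pos]. }
  assert (BQ : forall n, (n < N)%nat -> Cmod (nint 1 p_infty (f n)) <= q).
  { intros n Hn. apply (proj2 (nint_bound_sub (f n) _ _ _ GR Pos) (HQ n)).
    intros t Ht. unfold f. rewrite ray_integrand_bound by lra.
    apply Rmult_le_compat_r; [left; apply exp_pos|]. apply Rle_Rpower; [lra|].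
    assert (INR n <= INR N) by (apply le_INR; lia). unfold rho, Re in *. simpl. lra. }
  (* on the segment the factor s^N of the remainder raises the exponent to rho - 1 *)
  assert (BD : Cmod (J - partial_sum (fun n => x n * nint 0 1 (f n)) N)%C <= M * KA * q).
  { assert (GR2 : is_nint 0 p_infty (fun t => RtoC (M * KA * (Rpower t (rho - 1) * exp (- (Re w * t)))))
                    (RtoC (M * KA * q))).
    { rewrite RtoC_mult. eapply nint_ext; [|apply (nint_scal 0 p_infty _ _ (RtoC (M * KA)) I GR)].
      intros; symmetry; apply RtoC_mult. }
    pose proof (nint_partial_sum 0 1 _ _ N lt_0_1
      (fun n => nint_scal 0 1 _ _ (x n) lt_0_1 (HP n))) as HPS.
    pose proof (nint_minus 0 1 _ _ _ _ lt_0_1 HJ HPS) as HD.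
    apply (proj1 (nint_bound_sub _ _ _ _ GR2
      (fun t Ht => Rmult_le_pos _ _ (Rmult_le_pos _ _ M0 KA0) (Pos t Ht))) HD).
    intros s Hs. cbv beta.
    replace (m * Cpower (RtoC s * m) (alpha - 1) * A s * Cexp (Ci * RtoC lambda * (RtoC s * m))
       - partial_sum (fun n => x n * f n s) N)%C
      with (Cpower m alpha * (Cpower (RtoC s) (alpha - 1) * Cexp (- (w * RtoC s))) *
            (A s - partial_sum (fun n => c n * (RtoC s * m) ^ n) N))%C.
    2:{ replace (Ci * RtoC lambda * (RtoC s * m))%C with (- (w * RtoC s))%C by (unfold w; ring).
        rewrite Cpower_scale by (auto; lra). rewrite (Cpower_minus_1 m) by auto.
        replace (partial_sum (fun n => x n * f n s)%C N)
          with (Cpower m alpha * (Cpower (RtoC s) (alpha - 1) * Cexp (- (w * RtoC s))) *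
                partial_sum (fun n => c n * (RtoC s * m) ^ n) N)%C.
        - field. auto.
        - rewrite <- partial_sum_scal. apply partial_sum_ext. intros n _. unfold x, f.
          replace (alpha + RtoC (INR n) - 1)%C with (alpha - 1 + RtoC (INR n))%C by ring.
          rewrite Cpower_plus_nat by (apply RtoC_neq_0; lra). rewrite Cpow_mult_l. ring. }
    rewrite !Cmod_mult. rewrite <- (Cmod_mult (Cpower (RtoC s) (alpha - 1))).
    rewrite ray_integrand_bound by lra. fold M.
    specialize (HKA s ltac:(lra)).
    replace (M * KA * (Rpower s (rho - 1) * exp (- (Re w * s))))
      with (M * (Rpower s (Re alpha - 1) * exp (- (Re w * s))) * (KA * s ^ N)).
    - apply Rmult_le_compat_l; auto. apply Rmult_le_pos; auto.
      apply Rmult_le_pos; left; [apply Rpower_pos|apply exp_pos].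
    - replace (rho - 1) with (Re alpha - 1 + INR N) by (unfold rho; ring).
      rewrite Rpower_plus, Rpower_pow by lra. ring. }
  pose proof (HS (fun n => nint 1 p_infty (f n)) q q0 BQ) as BS.
  replace (J - partial_sum (fun n => c n * CGamma (alpha + RtoC (INR n))
        * Cpower (- (Ci * RtoC lambda)) (- alpha - RtoC (INR n))) N)%C
    with ((J - partial_sum (fun n => x n * nint 0 1 (f n)) N)
          - partial_sum (fun n => x n * nint 1 p_infty (f n)) N)%C.
  - eapply Rle_trans; [apply Cmod_minus_le|].
    replace ((M * KA + S) * (g0 * Rpower (Rabs (Im m)) (- rho)) * Rpower (Rabs lambda) (- Re alpha - INR N))
      with (M * KA * q + S * q) by (rewrite Eq; ring).
    lra.
  - assert (E : forall n, (c n * CGamma (alpha + RtoC (INR n))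
        * Cpower (- (Ci * RtoC lambda)) (- alpha - RtoC (INR n)))%C
        = (x n * nint 0 1 (f n) + x n * nint 1 p_infty (f n))%C).
    { intros n. rewrite <- Cmult_plus_distr_l.
      rewrite <- (nint_split 0 1 p_infty _ _ _ _ ltac:(lra) I (HI n) (HP n) (HQ n)).
      unfold x. rewrite <- Cpower_plus_nat by auto.
      set (bn := (alpha + RtoC (INR n))%C).
      replace (- alpha - RtoC (INR n))%C with (- bn)%C by (unfold bn; ring).
      assert (W : Cpower w (- bn) = (Cpower (- (Ci * RtoC lambda)) (- bn) * Cpower m (- bn))%C).
      { unfold Cpower, w. rewrite Clog_minus_Ci_mult by auto. rewrite <- Cexp_plus. f_equal. ring. }
      rewrite W, (Cpower_opp m bn). field. apply Cpower_neq_0. }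
    rewrite (partial_sum_ext _ _ N (fun n _ => E n)), partial_sum_plus. ring.
Qed.

(** * Deforming the interval into two segments *)

Lemma clim_0_power_bound (F : R -> C) K alpha : 0 < alpha ->
  at_right 0 (fun t => Cmod (F t) <= K * Rpower t alpha) -> clim (at_right 0) F 0%C.
Proof.
  intros Ha H eps He.
  set (e := eps / (Rabs K + 1)). pose proof (Rabs_pos K) as K0.
  assert (e0 : 0 < e) by (apply Rdiv_lt_0_compat; lra).
  generalize (filter_and _ _ H (at_right_0_lt _ (exp_pos (/ alpha * ln e)))). apply filter_imp.
  intros t [A [Ht1 Ht2]]. replace (F t - 0)%C with (F t) by ring.
  pose proof (Rpower_small t alpha e Ha e0 (conj Ht1 Ht2)).
  pose proof (Rpower_pos t alpha). pose proof (Rle_abs K).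
  replace eps with ((Rabs K + 1) * e) by (unfold e; field; lra). nra.
Qed.

(** The rays through 1 and m are joined by segments of length O(t), on which the
    integrand is O(t^(alpha-1)). *)
Lemma corner_limit (P V : C -> C) (m : C) (alpha K : R) (l : C) : 0 < alpha -> 0 <= K ->
  (forall t u, 0 < t < 1 / 2 -> 0 <= u <= 1 ->
     cder (fun u => P (RtoC t + RtoC u * (RtoC t * (m - 1)))%C) u
       (RtoC t * (m - 1) * V (RtoC t + RtoC u * (RtoC t * (m - 1))))%C /\
     Cmod (V (RtoC t + RtoC u * (RtoC t * (m - 1)))%C) <= K * Rpower t (alpha - 1)) ->
  clim (at_right 0) (fun t => P (RtoC t)) l ->
  clim (at_right 0) (fun t => P (RtoC t * m)%C) l.
Proof.
  intros Ha HK H L. apply (clim_close _ _ (fun t => P (RtoC t))); auto.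
  apply (clim_0_power_bound _ (Cmod (m - 1) * K) alpha Ha).
  generalize (at_right_0_lt (1 / 2) ltac:(lra)). apply filter_imp. intros t Ht.
  set (Kt := Cmod (m - 1) * K * Rpower t alpha).
  pose proof (mean_value_bound (fun u => P (RtoC t + RtoC u * (RtoC t * (m - 1)))%C)
    (fun u => RtoC t * (m - 1) * V (RtoC t + RtoC u * (RtoC t * (m - 1))))%C Kt) as MV.
  cbv beta in MV.
  replace (RtoC t + RtoC 1 * (RtoC t * (m - 1)))%C with (RtoC t * m)%C in MV by ring.
  replace (RtoC t + RtoC 0 * (RtoC t * (m - 1)))%C with (RtoC t) in MV by ring.
  apply MV.
  - intros u Hu. apply H; auto.
  - intros u Hu. destruct (H t u Ht Hu) as [_ B].
    rewrite !Cmod_mult, Cmod_R, Rabs_right by lra.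
    replace Kt with (t * Cmod (m - 1) * (K * Rpower t (alpha - 1))).
    + apply Rmult_le_compat_l; auto. apply Rmult_le_pos; [lra|apply Cmod_ge_0].
    + unfold Kt. replace alpha with (1 + (alpha - 1)) at 2 by ring.
      rewrite Rpower_plus, Rpower_1 by lra. ring.
Qed.

(** The integrand near 0 and, after the reflection of the unit interval, near 1:
    p = 1, e = x and p = 1 - x, e = - x respectively. *)
Definition corner_integrand (a d b p e Y z : C) : C :=
  (Cpower z (a - 1) * (Cpower (1 - z) (d - 1) * Cpower (p - z * e) (- b) * Cexp (z * Y)))%C.

Definition rectangle (delta : R) (z : C) : Prop := 0 < Re z < 1 /\ Rabs (Im z) < 2 * delta.

Lemma corner_integrand_bound a d b p e Y kappa delta : 0 < kappa -> 0 < delta <= 1 ->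
  (forall z, rectangle delta z -> cut_gap kappa (p - z * e)) ->
  exists K, 0 <= K /\ forall t mu, 0 < t < 1 / 2 -> 1 / 2 <= Re mu <= 1 -> Rabs (Im mu) < 2 * delta ->
    Cmod (corner_integrand a d b p e Y (RtoC t * mu)) <= K * Rpower t (Re a - 1).
Proof.
  intros kp Hd Gap.
  destruct (power_bound (1 / 2) 3 (a - 1) ltac:(lra)) as (M1 & M1p & HM1).
  destruct (power_bound (1 / 2) 4 (d - 1) ltac:(lra)) as (M2 & M2p & HM2).
  destruct (power_bound kappa (Cmod p + 3 * Cmod e) (- b) kp) as (M3 & M3p & HM3).
  exists (M1 * (M2 * M3 * exp (3 * Cmod Y))). split.
  { pose proof (exp_pos (3 * Cmod Y)). assert (0 < M2 * M3) by (apply Rmult_lt_0_compat; auto).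
    left. apply Rmult_lt_0_compat; auto. apply Rmult_lt_0_compat; auto. }
  intros t mu Ht Hmu Him.
  assert (Cm : Cmod mu <= 3).
  { eapply Rle_trans; [apply Cmod_le_abs|]. fold (Re mu) (Im mu). rewrite (Rabs_right (Re mu)); lra. }
  assert (Ctm : Cmod (RtoC t * mu) <= 3).
  { rewrite Cmod_mult, Cmod_R, Rabs_right by lra. pose proof (Cmod_ge_0 mu). nra. }
  assert (Rtm : Re (RtoC t * mu) = t * Re mu) by (unfold Re; simpl; ring).
  assert (Itm : Im (RtoC t * mu) = t * Im mu) by (unfold Im; simpl; ring).
  assert (Rect : rectangle delta (RtoC t * mu)).
  { split; rewrite ?Rtm, ?Itm; [nra|]. rewrite Rabs_mult, Rabs_right by lra.
    pose proof (Rabs_pos (Im mu)). nra. }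
  unfold corner_integrand.
  assert (Omu : off_cut mu) by (apply off_cut_Re; lra).
  rewrite Cpower_scale by (auto; lra). rewrite !Cmod_mult, Cmod_Cpower_R by lra.
  replace (Re (a - 1)) with (Re a - 1) by (unfold Re; simpl; ring).
  assert (B1 : Cmod (Cpower mu (a - 1)) <= M1).
  { apply HM1; auto. unfold cut_gap. pose proof (Cmod_ge_0 mu). lra. }
  assert (B2 : Cmod (Cpower (1 - RtoC t * mu) (d - 1)) <= M2).
  { apply HM2.
    - unfold cut_gap. pose proof (Cmod_ge_0 (1 - RtoC t * mu)).
      assert (Re (1 - RtoC t * mu) = 1 - t * Re mu) by (unfold Re; simpl; ring). nra.
    - eapply Rle_trans; [apply Cmod_minus_le|]. rewrite Cmod_1. lra. }
  assert (B3 : Cmod (Cpower (p - RtoC t * mu * e) (- b)) <= M3).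
  { apply HM3; [apply Gap, Rect|].
    eapply Rle_trans; [apply Cmod_minus_le|]. rewrite Cmod_mult.
    pose proof (Cmod_ge_0 e). nra. }
  assert (B4 : Cmod (Cexp (RtoC t * mu * Y)) <= exp (3 * Cmod Y)).
  { rewrite Cmod_Cexp. apply exp_le. eapply Rle_trans; [apply Re_le_Cmod'|].
    rewrite Cmod_mult. pose proof (Cmod_ge_0 Y). nra. }
  pose proof (Rpower_pos t (Re a - 1)).
  replace (M1 * (M2 * M3 * exp (3 * Cmod Y)) * Rpower t (Re a - 1))
    with (Rpower t (Re a - 1) * M1 * (M2 * M3 * exp (3 * Cmod Y))) by ring.
  assert (forall u : C, 0 <= Cmod u) by (intros; apply Cmod_ge_0).
  apply Rmult_le_compat; auto.
  - apply Rmult_le_pos; auto; lra.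
  - apply Rmult_le_pos; auto. apply Rmult_le_pos; auto.
  - apply Rmult_le_compat_l; auto; lra.
  - apply Rmult_le_compat; auto.
    + apply Rmult_le_pos; auto.
    + apply Rmult_le_compat; auto.
Qed.

(** Written as the exponential of a sum of logarithms, the integrand has a derivative
    that is visibly continuous. *)
Lemma corner_integrand_primitive a d b x Y kappa delta : 0 < kappa -> 0 < delta ->
  (forall z, rectangle delta z -> cut_gap kappa (1 - z * x)) ->
  exists P : C -> C, forall (p q : C) (t : R), rectangle delta (p + RtoC t * q)%C ->
    cder (fun u => P (p + RtoC u * q)%C) t
      (q * corner_integrand a d b 1 x Y (p + RtoC t * q))%C.
Proof.
  intros kp Hd Gap.
  set (phi := fun z => ((a - 1) * Clog z + ((d - 1) * Clog (1 - z) + (- b * Clog (1 - z * x) + z * Y)))%C).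
  set (phi' := fun z => ((a - 1) * / z + ((d - 1) * (/ (1 - z) * (0 - 1))
      + (- b * (/ (1 - z * x) * (0 - (1 * x + z * 0))) + (1 * Y + z * 0))))%C).
  assert (EG : forall z, corner_integrand a d b 1 x Y z = Cexp (phi z)).
  { intros z. unfold corner_integrand, phi, Cpower. rewrite !Cexp_plus. ring. }
  destruct (star_primitive (rectangle delta) (RtoC (1 / 2)) (fun z => Cexp (phi z))
    (fun z => Cexp (phi z) * phi' z)%C) as [P HP].
  - intros z [[H1 H2] H3].
    exists (Rmin (Rmin (Re z) (1 - Re z)) (2 * delta - Rabs (Im z))). split.
    { repeat apply Rmin_glb_lt; lra. }
    intros w Hw.
    pose proof (Rmin_l (Rmin (Re z) (1 - Re z)) (2 * delta - Rabs (Im z))).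
    pose proof (Rmin_r (Rmin (Re z) (1 - Re z)) (2 * delta - Rabs (Im z))).
    pose proof (Rmin_l (Re z) (1 - Re z)). pose proof (Rmin_r (Re z) (1 - Re z)).
    pose proof (fst_le_Cmod (w - z)) as B. simpl in B. apply Rabs_le_between in B.
    pose proof (snd_le_Cmod (w - z)) as B'. simpl in B'.
    pose proof (Rabs_triang (Im z) (Im w - Im z)) as T.
    replace (Im z + (Im w - Im z)) with (Im w) in T by ring.
    unfold rectangle, Re, Im, Rminus in *. lra.
  - intros z s [[H1 H2] H3] Hs. split.
    + unfold Re in *. simpl. nra.
    + replace (Im (RtoC (1 / 2) + RtoC s * (z - RtoC (1 / 2)))) with (s * Im z) by (unfold Im; simpl; ring).
      rewrite Rabs_mult, Rabs_right by lra. pose proof (Rabs_pos (Im z)). nra.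
  - intros z Hz. pose proof Hz as [[H1 H2] H3].
    assert (O1 : off_cut z) by (apply off_cut_Re; auto).
    assert (O2 : off_cut (1 - z)) by (apply off_cut_Re; unfold Re in *; simpl; lra).
    assert (O3 : off_cut (1 - z * x)) by (apply (cut_gap_off_cut kappa); auto).
    assert (C1 : ccont (fun z => 1 - z)%C z) by (apply ccont_minus; [apply ccont_const|apply ccont_id]).
    assert (C2 : ccont (fun z => 1 - z * x)%C z).
    { apply ccont_minus; [apply ccont_const|]. apply ccont_mult; [apply ccont_id|apply ccont_const]. }
    assert (Cphi : ccont phi z).
    { unfold phi. repeat apply ccont_plus; apply ccont_mult; try apply ccont_const; try apply ccont_id.
      - apply ccont_Clog, O1.
      - apply (ccont_comp Clog); [apply ccont_Clog, O2|exact C1].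
      - apply (ccont_comp Clog); [apply ccont_Clog, O3|exact C2]. }
    assert (Cphi' : ccont phi' z).
    { unfold phi'. apply ccont_plus; [|apply ccont_plus; [|apply ccont_plus]].
      - apply ccont_mult; [apply ccont_const|apply ccont_Cinv, off_cut_neq_0, O1].
      - apply ccont_mult; [apply ccont_const|]. apply ccont_mult; [|apply ccont_const].
        apply (ccont_comp Cinv); [apply ccont_Cinv, off_cut_neq_0, O2|exact C1].
      - apply ccont_mult; [apply ccont_const|]. apply ccont_mult.
        + apply (ccont_comp Cinv); [apply ccont_Cinv, off_cut_neq_0, O3|exact C2].
        + apply ccont_minus; [apply ccont_const|]. apply ccont_plus; [apply ccont_const|].
          apply ccont_mult; [apply ccont_id|apply ccont_const].
      - apply ccont_plus; [apply ccont_const|]. apply ccont_mult; [apply ccont_id|apply ccont_const]. }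
    assert (Cexpphi : ccont (fun z => Cexp (phi z)) z).
    { apply (ccont_comp Cexp); [apply ccont_Cexp|exact Cphi]. }
    split; [|split; [exact Cexpphi|apply ccont_mult; auto]].
    apply (hol_comp Cexp phi); [apply hol_Cexp|].
    unfold phi, phi'. apply hol_plus; [|apply hol_plus; [|apply hol_plus]].
    + apply hol_scal, hol_Clog, O1.
    + apply hol_scal. apply (hol_comp Clog (fun z => 1 - z)%C); [apply hol_Clog, O2|].
      apply hol_minus; [apply hol_const|apply hol_id].
    + apply hol_scal. apply (hol_comp Clog (fun z => 1 - z * x)%C); [apply hol_Clog, O3|].
      apply hol_minus; [apply hol_const|].
      apply hol_mult; [apply hol_id|apply hol_const].
    + apply hol_mult; [apply hol_id|apply hol_const].
  - exists P. intros p q t H. rewrite EG. apply HP, H.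
Qed.

Definition apex (v : R) : C := (1 / 2, v)%R.

Lemma corner_reflect a d b x Y z :
  corner_integrand a d b 1 x Y (1 - z) =
  (Cexp Y * corner_integrand d a b (1 - x) (- x) (- Y) z)%C.
Proof.
  unfold corner_integrand.
  replace (1 - (1 - z))%C with z by ring.
  replace (1 - (1 - z) * x)%C with (1 - x - z * - x)%C by ring.
  replace (Cexp ((1 - z) * Y)) with (Cexp Y * Cexp (z * - Y))%C
    by (rewrite <- Cexp_plus; f_equal; ring).
  ring.
Qed.

(** The primitive lives on a thin rectangle, which contains the open interval and the
    sides of the triangle over it but not the corners 0 and 1.  Its limits at a corner
    along the interval and along the side coincide, so the increments agree. *)
Lemma humbert_integral_deformed a d b x Y kappa delta v :
  0 < Re a -> 0 < Re d -> slit_plane x -> 0 < kappa -> 0 < delta <= 1 ->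
  (forall z, rectangle delta z -> cut_gap kappa (1 - z * x)) -> Rabs v <= delta ->
  exists J1 J2,
    is_nint 0 1 (fun s => apex v * corner_integrand a d b 1 x Y (RtoC s * apex v))%C J1 /\
    is_nint 0 1 (fun s => apex (- v) * corner_integrand d a b (1 - x) (- x) (- Y) (RtoC s * apex (- v)))%C J2 /\
    humbert_integral a d b x Y = (J1 + Cexp Y * J2)%C.
Proof.
  intros Ha Hd Hx kp Hdel Gap Hv.
  set (m := apex v). set (m' := apex (- v)).
  assert (Em : (1 - m')%C = m) by (apply C_ext; unfold m, m', apex; simpl; lra).
  destruct (corner_integrand_primitive a d b x Y kappa delta kp ltac:(lra) Gap) as [P HP].
  set (G := corner_integrand a d b 1 x Y) in *.
  assert (HI : is_nint 0 1 (fun t => G (RtoC t)) (humbert_integral a d b x Y)).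
  { destruct (slit_factor_bound b x Hx) as (M & Mp & HM).
    eapply nint_ext; [|apply (nint_beta_exists a d _ (M * exp (Cmod Y)) Ha Hd)].
    - intros t _ _. unfold G, corner_integrand, beta_weight, euler_factor.
      rewrite RtoC_minus. ring.
    - intros t Ht. apply ccontR_mult.
      + apply ccontR_Cpower_segment, off_cut_segment; auto; lra.
      + eapply cder_ccontR.
        apply (hol_Cexp (RtoC t * Y)%C (fun t => RtoC t * Y)%C); [reflexivity|].
        apply cder_mult; [apply cder_id|apply cder_const].
    - intros t Ht. rewrite Cmod_mult, Cmod_Cexp.
      apply Rmult_le_compat; [apply Cmod_ge_0|left; apply exp_pos|apply HM; lra|].
      apply exp_le. eapply Rle_trans; [apply Re_le_Cmod'|].
      rewrite Cmod_mult, Cmod_R, Rabs_right by lra. pose proof (Cmod_ge_0 Y). nra. }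
  assert (Rect : forall (p q : C) (t r i : R), (p + RtoC t * q)%C = (r, i) -> 0 < r < 1 ->
    Rabs i < 2 * delta -> rectangle delta (p + RtoC t * q)%C).
  { intros p q t r i -> Hr Hi. split; auto. }
  assert (Rr : forall t, 0 < t < 1 -> cder (fun s => P (RtoC s)) t (G (RtoC t))).
  { intros t Ht. assert (E : (0 + RtoC t * 1)%C = (t, 0)) by (apply C_ext; simpl; ring).
    pose proof (HP 0%C 1%C t (Rect _ _ _ _ _ E Ht ltac:(rewrite Rabs_R0; lra))) as D.
    eapply cder_val; [eapply cder_ext; [|exact D]|].
    - intros s. cbv beta. f_equal. ring.
    - replace (0 + RtoC t * 1)%C with (RtoC t) by ring. ring. }
  destruct (nint_antiderivative 0 1 _ _ (fun s => P (RtoC s)) lt_0_1 HI) as (la & lb & L1 & L2 & EI).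
  { intros t H1 H2. simpl in H2. apply Rr; lra. }
  destruct (corner_integrand_bound a d b 1 x Y kappa delta kp Hdel Gap) as (K1 & K10 & B1).
  assert (Gap2 : forall z, rectangle delta z -> cut_gap kappa (1 - x - z * - x)).
  { intros z [Hz1 Hz2]. replace (1 - x - z * - x)%C with (1 - (1 - z) * x)%C by ring.
    apply Gap. split.
    - unfold Re in *; simpl; lra.
    - replace (Im (1 - z)) with (- Im z) by (unfold Im; simpl; ring). rewrite Rabs_Ropp. exact Hz2. }
  destruct (corner_integrand_bound d a b (1 - x) (- x) (- Y) kappa delta kp Hdel Gap2) as (K2 & K20 & B2).
  set (G2 := corner_integrand d a b (1 - x) (- x) (- Y)) in *.
  assert (Bmu : forall w u, 0 <= u <= 1 -> Rabs w <= delta ->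
     1 / 2 <= Re (1 + RtoC u * (apex w - 1)) <= 1 /\
     Rabs (Im (1 + RtoC u * (apex w - 1))) < 2 * delta).
  { intros w u Hu Hw. split.
    - unfold Re; simpl. lra.
    - replace (Im (1 + RtoC u * (apex w - 1))) with (u * w) by (unfold Im; simpl; ring).
      rewrite Rabs_mult, Rabs_right by lra. pose proof (Rabs_pos w). nra. }
  assert (L3 : clim (at_right 0) (fun t => P (RtoC t * m)%C) la).
  { apply (corner_limit P G m (Re a) K1 la Ha K10); auto.
    intros t u Ht Hu. destruct (Bmu v u Hu Hv) as [A1 A2]. fold m in A1, A2.
    assert (E : (RtoC t + RtoC u * (RtoC t * (m - 1)))%C = (RtoC t * (1 + RtoC u * (m - 1)))%C) by ring.
    split.
    - apply HP. split; rewrite E.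
      + replace (Re (RtoC t * (1 + RtoC u * (m - 1)))) with (t * Re (1 + RtoC u * (m - 1)))
          by (unfold Re; simpl; ring). nra.
      + replace (Im (RtoC t * (1 + RtoC u * (m - 1)))) with (t * Im (1 + RtoC u * (m - 1)))
          by (unfold Im; simpl; ring).
        rewrite Rabs_mult, Rabs_right by lra.
        pose proof (Rabs_pos (Im (1 + RtoC u * (m - 1)))). nra.
    - rewrite E. apply B1; auto. }
  assert (Hv' : Rabs (- v) <= delta) by (rewrite Rabs_Ropp; exact Hv).
  assert (L2' : clim (at_right 0) (fun t => P (1 - RtoC t)%C) lb).
  { intros eps He. destruct (L2 eps He) as [de Hde]. exists de. intros y By Hy.
    rewrite <- RtoC_minus. apply Hde; [|lra].
    change (Rabs (1 - y - 1) < de). change (Rabs (y - 0) < de) in By.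
    replace (1 - y - 1) with (- (y - 0)) by ring. rewrite Rabs_Ropp. exact By. }
  assert (L4 : clim (at_right 0) (fun t => P (1 - RtoC t * m')%C) lb).
  { apply (corner_limit (fun z => P (1 - z)%C) (fun z => - (Cexp Y * G2 z))%C m' (Re d)
      (Cmod (Cexp Y) * K2) lb Hd); auto.
    { apply Rmult_le_pos; auto. apply Cmod_ge_0. }
    intros t u Ht Hu. destruct (Bmu (- v) u Hu Hv') as [A1 A2]. fold m' in A1, A2.
    assert (E : (RtoC t + RtoC u * (RtoC t * (m' - 1)))%C = (RtoC t * (1 + RtoC u * (m' - 1)))%C) by ring.
    split.
    - set (q := (- (RtoC t * (m' - 1)))%C).
      assert (E2 : forall u, (1 - (RtoC t + RtoC u * (RtoC t * (m' - 1))))%C = (1 - RtoC t + RtoC u * q)%C)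
        by (intros; unfold q; ring).
      eapply cder_val.
      + apply (cder_ext (fun s => P (1 - RtoC t + RtoC s * q)%C)).
        { intros s. f_equal. symmetry. apply E2. }
        apply HP.
        split; rewrite <- E2, E.
        * replace (Re (1 - RtoC t * (1 + RtoC u * (m' - 1)))) with (1 - t * Re (1 + RtoC u * (m' - 1)))
            by (unfold Re; simpl; ring). nra.
        * replace (Im (1 - RtoC t * (1 + RtoC u * (m' - 1)))) with (- (t * Im (1 + RtoC u * (m' - 1))))
            by (unfold Im; simpl; ring).
          rewrite Rabs_Ropp, Rabs_mult, Rabs_right by lra.
          pose proof (Rabs_pos (Im (1 + RtoC u * (m' - 1)))). nra.
      + rewrite <- E2. unfold G. rewrite corner_reflect. fold G2. unfold q. ring.
    - rewrite E, Cmod_opp, Cmod_mult, Rmult_assoc. apply Rmult_le_compat_l; [apply Cmod_ge_0|].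
      apply B2; auto. }
  assert (Side : forall s w, 0 < s <= 1 -> Rabs w <= delta -> 0 < s * (1 / 2) < 1 /\ Rabs (s * w) < 2 * delta).
  { intros s w Hs Hw. split; [lra|]. rewrite Rabs_mult, Rabs_right by lra. pose proof (Rabs_pos w). nra. }
  assert (D1 : forall s, 0 < s <= 1 -> cder (fun s => P (RtoC s * m)%C) s (m * G (RtoC s * m))%C).
  { intros s Hs. destruct (Side s v Hs Hv) as [S1 S2].
    assert (E : (0 + RtoC s * m)%C = (s * (1 / 2), s * v)%R)
      by (apply C_ext; unfold m, apex; simpl; ring).
    pose proof (HP 0%C m s (Rect _ _ _ _ _ E S1 S2)) as D.
    eapply cder_val; [eapply cder_ext; [|exact D]|].
    - intros u. cbv beta. f_equal. ring.
    - replace (0 + RtoC s * m)%C with (RtoC s * m)%C by ring. reflexivity. }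
  assert (D2 : forall s, 0 < s <= 1 ->
    cder (fun s => P (1 - RtoC s * m')%C) s (- (Cexp Y * (m' * G2 (RtoC s * m'))))%C).
  { intros s Hs. destruct (Side s (- v) Hs Hv') as [S1 S2].
    assert (E : (1 + RtoC s * - m')%C = (1 - s * (1 / 2), - (s * - v))%R)
      by (apply C_ext; unfold m', apex; simpl; ring).
    pose proof (HP 1%C (- m')%C s (Rect _ _ _ _ _ E ltac:(lra) ltac:(rewrite Rabs_Ropp; exact S2))) as D.
    eapply cder_val; [eapply cder_ext; [|exact D]|].
    - intros u. cbv beta. f_equal. ring.
    - replace (1 + RtoC s * - m')%C with (1 - RtoC s * m')%C by ring.
      unfold G. rewrite corner_reflect. fold G2. ring. }
  exists (P m - la)%C, (/ Cexp Y * (lb - P m))%C. split; [|split].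
  - exists (fun s => P (RtoC s * m)%C), la, (P m). split; [|split; [|split]]; auto.
    + intros t H1 H2. simpl in H2. apply D1; lra.
    + intros eps He. apply filter_le_within.
      replace (P m) with (P (RtoC 1 * m)%C) by (f_equal; ring).
      apply (cder_cont _ _ _ _ (D1 1 ltac:(lra)) He).
  - exists (fun s => - / Cexp Y * P (1 - RtoC s * m'))%C, (- / Cexp Y * lb)%C, (- / Cexp Y * P m)%C.
    split; [|split; [|split]].
    + intros t H1 H2. simpl in H2. eapply cder_val; [apply cder_scal, D2; lra|].
      fold m'. field. apply Cexp_neq_0.
    + apply clim_scal; auto. typeclasses eauto.
    + apply (clim_scal (at_left 1)). intros eps He. apply filter_le_within.
      replace (P m) with (P (1 - RtoC 1 * m')%C) by (f_equal; rewrite <- Em; ring).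
      apply (cder_cont _ _ _ _ (D2 1 ltac:(lra)) He).
    + ring.
  - rewrite EI. field. apply Cexp_neq_0.
Qed.

(** * The Kampe de Feriet coefficients *)

(** Taylor coefficients of (1 - z)^(-alpha) (1 - X z)^(-beta) e^(y z). *)
Definition taylor_coef (alpha beta X y : C) : nat -> C :=
  convolution (bin_coef alpha)
    (convolution (fun n => bin_coef beta n * X ^ n)%C (fun n => y ^ n / Cfact n)%C).

Lemma poch_opp_nat n k : (k <= n)%nat ->
  (poch (- RtoC (INR n)) k * Cfact (n - k))%C = ((- (1)) ^ k * Cfact n)%C.
Proof.
  induction k as [|k IH]; intros Hk.
  - rewrite Nat.sub_0_r. simpl. ring.
  - rewrite poch_S.
    assert (E : Cfact (n - k) = (RtoC (INR (n - k)) * Cfact (n - S k))%C).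
    { replace (n - k)%nat with (S (n - S k)) by lia. apply Cfact_S. }
    specialize (IH ltac:(lia)). rewrite E, minus_INR, RtoC_minus in IH by lia.
    simpl Cpow.
    transitivity (- (1) * (poch (- RtoC (INR n)) k * ((RtoC (INR n) - RtoC (INR k)) * Cfact (n - S k))))%C;
      [ring|]. rewrite IH. ring.
Qed.

(** Since (-n)_(r+s) = (-1)^(r+s) n! / (n-r-s)!, the factor y^n turns the (r, s) term
    into a product of binomial coefficients and the term y^(n-r-s) / (n-r-s)! of the
    exponential series. *)
Lemma KdF_taylor n alpha beta X y : y <> RtoC 0 ->
  (y ^ n * KdF n alpha beta (- (1 / y)) (- (X / y)))%C = (Cfact n * taylor_coef alpha beta X y n)%C.
Proof.
  intros Hy.
  unfold KdF. change (sum_n ?f n) with (partial_sum f (S n)).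
  unfold taylor_coef, convolution at 1.
  rewrite <- !partial_sum_scal. apply partial_sum_ext. intros r Hr.
  change (sum_n ?f (n - r)) with (partial_sum f (S (n - r))).
  unfold convolution. rewrite <- !partial_sum_scal. apply partial_sum_ext. intros s Hs.
  pose proof (poch_opp_nat n (r + s) ltac:(lia)) as P.
  assert (N1 : forall k, Cfact k <> RtoC 0) by apply Cfact_neq_0.
  replace (n - r - s)%nat with (n - (r + s))%nat by lia.
  replace (poch (- RtoC (INR n)) (r + s))%C
    with ((- (1)) ^ (r + s) * Cfact n / Cfact (n - (r + s)))%C by (rewrite <- P; field; auto).
  assert (Ey : (y ^ n)%C = (y ^ (n - (r + s)) * (y ^ r * y ^ s))%C).
  { rewrite <- !Cpow_add_r. f_equal. lia. }
  rewrite Ey, Cpow_add_r.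
  assert (Yr : ((- (1 / y)) ^ r * ((- (1)) ^ r * y ^ r))%C = 1%C).
  { rewrite <- !Cpow_mult_l. replace (- (1 / y) * (- (1) * y))%C with (RtoC 1) by (field; auto).
    clear. induction r as [|r IH]; [reflexivity|]. simpl. rewrite IH. ring. }
  assert (Ys : ((- (X / y)) ^ s * ((- (1)) ^ s * y ^ s))%C = (X ^ s)%C).
  { rewrite <- !Cpow_mult_l. f_equal. field; auto. }
  unfold bin_coef. rewrite <- Ys.
  transitivity (y ^ (n - (r + s)) * Cfact n / Cfact (n - (r + s)) * poch alpha r * poch beta s / Cfact r / Cfact s
     * ((- (X / y)) ^ s * ((- (1)) ^ s * y ^ s)) * ((- (1 / y)) ^ r * ((- (1)) ^ r * y ^ r)))%C.
  - field. auto.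
  - rewrite Yr. field. auto.
Qed.

Lemma ccontR_const k t : ccontR (fun _ => k) t.
Proof. exact (cder_ccontR _ t _ (cder_const k t)). Qed.

Lemma ccontR_plus f g t : ccontR f t -> ccontR g t -> ccontR (fun s => f s + g s)%C t.
Proof.
  intros [A B] [A' B']. split; simpl; apply (continuous_plus (V := R_NormedModule)); auto.
Qed.

Lemma ccontR_partial_sum (f : nat -> R -> C) N t : (forall n, ccontR (f n) t) ->
  ccontR (fun s => partial_sum (fun n => f n s) N) t.
Proof.
  intros H. induction N as [|N IH].
  - apply ccontR_const.
  - destruct (ccontR_plus _ _ t IH (H N)) as [A B].
    split; [eapply continuous_ext; [|exact A]|eapply continuous_ext; [|exact B]];
      intros s; cbv beta; rewrite partial_sum_S; reflexivity.
Qed.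

Lemma ccontR_taylor_coef alpha beta X sg n t :
  ccontR (fun t => taylor_coef alpha beta X (RtoC t * sg) n) t.
Proof.
  unfold taylor_coef, convolution at 1.
  apply (ccontR_partial_sum (fun r t => bin_coef alpha r *
    convolution (fun n => bin_coef beta n * X ^ n) (fun n => (RtoC t * sg) ^ n / Cfact n) (n - r))%C).
  intros r. apply ccontR_mult; [apply ccontR_const|]. unfold convolution.
  apply (ccontR_partial_sum (fun s t => bin_coef beta s * X ^ s * ((RtoC t * sg) ^ (n - r - s) / Cfact (n - r - s)))%C).
  intros s. apply ccontR_mult; [apply ccontR_const|].
  pose proof (ccontR_scal_pow (/ Cfact (n - r - s)) sg (n - r - s) t) as [A B].
  split; [eapply continuous_ext; [|exact A]|eapply continuous_ext; [|exact B]];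
    intros u; cbv beta; f_equal; unfold Cdiv; ring.
Qed.

(** The limit at 0 in the definition is taken along the real axis, where continuity
    of the polynomial determines it. *)
Lemma extend0_taylor g alpha beta X sg n y :
  (forall y, y <> RtoC 0 -> g y = (Cfact n * taylor_coef alpha beta X (y * sg) n)%C) ->
  extend0 g y = (Cfact n * taylor_coef alpha beta X (y * sg) n)%C.
Proof.
  intros Hg. unfold extend0. destruct (Ceq_dec y 0) as [->|Hy]; [|auto].
  pose proof (ccontR_mult _ _ 0 (ccontR_const (Cfact n) 0) (ccontR_taylor_coef alpha beta X sg n 0)) as [C1 C2].
  assert (E : forall t, t <> 0 -> (Cfact n * taylor_coef alpha beta X (RtoC t * sg) n)%C = g (t, 0)).
  { intros t Ht. symmetry. apply (Hg (RtoC t)). apply RtoC_neq_0, Ht. }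
  unfold C_lim. apply C_ext; simpl.
  - rewrite (is_lim_unique _ 0 (fst (Cfact n * taylor_coef alpha beta X (RtoC 0 * sg) n)%C)); [reflexivity|].
    eapply is_lim_ext_loc; [|apply (is_lim_continuity (fun t => fst (Cfact n * taylor_coef alpha beta X (RtoC t * sg) n)%C) 0)].
    + exists (mkposreal 1 Rlt_0_1). intros t _ Ht. rewrite E by auto. reflexivity.
    + apply continuity_pt_filterlim, C1.
  - rewrite (is_lim_unique _ 0 (snd (Cfact n * taylor_coef alpha beta X (RtoC 0 * sg) n)%C)); [reflexivity|].
    eapply is_lim_ext_loc; [|apply (is_lim_continuity (fun t => snd (Cfact n * taylor_coef alpha beta X (RtoC t * sg) n)%C) 0)].
    + exists (mkposreal 1 Rlt_0_1). intros t _ Ht. rewrite E by auto. reflexivity.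
    + apply continuity_pt_filterlim, C2.
Qed.

Lemma coef_origin_taylor a b c x y n :
  coef_origin a b c x y n = taylor_coef (a - c + 1) b x y n.
Proof.
  unfold coef_origin. rewrite (extend0_taylor _ (a - c + 1) b x 1 n y).
  - replace (y * 1)%C with y by ring. field. apply Cfact_neq_0.
  - intros z Hz. rewrite KdF_taylor by auto. replace (z * 1)%C with z by ring. reflexivity.
Qed.

Lemma coef_one_taylor a b x y n : x <> RtoC 1 ->
  coef_one a b x y n = taylor_coef (1 - a) b (x / (x - 1)) (- y) n.
Proof.
  intros Hx. unfold coef_one. rewrite (extend0_taylor _ (1 - a) b (x / (x - 1)) (- (1)) n y).
  - replace (y * - (1))%C with (- y)%C by ring. field. apply Cfact_neq_0.
  - intros z Hz.
    assert (Nx : (x - 1)%C <> RtoC 0).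
    { intros E. apply Hx. replace x with (x - 1 + 1)%C by ring. rewrite E. ring. }
    replace (z * - (1))%C with (- z)%C by ring.
    rewrite <- KdF_taylor.
    + f_equal. f_equal; field; auto.
    + intros E. apply Hz. replace z with (- - z)%C by ring. rewrite E. ring.
Qed.

(** * The compound expansion *)

Lemma slit_plane_of_arg x : x <> RtoC 1 -> Rabs (Carg (1 - x)) < PI -> slit_plane x.
Proof.
  intros Hx Ha [H1 H2].
  assert (L : 1 < Re x).
  { destruct H2 as [L|E]; auto. exfalso. apply Hx. apply C_ext; simpl; unfold Re, Im in *; auto. }
  assert (E : (1 - x)%C = RtoC (1 - Re x)) by (apply C_ext; unfold Re, Im in *; simpl; lra).
  rewrite E in Ha. unfold Carg in Ha. simpl in Ha.
  destruct (Rle_dec 0 0) as [_|N]; [|lra].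
  rewrite Cmod_R, (Rabs_left (1 - Re x)) in Ha by lra.
  replace ((1 - Re x) / - (1 - Re x)) with (- (1)) in Ha by (field; lra).
  rewrite acos_opp, acos_1, Rminus_0_r in Ha. pose proof PI_RGT_0.
  rewrite Rabs_right in Ha by lra. lra.
Qed.

Lemma convolution_scal_l k c d n :
  convolution (fun n => k * c n)%C d n = (k * convolution c d n)%C.
Proof.
  unfold convolution. rewrite <- partial_sum_scal. apply partial_sum_ext. intros; ring.
Qed.

Lemma expansion_ext m A B c d : (forall s, 0 < s <= 1 -> A s = B s) -> (forall n, c n = d n) ->
  has_expansion m A c -> has_expansion m B d.
Proof.
  intros E1 E2 H N. destruct (H N) as [K HK]. exists K. intros s Hs.
  rewrite <- E1, <- (partial_sum_ext (fun n => c n * (RtoC s * m) ^ n)%C); auto.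
  intros n _. rewrite E2. reflexivity.
Qed.

(** The factors of the corner integrand that are regular at the corner; the singular
    power and the oscillation are left to Watson's lemma. *)
Definition corner_amplitude (d b p e y m : C) (s : R) : C :=
  (Cpower (1 - RtoC s * m) (d - 1) * (Cpower (p - RtoC s * m * e) (- b) * Cexp (RtoC s * m * y)))%C.

Lemma corner_amplitude_expansion d b p e y v kappa delta :
  0 < kappa -> 0 < delta -> Rabs v <= delta ->
  cut_gap kappa p ->
  (forall z, rectangle delta z -> cut_gap kappa (p - z * e)) ->
  has_expansion (apex v) (corner_amplitude d b p e y (apex v))
    (fun n => Cpower p (- b) * taylor_coef (1 - d) b (e / p) y n)%C.
Proof.
  intros kp Hd Hv Gp Gap.
  set (m := apex v).
  assert (X1 : has_expansion m (fun s => Cpower (1 - RtoC s * (m * 1)) (- (1 - d)))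
     (fun n => Cpower 1 (- (1 - d)) * (bin_coef (1 - d) n * (1 / 1) ^ n))%C).
  { apply (expansion_power m (1 / 2)); [lra|]. intros s Hs. unfold cut_gap.
    pose proof (Cmod_ge_0 (1 - RtoC s * (m * 1))).
    assert (Re (1 - RtoC s * (m * 1)) = 1 - s / 2) by (unfold Re, m, apex; simpl; field). lra. }
  assert (X2 : has_expansion m (fun s => Cpower (p - RtoC s * (m * e)) (- b))
     (fun n => Cpower p (- b) * (bin_coef b n * (e / p) ^ n))%C).
  { apply (expansion_power m kappa); [lra|]. intros s Hs.
    replace (p - RtoC s * (m * e))%C with (p - RtoC s * m * e)%C by ring.
    destruct (Req_dec s 0) as [->|Ns].
    - replace (p - RtoC 0 * m * e)%C with p by ring. exact Gp.
    - apply Gap. split.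
      + unfold Re, m, apex; simpl. lra.
      + replace (Im (RtoC s * m)) with (s * v) by (unfold Im, m, apex; simpl; ring).
        rewrite Rabs_mult, Rabs_right by lra. pose proof (Rabs_pos v). nra. }
  eapply expansion_ext; [| |apply (expansion_mult m _ _ _ _ X1 (expansion_mult m _ _ _ _ X2 (expansion_exp m y)))].
  - intros s Hs. unfold corner_amplitude. fold m.
    replace (- (1 - d))%C with (d - 1)%C by ring. replace (m * 1)%C with m by ring.
    replace (p - RtoC s * (m * e))%C with (p - RtoC s * m * e)%C by ring. reflexivity.
  - intros n. unfold taylor_coef, convolution at 1 3. rewrite <- partial_sum_scal.
    apply partial_sum_ext. intros k _. rewrite convolution_scal_l, Cpower_one.
    replace (1 / 1)%C with (RtoC 1) by field.
    assert (O : (1 ^ k)%C = 1%C) by (clear; induction k as [|k IH]; [reflexivity|]; simpl; rewrite IH; ring).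
    rewrite O. ring.
Qed.

Lemma corner_integrand_amplitude a d b p e y lambda m s :
  (m * corner_integrand a d b p e (y + Ci * RtoC lambda) (RtoC s * m))%C =
  (m * Cpower (RtoC s * m) (a - 1) * corner_amplitude d b p e y m s
   * Cexp (Ci * RtoC lambda * (RtoC s * m)))%C.
Proof.
  unfold corner_integrand, corner_amplitude.
  replace (RtoC s * m * (y + Ci * RtoC lambda))%C
    with (RtoC s * m * y + Ci * RtoC lambda * (RtoC s * m))%C by ring.
  rewrite Cexp_plus. ring.
Qed.

(** The apex has to lie on the side of the real axis on which e^(i lambda z) decays,
    so its position, and with it the constants, depend on the sign of lambda. *)
Lemma humbert_integral_asymptotic a d b x y N sg : 0 < Re a -> 0 < Re d ->
  x <> RtoC 1 -> slit_plane x -> sg = 1 \/ sg = -1 ->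
  exists K1 K2, 0 <= K1 /\ 0 <= K2 /\ forall lambda, 0 < lambda * sg ->
    exists E1 E2,
    humbert_integral a d b x (y + Ci * RtoC lambda) =
      (partial_sum (fun n => taylor_coef (1 - d) b x y n * CGamma (a + RtoC (INR n))
          * Cpower (- Ci * RtoC lambda) (- a - RtoC (INR n))) N + E1
       + Cexp (y + Ci * RtoC lambda) *
         (partial_sum (fun n => Cpower (1 - x) (- b) * taylor_coef (1 - a) b (x / (x - 1)) (- y) n
            * CGamma (d + RtoC (INR n)) * Cpower (Ci * RtoC lambda) (- d - RtoC (INR n))) N + E2))%C /\
    Cmod E1 <= K1 * Rpower (Rabs lambda) (- Re a - INR N) /\
    Cmod E2 <= K2 * Rpower (Rabs lambda) (- Re d - INR N).
Proof.
  intros Ha Hd Hx1 Hx Hsg.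
  destruct (slit_gap x Hx) as (kappa & kp & Gap0).
  assert (k2 : kappa <= 2).
  { specialize (Gap0 0 ltac:(lra)). unfold cut_gap in Gap0.
    replace (1 - RtoC 0 * x)%C with (RtoC 1) in Gap0 by ring.
    rewrite Cmod_R, Rabs_R1 in Gap0. simpl in Gap0. lra. }
  pose proof (Cmod_ge_0 x) as X0.
  (* moving z by less than 2 delta off the axis moves 1 - z x by at most kappa / 4 *)
  set (delta := kappa / (8 * (Cmod x + 1))).
  assert (dp : 0 < delta) by (unfold delta; apply Rdiv_lt_0_compat; lra).
  assert (dx : delta * (8 * (Cmod x + 1)) = kappa) by (unfold delta; field; lra).
  assert (d1 : delta <= 1) by nra.
  assert (Gap : forall z, rectangle delta z -> cut_gap (kappa / 2) (1 - z * x)).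
  { intros z [[Hz1 Hz2] Hz3]. apply (cut_gap_near kappa (1 - RtoC (Re z) * x)).
    - apply Gap0. lra.
    - replace (1 - z * x - (1 - RtoC (Re z) * x))%C with (- (Ci * RtoC (Im z) * x))%C.
      2:{ apply C_ext; unfold Re, Im; simpl; ring. }
      rewrite Cmod_opp, !Cmod_mult, Cmod_Ci, Cmod_R. nra. }
  assert (Gap2 : forall z, rectangle delta z -> cut_gap (kappa / 2) (1 - x - z * - x)).
  { intros z [Hz1 Hz2]. replace (1 - x - z * - x)%C with (1 - (1 - z) * x)%C by ring.
    apply Gap. split.
    - unfold Re in *; simpl; lra.
    - replace (Im (1 - z)) with (- Im z) by (unfold Im; simpl; ring). rewrite Rabs_Ropp. exact Hz2. }
  set (v := sg * delta).
  assert (Hv : Rabs v <= delta).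
  { unfold v. rewrite Rabs_mult, (Rabs_right delta) by lra.
    replace (Rabs sg) with 1; [lra|]. destruct Hsg as [->| ->]; [rewrite Rabs_R1; auto|].
    rewrite Rabs_left by lra. ring. }
  assert (Hv' : Rabs (- v) <= delta) by (rewrite Rabs_Ropp; exact Hv).
  assert (Nv : v <> 0) by (unfold v; destruct Hsg as [->| ->]; lra).
  assert (k1 : 0 < kappa / 2) by lra.
  assert (G1 : cut_gap (kappa / 2) 1).
  { unfold cut_gap. rewrite Cmod_1. simpl. lra. }
  assert (G1x : cut_gap (kappa / 2) (1 - x)).
  { specialize (Gap0 1 ltac:(lra)). unfold cut_gap in *.
    replace (1 - RtoC 1 * x)%C with (1 - x)%C in Gap0 by ring. lra. }
  pose proof (corner_amplitude_expansion d b 1 x y v (kappa / 2) delta k1 dp Hv G1 Gap) as X1.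
  pose proof (corner_amplitude_expansion a b (1 - x) (- x) (- y) (- v) (kappa / 2) delta k1 dp Hv' G1x Gap2) as X2.
  destruct (watson a (apex v) _ _ N Ha ltac:(unfold Re; simpl; lra) Nv X1) as (K1 & K10 & W1).
  destruct (watson d (apex (- v)) _ _ N Hd ltac:(unfold Re; simpl; lra)
    ltac:(unfold Im, apex; simpl; lra) X2) as (K2 & K20 & W2).
  exists K1, K2. split; [auto|]. split; [auto|]. intros lambda Hl.
  destruct (humbert_integral_deformed a d b x (y + Ci * RtoC lambda) (kappa / 2) delta v Ha Hd Hx k1
    (conj dp d1) Gap Hv) as (J1 & J2 & I1 & I2 & E).
  assert (Lv : 0 < lambda * v) by (unfold v; nra).
  specialize (W1 lambda J1 Lv).
  assert (Lv' : 0 < - lambda * Im (apex (- v))) by (unfold Im, apex; simpl; lra).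
  specialize (W2 (- lambda) J2 Lv').
  rewrite Rabs_Ropp in W2.
  match goal with |- exists E1 E2, _ = (?T1 + E1 + _ * (?T2 + E2))%C /\ _ /\ _ =>
    exists (J1 - T1)%C, (J2 - T2)%C end.
  split; [|split].
  - rewrite E. ring.
  - eapply Rle_trans; [|apply W1].
    + right. f_equal. f_equal. apply partial_sum_ext. intros n _.
      rewrite Cpower_one. replace (x / 1)%C with x by field.
      replace (- Ci * RtoC lambda)%C with (- (Ci * RtoC lambda))%C by ring. ring.
    + eapply nint_ext; [|exact I1]. intros s _ _. apply corner_integrand_amplitude.
  - eapply Rle_trans; [|apply W2].
    + right. f_equal. f_equal. apply partial_sum_ext. intros n _.
      replace (- (Ci * RtoC (- lambda)))%C with (Ci * RtoC lambda)%C by (rewrite RtoC_opp; ring).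
      replace (- x / (1 - x))%C with (x / (x - 1))%C; [reflexivity|].
      field. split.
      * intros E0. apply Hx1. replace x with (1 - (1 - x))%C by ring. rewrite E0. ring.
      * intros E0. apply Hx1. replace x with (x - 1 + 1)%C by ring. rewrite E0. ring.
    + eapply nint_ext; [|exact I2]. intros s _ _.
      replace (- (y + Ci * RtoC lambda))%C with (- y + Ci * RtoC (- lambda))%C
        by (rewrite RtoC_opp; ring).
      apply corner_integrand_amplitude.
Qed.

Open Scope C_scope.

Theorem theorem3p5 (a b c x y : C)
  (ha : (0 < Re a)%R) (hc : (Re a < Re c)%R)
  (hx1 : x <> RtoC 1) (hx : (Rabs (Carg (1 - x)) < PI)%R) :
  forall N : nat, exists K L : R, forall lambda : R, (L < Rabs lambda)%R ->
    (Cmod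
       (Phi1 a b c x (y + Ci * RtoC lambda)
        - (CGamma c / CGamma (c - a)
             * partial_sum (fun n =>
                 coef_origin a b c x y n * poch a n
                   * Cpower (- Ci * RtoC lambda) (- a - RtoC (INR n))) N
           + CGamma c / CGamma a * Cpower (1 - x) (- b)
             * Cexp (y + Ci * RtoC lambda)
             * partial_sum (fun n =>
                 coef_one a b x y n * poch (c - a) n
                   * Cpower (Ci * RtoC lambda) (a - c - RtoC (INR n))) N))%C
     <= K * (Rpower (Rabs lambda) (- Re a - INR N)
             + Rpower (Rabs lambda) (Re a - Re c - INR N)))%R.
Proof.
  intros N. pose proof (slit_plane_of_arg x hx1 hx) as Sx.
  set (d := c - a).
  assert (Ed : c = a + d) by (unfold d; ring).
  assert (hd : (0 < Re d)%R) by (unfold d, Re in *; simpl; lra).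
  assert (Er : (Re a - Re c - INR N)%R = (- Re d - INR N)%R) by (unfold d, Re; simpl; ring).
  rewrite Er.
  assert (hc0 : (0 < Re c)%R) by lra.
  destruct (humbert_integral_asymptotic a d b x y N 1 ha hd hx1 Sx (or_introl eq_refl))
    as (K1 & K2 & K10 & K20 & HP).
  destruct (humbert_integral_asymptotic a d b x y N (-1) ha hd hx1 Sx (or_intror eq_refl))
    as (K3 & K4 & K30 & K40 & HM).
  pose proof (Beta_neq_0 a d ha hd) as NB.
  pose proof (CGamma_neq_0 a ha) as Na. pose proof (CGamma_neq_0 d hd) as Nd.
  pose proof (Beta_Gamma a d ha hd) as BG. rewrite <- Ed in BG.
  assert (IB : (/ Beta a d)%C = CGamma c / (CGamma a * CGamma d)).
  { rewrite <- BG. field. split; [apply CGamma_neq_0; auto|auto]. }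
  set (B := Cmod (/ Beta a d)). assert (B0 : (0 <= B)%R) by apply Cmod_ge_0.
  set (ey := exp (Re y)). assert (ey0 : (0 < ey)%R) by apply exp_pos.
  exists (B * ((K1 + K3) + ey * (K2 + K4)))%R, 0%R. intros lambda Hl.
  assert (Hex : exists E1 E2,
    humbert_integral a d b x (y + Ci * RtoC lambda) =
      (partial_sum (fun n => taylor_coef (1 - d) b x y n * CGamma (a + RtoC (INR n))
          * Cpower (- Ci * RtoC lambda) (- a - RtoC (INR n))) N + E1
       + Cexp (y + Ci * RtoC lambda) *
         (partial_sum (fun n => Cpower (1 - x) (- b) * taylor_coef (1 - a) b (x / (x - 1)) (- y) n
            * CGamma (d + RtoC (INR n)) * Cpower (Ci * RtoC lambda) (- d - RtoC (INR n))) N + E2))%C /\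
    (Cmod E1 <= (K1 + K3) * Rpower (Rabs lambda) (- Re a - INR N))%R /\
    (Cmod E2 <= (K2 + K4) * Rpower (Rabs lambda) (- Re d - INR N))%R).
  { pose proof (Rpower_pos (Rabs lambda) (- Re a - INR N)).
    pose proof (Rpower_pos (Rabs lambda) (- Re d - INR N)).
    destruct (Rlt_dec 0 lambda) as [P|P].
    - destruct (HP lambda ltac:(lra)) as (E1 & E2 & E & H1 & H2).
      exists E1, E2. split; [exact E|]. split; nra.
    - assert (lambda <> 0)%R by (intros ->; rewrite Rabs_R0 in Hl; lra).
      destruct (HM lambda ltac:(lra)) as (E1 & E2 & E & H1' & H2).
      exists E1, E2. split; [exact E|]. split; nra. }
  destruct Hex as (E1 & E2 & E & H1 & H2).
  assert (EP : Phi1 a b c x (y + Ci * RtoC lambda)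
     = humbert_integral a d b x (y + Ci * RtoC lambda) / Beta a d)
    by (rewrite Ed at 1; apply Phi1_humbert_integral; auto).
  rewrite EP, E.
  set (S1 := partial_sum (fun n => coef_origin a b c x y n * poch a n
      * Cpower (- Ci * RtoC lambda) (- a - RtoC (INR n))) N).
  set (S2 := partial_sum (fun n => coef_one a b x y n * poch d n
      * Cpower (Ci * RtoC lambda) (a - c - RtoC (INR n))) N).
  rewrite (partial_sum_ext _ (fun n => CGamma a * (coef_origin a b c x y n * poch a n
      * Cpower (- Ci * RtoC lambda) (- a - RtoC (INR n)))) N).
  2:{ intros n _. rewrite coef_origin_taylor, CGamma_poch by auto.
      replace (a - c + 1) with (1 - d) by (unfold d; ring). ring. }
  rewrite (partial_sum_ext (fun n => Cpower (1 - x) (- b) * _ * _ * _) (fun n => Cpower (1 - x) (- b) * CGamma d * (coef_one a b x y n * poch d n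
      * Cpower (Ci * RtoC lambda) (a - c - RtoC (INR n)))) N).
  2:{ intros n _. rewrite coef_one_taylor, CGamma_poch by auto.
      replace (a - c - RtoC (INR n)) with (- d - RtoC (INR n)) by (unfold d; ring). ring. }
  rewrite !partial_sum_scal. fold S1 S2.
  set (ex := Cexp (y + Ci * RtoC lambda)).
  assert (Mex : Cmod ex = ey).
  { unfold ex, ey. rewrite Cmod_Cexp. f_equal. unfold Re; simpl; ring. }
  match goal with |- (Cmod ?z <= _)%R => replace z with (/ Beta a d * (E1 + ex * E2)) end.
  2:{ unfold Cdiv at 1. rewrite IB. field. auto. }
  rewrite Cmod_mult. fold B. rewrite Rmult_assoc. apply Rmult_le_compat_l; auto.
  eapply Rle_trans; [apply Cmod_triangle|]. rewrite Cmod_mult, Mex.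
  pose proof (Rpower_pos (Rabs lambda) (- Re a - INR N)).
  pose proof (Rpower_pos (Rabs lambda) (- Re d - INR N)).
  set (U := Rpower (Rabs lambda) (- Re a - INR N)) in *.
  set (W := Rpower (Rabs lambda) (- Re d - INR N)) in *.
  assert (ey * Cmod E2 <= ey * ((K2 + K4) * W))%R by (apply Rmult_le_compat_l; lra).
  assert (0 <= (K1 + K3) * W)%R by (apply Rmult_le_pos; lra).
  assert (0 <= ey * (K2 + K4) * U)%R by (apply Rmult_le_pos; [apply Rmult_le_pos|]; lra).
  nra.
Qed.
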